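(* Let $q:\mathbf{R}^n_x\times\mathbf{R}^n_\xi\to\mathbf{C}$ be a complex-valued quadratic form such that $\mathrm{Re}\, q$ is positive definite, and assume that the Hamilton map $F$ of $q$ is diagonalizable. Let $\Omega\subset\subset\mathbf{C}$ (a relatively compact subset of $\mathbf{C}$). Then there exist $h_0>0$ and $A>0$ such that for all $h\in(0,h_0]$ and all $z\in\Omega$ with $z\notin\mathrm{Spec}(q^w(x,hD_x))$, $$\left\| \left(q^w(x,hD_x)-z\right)^{-1}\right\|_{\mathcal{L}(L^2(\mathbf{R}^n),L^2(\mathbf{R}^n))}\leq \frac{A\,e^{A/h}}{\mathrm{dist}\,(z,\mathrm{Spec}(q^w(x,hD_x)))}.$$
   Context: For $0<h\leq 1$, $q^w(x,hD_x)$ denotes the semiclassical Weyl quantization of $q$: with $D_{x_j}=\frac1i\partial_{x_j}$, the monomials $x_jx_k$, $\xi_j\xi_k$, $x_j\xi_k$ are quantized as multiplication by $x_jx_k$, as $hD_{x_j}hD_{x_k}$, and as $\frac12(x_j\,hD_{x_k}+hD_{x_k}\,x_j)$ respectively, extended by complex linearity. It is viewed as a closed densely defined operator on $L^2(\mathbf{R}^n)$ with domain $\{u\in L^2(\mathbf{R}^n);\ q^w(x,hD_x)u\in L^2(\mathbf{R}^n)\}$. Its spectrum is discrete. The Hamilton map $F:\mathbf{C}^{2n}\to\mathbf{C}^{2n}$ of $q$ is the linear map defined by $q(X,Y)=\sigma(X,FY)$ for all $X,Y\in\mathbf{C}^{2n}$, where $q(X,Y)$ is the polarization of $q$ (symmetric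 bilinear form on $\mathbf{C}^{2n}$) and $\sigma((x,\xi),(y,\eta))=\xi\cdot y-x\cdot\eta$ is the complex symplectic form; equivalently $F(x,\xi)=\frac12(q'_\xi(x,\xi),-q'_x(x,\xi))$. *)

(* Defs.v *)
From HB Require Import structures.
From mathcomp Require Import all_boot all_order all_algebra.
From mathcomp Require Import complex.
From mathcomp Require Import all_classical all_reals all_analysis.

Set Implicit Arguments.
Unset Strict Implicit.
Unset Printing Implicit Defensive.

Import Order.TTheory GRing.Theory Num.Theory.
Import numFieldNormedType.Exports.

Local Open Scope classical_set_scope.
Local Open Scope ring_scope.
Local Open Scope complex_scope.

(* R^n is 'rV[R]_n, with its library topology (sup norm) and the product
   sigma-algebra of the Borel sets of R, generated by the coordinates. *)
Section row_measurable.
Variables (R : realType) (n : nat).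

Let coord (i : 'I_n) (x : 'rV[R]_n) : measurableTypeR R := x ord0 i.

Let row_set0 : g_sigma_preimage coord set0.
Proof. exact: sigma_algebra0. Qed.

Let row_setC A : g_sigma_preimage coord A -> g_sigma_preimage coord (~` A).
Proof. exact: sigma_algebraC. Qed.

Let row_bigcup (F : _^nat) : (forall i, g_sigma_preimage coord (F i)) ->
  g_sigma_preimage coord (\bigcup_i (F i)).
Proof. exact: sigma_algebra_bigcup. Qed.

HB.instance Definition _ := @isMeasurable.Build default_measure_display
  'rV[R]_n (g_sigma_preimage coord) row_set0 row_setC row_bigcup.

Lemma measurable_row_coord (i : 'I_n) :
  measurable_fun [set: 'rV[R]_n] (fun x => x ord0 i : measurableTypeR R).
Proof.
move=> _ Y mY; rewrite setTI; apply: sub_sigma_algebra => /=.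
rewrite -bigcup_seq/=; exists i => /=; first by rewrite mem_index_enum.
by exists Y => //; rewrite setTI.
Qed.

Lemma measurable_fun_row d (T : measurableType d) (f : T -> 'rV[R]_n) :
  (forall i, measurable_fun [set: T] (fun t => f t ord0 i : measurableTypeR R)) ->
  measurable_fun [set: T] f.
Proof.
move=> mf; have H : g_sigma_preimage (fun i => coord i \o f) `<=` measurable.
  apply: smallest_sub; first exact: sigma_algebra_measurable.
  move=> A; rewrite -bigcup_seq => -[i _ [B mB <-]]; exact: mf.
by move=> _ A mA; apply: H; rewrite g_sigma_preimage_comp; exists A.
Qed.

End row_measurable.

Section row_cons.
Variables (R : realType) (n : nat).

Definition row_cons (p : measurableTypeR R * 'rV[R]_n) : 'rV[R]_n.+1 :=
  row_mx p.1%:M p.2.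

Definition row_uncons (x : 'rV[R]_n.+1) : measurableTypeR R * 'rV[R]_n :=
  (x ord0 ord0, \row_i x ord0 (lift ord0 i)).

Lemma row_consK : cancel row_cons row_uncons.
Proof.
move=> [t y]; rewrite /row_uncons /row_cons/=; congr (_, _).
  have -> : (ord0 : 'I_n.+1) = lshift n (ord0 : 'I_1) by apply: val_inj.
  by rewrite (row_mxEl t%:M y ord0 ord0) mxE eqxx mulr1n.
apply/rowP => i; rewrite mxE.
have -> : lift ord0 i = rshift 1 i by apply: val_inj.
by rewrite (row_mxEr t%:M y ord0 i).
Qed.

Lemma measurable_row_cons : measurable_fun [set: _] row_cons.
Proof.
apply: measurable_fun_row => i; rewrite /row_cons.
case: (@split_ordP 1 n i) => j ->.
  rewrite (_ : (fun _ => _) = fst); first exact: measurable_fst.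
  apply/funext => p.
  by rewrite (row_mxEl (p.1%:M : 'M[R]_1) p.2 ord0 j) mxE (ord1 j) eqxx mulr1n.
rewrite (_ : (fun _ => _) =
    fun p : measurableTypeR R * 'rV[R]_n => p.2 ord0 j); last first.
  by apply/funext => p; rewrite (row_mxEr (p.1%:M : 'M[R]_1) p.2 ord0 j).
by apply: (measurableT_comp (measurable_row_coord j)); exact: measurable_snd.
Qed.

Lemma measurable_row_uncons : measurable_fun [set: _] row_uncons.
Proof.
apply/measurable_fun_pairP; split => /=; first exact: measurable_row_coord.
apply: measurable_fun_row => i.
rewrite (_ : (fun _ => _) = fun x : 'rV[R]_n.+1 => x ord0 (lift ord0 i)).
  exact: measurable_row_coord.
by apply/funext => x; rewrite /= mxE.
Qed.

End row_cons.

Section lebesgue_cons.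
Variables (R : realType) (n : nat).
Variable m : {sigma_finite_measure set 'rV[R]_n -> \bar R}.
Local Open Scope ereal_scope.

Definition lebesgue_cons : set 'rV[R]_n.+1 -> \bar R :=
  pushforward (@lebesgue_measure R \x m) (@row_cons R n).

Let lebesgue_cons0 : lebesgue_cons set0 = 0.
Proof. by rewrite /lebesgue_cons /pushforward preimage_set0 measure0. Qed.

Let lebesgue_cons_ge0 A : 0 <= lebesgue_cons A.
Proof. by rewrite /lebesgue_cons /pushforward; exact: measure_ge0. Qed.

Let lebesgue_cons_sigma_additive : semi_sigma_additive lebesgue_cons.
Proof.
pose mf := @measurable_row_cons R n.
move=> F mF tF mUF; rewrite /lebesgue_cons /pushforward preimage_bigcup.
apply: measure_semi_sigma_additive.
- by move=> k; rewrite -[X in measurable X]setTI; exact: mf.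
- apply/trivIsetP => /= i j _ _ ij; rewrite -preimage_setI.
  by move/trivIsetP : tF => /(_ _ _ _ _ ij) ->//; rewrite preimage_set0.
- by rewrite -preimage_bigcup -[X in measurable X]setTI; exact: mf.
Qed.

HB.instance Definition _ := isMeasure.Build _ _ _ lebesgue_cons
  lebesgue_cons0 lebesgue_cons_ge0 lebesgue_cons_sigma_additive.

Let lebesgue_cons_sigma_finite : sigma_finite setT lebesgue_cons.
Proof.
have /sigma_finiteP[F [FT ndF Foo]] := sigma_finiteT (@lebesgue_measure R).
have /sigma_finiteP[G [GT ndG Goo]] := sigma_finiteT m.
exists (fun k => @row_uncons R n @^-1` (F k `*` G k)).
  rewrite -preimage_bigcup (_ : \bigcup_i _ = setT) ?preimage_setT//.
  rewrite -setXTT FT GT predeqE => -[x y]; split.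
    by move=> [k _ []/= ? ?]; split; exists k.
  move=> [/= [k _ Fkx] [l _ Gly]]; exists (maxn k l) => //; split.
  - by move: x Fkx; exact/subsetPset/ndF/leq_maxl.
  - by move: y Gly; exact/subsetPset/ndG/leq_maxr.
move=> k; have [mF Fkoo] := Foo k; have [mG Gkoo] := Goo k; split.
  rewrite -[X in measurable X]setTI; apply: measurable_row_uncons => //.
  exact: measurableX.
rewrite /lebesgue_cons /pushforward -comp_preimage.
rewrite (_ : @row_uncons R n \o _ = id); last first.
  by apply/funext => p /=; exact: row_consK.
by rewrite preimage_id product_measure1E// lte_mul_pinfty// ge0_fin_numE.
Qed.

HB.instance Definition _ := Measure_isSigmaFinite.Build _ _ _ lebesgue_cons
  lebesgue_cons_sigma_finite.

End lebesgue_cons.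

Fixpoint lebesgue_Rn (R : realType) (n : nat) :
    {sigma_finite_measure set 'rV[R]_n -> \bar R} :=
  if n is n'.+1 then lebesgue_cons (lebesgue_Rn R n') else \d_(0 : 'rV[R]_0).

Section functions_on_Rn.
Variables (R : realType) (n : nat).
Implicit Types (g : 'rV[R]_n -> R) (u f : 'rV[R]_n -> R[i]).

Definition integralC u : R[i] :=
  Rintegral (lebesgue_Rn R n) setT (fun x => complex.Re (u x)) +i*
  Rintegral (lebesgue_Rn R n) setT (fun x => complex.Im (u x)).

(* Elements of L^2(R^n; C) are represented by functions; equality in L^2 is
   almost everywhere equality [L2eq]. *)
Definition L2 : set ('rV[R]_n -> R[i]) :=
  [set u | (fun x => complex.Re (u x)) \in Lfun (lebesgue_Rn R n) 2%:E /\
           (fun x => complex.Im (u x)) \in Lfun (lebesgue_Rn R n) 2%:E].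

Definition L2eq u v := {ae lebesgue_Rn R n, forall x, u x = v x}.

Definition L2norm u : \bar R :=
  Lnorm (lebesgue_Rn R n) 2%:E (fun x => (Normc.normc (u x))%:E).

Definition ebase (j : 'I_n) : 'rV[R]_n := delta_mx ord0 j.

Fixpoint Ck (k : nat) g : Prop :=
  if k is k'.+1 then
    continuous g /\ forall j : 'I_n,
      (forall x, derivable g x (ebase j)) /\
      Ck k' (fun x => 'D_(ebase j) g x)
  else continuous g.

Definition partialC (j : 'I_n) u : 'rV[R]_n -> R[i] := fun x =>
  'D_(ebase j) (fun y => complex.Re (u y)) x +i*
  'D_(ebase j) (fun y => complex.Im (u y)) x.

Definition test_function : set ('rV[R]_n -> R[i]) :=
  [set phi | [/\ forall k, Ck k (fun x => complex.Re (phi x)),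
                 forall k, Ck k (fun x => complex.Im (phi x)) &
                 compact (closure [set x | phi x != 0])]].

(* Distributions are functionals that are only ever compared on
   [test_function]. *)
Definition distribution := ('rV[R]_n -> R[i]) -> R[i].

Definition distr_of u : distribution :=
  fun phi => integralC (fun x => u x * phi x).

Definition mulx (j : 'I_n) (T : distribution) : distribution :=
  fun phi => T (fun x => (x ord0 j)%:C * phi x).

(* h D_j with D_j = (1/i) d/dx_j and <d_j T, phi> = - <T, d_j phi> *)
Definition hD (h : R) (j : 'I_n) (T : distribution) : distribution :=
  fun phi => h%:C / 'i * - T (partialC j phi).

End functions_on_Rn.

Section unbounded_operators.
Variables (R : realType) (n : nat).
Local Notation fT := ('rV[R]_n -> R[i]).

(* An unbounded operator on L^2(R^n) is given by its graph: [P u f] means that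
   u is in the domain of P and P u = f. *)
Definition operator : Type := fT -> fT -> Prop.
Implicit Type P : operator.

(* The graph of (P - z)^-1: [resolvent P z f u] means that u is in the domain
   of P and (P - z) u = f. *)
Definition resolvent P (z : R[i]) : operator :=
  fun f u => exists2 g, P u g & f = (fun x => g x - z * u x).

Definition bijective_op (B : operator) :=
  (forall f, L2 f -> exists u, B f u) /\
  (forall f1 f2 u1 u2, B f1 u1 -> B f2 u2 -> L2eq f1 f2 -> L2eq u1 u2).

Definition opnorm (B : operator) : \bar R :=
  ereal_sup [set t | exists f u, [/\ B f u, (L2norm f <= 1)%E & t = L2norm u]].

Definition resolvent_set P : set R[i] :=
  [set z | bijective_op (resolvent P z) /\ (opnorm (resolvent P z) < +oo)%E].

Definition spectrum P : set R[i] := ~` resolvent_set P.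

End unbounded_operators.

Definition distC (R : realType) (z : R[i]) (S : set R[i]) : R :=
  inf [set Normc.normc (z - w) | w in S].

(* A point (x, xi) of phase space is the row vector [row_mx x xi]. *)
Section quadratic_forms.
Variables (R : realType) (n : nat).
Implicit Type q : 'rV[R]_(n + n) -> R[i].

Definition quadratic_form q := exists c : 'M[R[i]]_(n + n), forall X,
  q X = \sum_a \sum_b c a b * (X ord0 a)%:C * (X ord0 b)%:C.

Definition Re_positive_definite q :=
  forall X, X != 0 -> 0 < complex.Re (q X).

Definition polar_mx q : 'M[R[i]]_(n + n) := \matrix_(a, b)
  ((q (delta_mx ord0 a + delta_mx ord0 b)
    - q (delta_mx ord0 a) - q (delta_mx ord0 b)) / 2).

Definition polar q (X Y : 'rV[R[i]]_(n + n)) : R[i] :=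
  (X *m polar_mx q *m Y^T) ord0 ord0.

Definition symplectic_form (X Y : 'rV[R[i]]_(n + n)) : R[i] :=
  \sum_(j < n) (rsubmx X ord0 j * lsubmx Y ord0 j
                - lsubmx X ord0 j * rsubmx Y ord0 j).

(* Linear maps act on row vectors by right multiplication. *)
Definition hamilton_map q (F : 'M[R[i]]_(n + n)) :=
  forall X Y : 'rV[R[i]]_(n + n), polar q X Y = symplectic_form X (Y *m F).

(* The coefficient of x_j xi_k in q is twice the polarization of q at the
   corresponding basis vectors. *)
Definition weyl q (h : R) (T : distribution R n) : distribution R n :=
  fun phi => \sum_j \sum_k
    (ulsubmx (polar_mx q) j k * mulx j (mulx k T) phi
     + drsubmx (polar_mx q) j k * hD h j (hD h k T) phi
     + (ursubmx (polar_mx q) j k *+ 2) *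
         ((mulx j (hD h k T) phi + hD h k (mulx j T) phi) / 2)).

(* q^w(x, hD) on its maximal domain: u and q^w u, computed in the sense of
   distributions, both belong to L^2. *)
Definition weyl_op q (h : R) : operator R n := fun u f =>
  [/\ L2 u, L2 f & forall phi, test_function phi ->
    weyl q h (distr_of u) phi = distr_of f phi].

End quadratic_forms.

(* Main.v *)
(* Write q = X Q X^t and let Pol be the space of polynomials times a complex Gaussian
   exp (- x M x / 2h), where the Lagrangian plane annihilating the Gaussian is the sum of the
   eigenspaces of F on one side of the real axis.  On Pol the transposed operator T is, since F is
   diagonalizable, a sum of commuting number operators with weights kap, so it is diagonal with
   eigenvalues z_nu = z_0 + h sum_i kap_i nu_i.  The positivity of Re Q gives an a priori estimate
   that confines approximate solutions of (T - z) w = r to degrees N <= C / h, where the spectral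
   projections cost at most exp (C N); this yields |w| <= A e^(A/h) / min |z_nu - z| |(T - z) w|
   together with the surjectivity of T - z on Pol.

   If (P - z) u = f in L^2, testing against (T - z) w, w in Pol (smooth cutoffs), and the density of
   Pol in L^2 transfer the estimate to u.  Every z_nu is in Spec P, because (P - z_nu) has range
   orthogonal to an eigenvector of T; hence dist (z, Spec P) <= min |z_nu - z|.  Finally dist is
   positive since the resolvent set is open (Neumann series), which matters because x / 0 = 0. *)

Require Import Defs.
From HB Require Import structures.
From mathcomp Require Import all_boot all_order all_algebra.
From mathcomp Require Import complex.
From mathcomp Require Import all_classical all_reals all_analysis measurable_realfun.
From mathcomp Require mpoly.
Import -(notations) mpoly.
From mathcomp Require Import ring lra zify.

Set Implicit Arguments.
Unset Strict Implicit.
Unset Printing Implicit Defensive.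

Import Order.TTheory GRing.Theory Num.Theory.
Import numFieldNormedType.Exports.

Local Open Scope classical_set_scope.
Local Open Scope ring_scope.

(** * Quadratic forms and matrices *)

Local Notation "A ^H" := ((map_mx (@conjc _) A)^T) (at level 8, format "A ^H").

Section complex_facts.
Variable R : rcfType.
Implicit Types x y z : R[i].

(** Two gradings of Pol coexist. Words in the [g i] diagonalize T but are not orthogonal; words in
    the conjugates of the annihilators of the Gaussian are graded orthogonally by a Hermitian
    oscillator H. Both induce the same filtration by degree, and T preserves it. This lets high
    degrees be treated with H alone and low ones with the spectral projections. H equals h N in
    degree N and Re T dominates a multiple of H, so beyond a constant over h one has Re T >= |z| +
    1. A spectral projection in degree at most N is a Lagrange interpolation polynomial in number
    operators of norm O(N) there, and x^N / N! <= e^x keeps its norm exponential in N; this is the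
    source of exp (A / h). Diagonalizability makes T - z act on an eigenvector exactly as z_nu - z,
    so dist enters to the power one. Duality is taken for the bilinear pairing, the integral of u w
    without conjugation, which is the pairing of distributions: T has symbol q (x, - xi), and
    neither the adjoint of P nor its domain has to be identified. *)

Definition sqc z : R := complex.Re z ^+ 2 + complex.Im z ^+ 2.

Lemma sqc_ge0 z : 0 <= sqc z. Proof. by rewrite addr_ge0 ?sqr_ge0. Qed.

Lemma sqc_eq0 z : (sqc z == 0) = (z == 0).
Proof. by case: z => a b; rewrite /sqc paddr_eq0 ?sqr_ge0// !sqrf_eq0 eq_complex. Qed.

Lemma sqcM x y : sqc (x * y) = sqc x * sqc y.
Proof. by case: x y => [a b] [c d]; rewrite /sqc /=; ring. Qed.

Lemma sqcV x : sqc x^-1 = (sqc x)^-1.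
Proof.
have [->|x0] := eqVneq x 0; first by rewrite invr0 /sqc /= expr0n/= addr0 invr0.
apply: (mulIf (x := sqc x)); first by rewrite sqc_eq0.
by rewrite -sqcM !mulVf ?sqc_eq0// /sqc /= expr0n expr1n addr0.
Qed.

Lemma sqcX x k : sqc (x ^+ k) = sqc x ^+ k.
Proof.
elim: k => [|k IH]; first by rewrite !expr0 /sqc /= expr0n expr1n addr0.
by rewrite !exprS sqcM IH.
Qed.

Lemma sqcJ x : sqc x^*%C = sqc x.
Proof. by case: x => a b; rewrite /sqc /= sqrrN. Qed.

Lemma normc_sqr z : Normc.normc z ^+ 2 = sqc z.
Proof. by case: z => a b /=; rewrite sqr_sqrtr // addr_ge0 ?sqr_ge0. Qed.

Lemma ReD x y : complex.Re (x + y) = complex.Re x + complex.Re y.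
Proof. by case: x y => [? ?] [? ?]. Qed.

Lemma ImD x y : complex.Im (x + y) = complex.Im x + complex.Im y.
Proof. by case: x y => [? ?] [? ?]. Qed.

Lemma ReN x : complex.Re (- x) = - complex.Re x.
Proof. by case: x. Qed.

Lemma ImN x : complex.Im (- x) = - complex.Im x.
Proof. by case: x. Qed.

Lemma Re_sum (I : Type) (r : seq I) (P : pred I) (f : I -> R[i]) :
  complex.Re (\sum_(i <- r | P i) f i) = \sum_(i <- r | P i) complex.Re (f i).
Proof. exact: (big_morph _ ReD erefl). Qed.

Lemma ReM x y : complex.Re (x * y) =
  complex.Re x * complex.Re y - complex.Im x * complex.Im y.
Proof. by case: x y => [? ?] [? ?]. Qed.

Lemma ImM x y : complex.Im (x * y) =
  complex.Re x * complex.Im y + complex.Im x * complex.Re y.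
Proof. by case: x y => [? ?] [? ?]. Qed.

Lemma ReJ x : complex.Re x^*%C = complex.Re x. Proof. by case: x. Qed.
Lemma ImJ x : complex.Im x^*%C = - complex.Im x. Proof. by case: x. Qed.

Lemma Re_le_normc z : complex.Re z <= Normc.normc z.
Proof.
case: z => a b /=; apply: (le_trans (ler_norm a)).
by rewrite -sqrtr_sqr ler_sqrt ?lerDl ?addr_ge0 ?sqr_ge0.
Qed.

Lemma conjc_mxK m n (A : 'M[R[i]]_(m, n)) : A^H^H = A.
Proof. by apply/matrixP => i j; rewrite !mxE conjcK. Qed.

Lemma ctrM m n p (A : 'M[R[i]]_(m, n)) (B : 'M[R[i]]_(n, p)) : (A *m B)^H = B^H *m A^H.
Proof. by rewrite map_mxM trmx_mul. Qed.

End complex_facts.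

Section posdef.
Variables (R : realType) (m : nat).

Definition qf (A : 'M[R]_m) (X : 'rV[R]_m) : R := (X *m A *m X^T) ord0 ord0.

Lemma qfE A X : qf A X = \sum_a \sum_b A a b * X ord0 b * X ord0 a.
Proof.
rewrite /qf mxE exchange_big /=; apply: eq_bigr => b _.
rewrite !mxE big_distrl/=; apply: eq_bigr => a _; ring.
Qed.

(** No compactness of the sphere is involved: [V a] represents the a-th coordinate for the form,
    Cauchy-Schwarz against it bounds each squared coordinate by a multiple of the form, and these
    bounds are summed. *)
Lemma posdef_lower (A : 'M[R]_m) : A^T = A ->
  (forall X : 'rV[R]_m, X != 0 -> 0 < qf A X) ->
  exists2 c, 0 < c & forall X : 'rV[R]_m, c * \sum_a X ord0 a ^+ 2 <= qf A X.
Proof.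
move=> As Apos.
have qf_ge0 X : 0 <= qf A X.
  have [->|/Apos/ltW//] := eqVneq X 0.
  by rewrite /qf !mul0mx mxE.
have Au : A \in unitmx.
  rewrite -row_free_unit -kermx_eq0; apply/rowV0P => v /sub_kermxP vA.
  apply/eqP; apply/negP => /negP/Apos; by rewrite /qf vA mul0mx mxE ltxx.
pose V a : 'rV[R]_m := delta_mx ord0 a *m invmx A.
have XV (X : 'rV[R]_m) a : (X *m A *m (V a)^T) ord0 ord0 = X ord0 a.
  rewrite /V trmx_mul trmx_inv As -mulmxA mulKVmx//.
  by rewrite trmx_delta -colE mxE.
have VX (X : 'rV[R]_m) a : (V a *m A *m X^T) ord0 ord0 = X ord0 a.
  by rewrite /V mulmxKV// -rowE !mxE.
have CS (X : 'rV[R]_m) a : X ord0 a ^+ 2 <= qf A X * qf A (V a).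
  have H t : 0 <= qf A X - 2 * t * X ord0 a + t ^+ 2 * qf A (V a).
    have := qf_ge0 (X - t *: V a); rewrite /qf.
    suff -> : ((X - t *: V a) *m A *m (X - t *: V a)^T) ord0 ord0 =
     qf A X - 2 * t * X ord0 a + t ^+ 2 * qf A (V a) by [].
    rewrite [(X - t *: V a)^T]linearB /= [(t *: V a)^T]linearZ /=.
    rewrite !mulmxBl !mulmxBr -!scalemxAl -!scalemxAr.
    have E (P1 P2 P3 P4 : 'M[R]_1) : (P1 - t *: P2 - (t *: P3 - t *: (t *: P4))) ord0 ord0
       = P1 ord0 ord0 - t * P2 ord0 ord0 - t * P3 ord0 ord0 + t ^+ 2 * P4 ord0 ord0.
      by rewrite !mxE; ring.
    by rewrite E VX XV /qf; ring.
  have [Va0|Va0] := eqVneq (qf A (V a)) 0.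
    rewrite Va0 mulr0.
    have [->|xa] := eqVneq (X ord0 a) 0; first by rewrite expr0n.
    (* With a vanishing quadratic coefficient this t makes the polynomial equal to -1. *)
    have := H ((qf A X + 1) / (2 * X ord0 a)).
    rewrite Va0 mulr0 addr0 (_ : 2 * _ * _ = qf A X + 1); first by lra.
    by field.
  have Vp : 0 < qf A (V a) by rewrite lt_neqAle eq_sym Va0 qf_ge0.
  have := H (X ord0 a / qf A (V a)).
  rewrite (_ : _ + _ = (qf A X * qf A (V a) - X ord0 a ^+ 2) / qf A (V a)).
    by rewrite pmulr_lge0 ?invr_gt0// subr_ge0.
  by field.
pose S := \sum_a qf A (V a).
have S0 : 0 <= S by apply: sumr_ge0.
(* The summand 1 keeps the constant positive when m = 0. *)
exists (1 + S)^-1; first by rewrite invr_gt0; lra.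
move=> X; rewrite mulrC ler_pdivrMr; last lra.
apply: (@le_trans _ _ (\sum_a qf A X * qf A (V a))).
  by apply: ler_sum => a _.
by rewrite -mulr_sumr ler_wpM2l// /S lerDr.
Qed.

(** Write v = X + i Y. Since A is symmetric, Im A contributes the antisymmetric sum [Z] = 0, so the
    real part of the Hermitian expression is Re A at X plus Re A at Y. *)
Lemma posdef_lowerC (A : 'M[R[i]]_m) : A^T = A ->
  (forall X : 'rV[R]_m, X != 0 -> 0 < qf (map_mx (@complex.Re R) A) X) ->
  exists2 c, 0 < c & forall v : 'I_m -> R[i],
    c * \sum_a sqc (v a) <= complex.Re (\sum_a \sum_b A a b * v b * (v a)^*%C).
Proof.
move=> As Apos; set A1 := map_mx _ A in Apos.
have A1s : A1^T = A1 by apply/matrixP => i j; rewrite !mxE -[in RHS]As mxE.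
have [c c0 H] := posdef_lower A1s Apos; exists c => // v.
pose X : 'rV[R]_m := \row_a complex.Re (v a).
pose Y : 'rV[R]_m := \row_a complex.Im (v a).
suff -> : complex.Re (\sum_a \sum_b A a b * v b * (v a)^*%C) = qf A1 X + qf A1 Y.
  apply: le_trans (lerD (H X) (H Y)); rewrite -mulrDr -big_split/=.
  by rewrite le_eqVlt; apply/orP; left; apply/eqP; congr (_ * _); apply: eq_bigr => a _; rewrite !mxE.
pose Z := \sum_a \sum_b complex.Im (A a b) *
  (complex.Im (v b) * complex.Re (v a) - complex.Re (v b) * complex.Im (v a)).
have Z0 : Z = 0.
  have : Z = - Z.
    rewrite {1}/Z exchange_big /= -sumrN; apply: eq_bigr => a _.
    rewrite -sumrN; apply: eq_bigr => b _.
    have -> : A b a = A a b by rewrite -{2}As mxE.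
    ring.
  lra.
rewrite !qfE -big_split/= -[RHS]subr0 -[X in _ - X]Z0 /Z -sumrB Re_sum.
apply: eq_bigr => a _; rewrite -big_split -sumrB Re_sum/=; apply: eq_bigr => b _.
rewrite !mxE !ReM ImM ReJ ImJ; ring.
Qed.

End posdef.

(** * A Lyapunov argument: sign of a Hermitian form on the spectral halves of a diagonal matrix *)

Section lyapunov.
Variables (R : realType) (m : nat).
Implicit Types (H : 'M[R[i]]_m) (k : 'I_m -> R[i]) (s : 'rV[R[i]]_m).

Definition hform H s (t : 'rV[R[i]]_m) : R[i] := (s *m H *m t^H) ord0 ord0.

Lemma hformE H s (t : 'rV[R[i]]_m) :
  hform H s t = \sum_a \sum_b s ord0 a * H a b * (t ord0 b)^*%C.
Proof.
rewrite /hform mxE exchange_big /=; apply: eq_bigr => b _.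
by rewrite !mxE big_distrl /=.
Qed.

Let act k s : 'rV[R[i]]_m := \row_j (k j * s ord0 j).

Lemma expr_le1_cvg0 (r : R) : 0 <= r -> r < 1 -> (r ^+ t @[t --> \oo] --> 0).
Proof. by move=> r0 r1; apply: cvg_expr; rewrite ger0_norm. Qed.

(* The Cayley transform s |-> (1 - K)^-1 (1 + K) s contracts the components
   with Re k < 0 and strictly decreases the form H; since its iterates tend
   to 0, the form is positive. *)
Lemma lyapunov_pos H k : H^H = H ->
  (forall s, s != 0 -> complex.Re (hform H (act k s) s) < 0) ->
  forall s, s != 0 -> (forall j, s ord0 j != 0 -> complex.Re (k j) < 0) ->
  0 < complex.Re (hform H s s).
Proof.
move=> HH Hneg s s0 sk.
have hC x y : complex.Re (hform H x y) = complex.Re (hform H y x).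
  rewrite -[RHS]ReJ; congr complex.Re; rewrite /hform.
  transitivity (((y *m H *m x^H)^H) ord0 ord0); last by rewrite !mxE.
  by rewrite !ctrM conjc_mxK HH mulmxA.
have cayley w : w != 0 ->
    complex.Re (hform H (w + act k w) (w + act k w)) <
    complex.Re (hform H (w - act k w) (w - act k w)).
  move=> w0; have Hw := Hneg _ w0.
  have hD x y z : hform H (x + y) z = hform H x z + hform H y z.
    by rewrite /hform !mulmxDl mxE.
  have hN x z : hform H (- x) z = - hform H x z.
    by rewrite /hform !mulNmx mxE.
  have hDr x y z : hform H z (x + y) = hform H z x + hform H z y.
    by rewrite /hform map_mxD linearD /= mulmxDr mxE.
  have hNr x z : hform H z (- x) = - hform H z x.
    by rewrite /hform map_mxN linearN /= mulmxN mxE.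
  rewrite !(hD, hDr, hN, hNr) !(ReD, ReN) (hC w (act k w)); lra.
(* The value 0 elsewhere gives every multiplier a modulus less than 1; the vectors considered vanish
   on those components. *)
pose tau j := if complex.Re (k j) < 0 then (1 + k j) / (1 - k j) else 0.
have k1 j : complex.Re (k j) < 0 -> 1 - k j != 0.
  move=> kj; apply/eqP => /(congr1 (@complex.Re R)); rewrite ReD ReN /=; lra.
pose step s : 'rV[R[i]]_m := \row_j (tau j * s ord0 j).
pose supp s := forall j, s ord0 j != 0 -> complex.Re (k j) < 0.
have step_supp x : supp x -> supp (step x).
  by move=> sx j; rewrite mxE mulf_eq0 => /norP[_ /sx].
have step_lt x : supp x -> x != 0 ->
    complex.Re (hform H (step x) (step x)) < complex.Re (hform H x x).
  move=> sx x0; pose w : 'rV[R[i]]_m := \row_j (x ord0 j / (1 - k j)).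
  have xE : x = w - act k w.
    apply/rowP => j; rewrite !mxE.
    have [->|xj] := eqVneq (x ord0 j) 0; first by rewrite mul0r mulr0 subr0.
    by have /k1 H1 := sx _ xj; field.
  have stE : step x = w + act k w.
    apply/rowP => j; rewrite !mxE /tau.
    have [->|xj] := eqVneq (x ord0 j) 0; first by rewrite mul0r !mulr0 addr0.
    by have H2 := sx _ xj; have H1 := k1 _ H2; rewrite H2; field.
  rewrite stE [in ltRHS]xE; apply: cayley; apply: contra_neq x0 => w0.
  by rewrite xE w0; apply/rowP => j; rewrite !mxE mulr0 subr0.
have step_le x : supp x ->
    complex.Re (hform H (step x) (step x)) <= complex.Re (hform H x x).
  move=> sx; have [x0|x0] := eqVneq x 0; last exact/ltW/step_lt.
  by rewrite (_ : step x = x)// x0; apply/rowP => j; rewrite !mxE mulr0.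
pose phi t := complex.Re (hform H (iter t step s) (iter t step s)).
have suppt t : supp (iter t step s) by elim: t => // t IH; exact: step_supp.
have phi_dec : nonincreasing_seq phi.
  by apply/nonincreasing_seqP => t; exact: (step_le _ (suppt t)).
have tau1 j : sqc (tau j) < 1.
  rewrite /tau; case: ifPn => [kj|_]; last by rewrite /sqc /= expr0n addr0.
  have k1j := k1 _ kj.
  rewrite sqcM sqcV ltr_pdivrMr ?mul1r; last by rewrite lt_neqAle eq_sym sqc_eq0 k1j sqc_ge0.
  by rewrite /sqc !ReD !ImD ReN ImN /=; nra.
have iterE t j : iter t step s ord0 j = tau j ^+ t * s ord0 j.
  elim: t => [|t IH]; first by rewrite expr0 mul1r.
  by rewrite iterS mxE IH mulrA exprS.
have phi0 : phi @ \oo --> 0.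
  have -> : phi = fun t => \sum_a \sum_b complex.Re
      (tau a ^+ t * (tau b ^+ t)^*%C * (s ord0 a * H a b * (s ord0 b)^*%C)).
    apply/funext => t; rewrite /phi hformE Re_sum.
    apply: eq_bigr => a _; rewrite Re_sum; apply: eq_bigr => b _.
    by rewrite !iterE rmorphM; congr complex.Re; ring.
  rewrite [X in _ --> X](_ : 0 = \sum_(a < m) \sum_(b < m) (0 : R)); last first.
    by rewrite big1// => a _; rewrite big1.
  apply: cvg_big => [|a _]; first exact: add_continuous.
  apply: cvg_big => [|b _]; first exact: add_continuous.
  move: (s ord0 a * _ * _) => c.
  apply/cvgr0Pnorm_lt => /= e e0; near=> t.
  have T1 : sqc (tau a) ^+ t * sqc c < e ^+ 2.
    near: t.
    have : (sqc (tau a) ^+ t * sqc c) @[t --> \oo] --> 0 * sqc c.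
      by apply: cvgMr_tmp; apply: expr_le1_cvg0 => //; exact: sqc_ge0.
    rewrite mul0r => /cvgr0Pnorm_lt /(_ (e ^+ 2)) /=.
    move=> /(_ (exprn_gt0 _ e0)); apply: filterS => t.
    by apply: le_lt_trans; exact: ler_norm.
  rewrite -(ltr_pXn2r (n := 2)) ?nnegrE// ?ltW// real_normK ?num_real//.
  apply: (le_lt_trans _ T1).
  apply: (@le_trans _ _ (sqc (tau a ^+ t * (tau b ^+ t)^*%C * c))).
    by rewrite /sqc lerDl sqr_ge0.
  rewrite !sqcM sqcJ !sqcX; apply: ler_wpM2r; first exact: sqc_ge0.
  apply: ler_piMr; first by rewrite exprn_ge0 ?sqc_ge0.
  by apply: exprn_ile1; [exact: sqc_ge0 | exact/ltW].
(* The sequence decreases to 0, so it is nonnegative from index 1 on; the strict decrease of the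
   first step then makes the form positive at s. *)
have phi1 : 0 <= phi 1%N.
  rewrite -(cvg_lim _ phi0)//; apply: nonincreasing_cvgn_ge => //.
  by apply/cvg_ex; exists 0.
exact: (le_lt_trans phi1 (step_lt _ sk s0)).
Unshelve. all: by end_near. Qed.

Lemma hformN H s (t : 'rV[R[i]]_m) : hform (- H) s t = - hform H s t.
Proof. by rewrite /hform mulmxN mulNmx mxE. Qed.

(** At a basis vector the form is k j times the real number [H j j], so Re (k j) cannot vanish. The
    positive half is the negative one for the pair - H, - k. *)
Lemma lyapunov_sign H k : H^H = H ->
  (forall s, s != 0 -> complex.Re (hform H (act k s) s) < 0) ->
  [/\ forall j, complex.Re (k j) != 0,
      forall s, s != 0 -> (forall j, s ord0 j != 0 -> complex.Re (k j) < 0) ->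
        hform H s s != 0 &
      forall s, s != 0 -> (forall j, s ord0 j != 0 -> 0 < complex.Re (k j)) ->
        hform H s s != 0].
Proof.
move=> HH Hneg; split.
- move=> j; apply/negP => /eqP kj.
  have d0 : (delta_mx ord0 j : 'rV[R[i]]_m) != 0.
    by apply/eqP => /rowP /(_ j); rewrite !mxE !eqxx => /eqP; rewrite oner_eq0.
  have := Hneg _ d0.
  have Hr : complex.Im (H j j) = 0.
    have := congr1 (fun A : 'M[R[i]]_m => complex.Im (A j j)) HH.
    rewrite !mxE ImJ; lra.
  rewrite hformE (bigD1 j)//= (bigD1 j)//= !mxE !eqxx /= !big1 ?addr0.
  + by rewrite mulr1 oppr0 (_ : Complex 1 0 = 1)// mulr1 ReM kj Hr mulr0 mul0r subr0 ltxx.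
  + move=> a aj; rewrite big1// => b _; rewrite !mxE eqxx (negbTE aj) /=.
    by rewrite mulr0 !mul0r.
  + by move=> b bj; rewrite !mxE eqxx (negbTE bj) /= oppr0 (_ : Complex 0 0 = 0)// mulr0.
- move=> s s0 sk; have := lyapunov_pos HH Hneg s0 sk.
  by apply: contraPneq => ->; rewrite ltxx.
- move=> s s0 sk.
  have NHH : (- H)^H = - H by rewrite map_mxN linearN/= HH.
  have := @lyapunov_pos (- H) (fun j => - k j) NHH _ s s0.
  rewrite hformN ReN => L.
  suff : 0 < - complex.Re (hform H s s).
    by apply: contraPneq => ->; rewrite oppr0 ltxx.
  apply: L => [t t0|j /sk]; last by rewrite ReN oppr_lt0.
  rewrite hformN (_ : act _ t = - act k t); last first.
    by apply/rowP => j; rewrite !mxE mulNr.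
  by rewrite /hform !mulNmx mxE opprK; apply: Hneg.
Qed.

End lyapunov.

(** * The symplectic structure of Q *)

Section anticommutation.
Variables (K : fieldType) (p : nat).
Implicit Types A B D : 'M[K]_p.

Lemma anticomm_invmx A D : A \in unitmx ->
  D *m A = - (A *m D) -> D *m invmx A = - (invmx A *m D).
Proof.
move=> Au E; apply: (can_inj (mulKmx Au)).
by rewrite mulmxN mulKVmx// mulmxA -[A *m D]opprK -E mulNmx mulmxK.
Qed.

Lemma mxrank_le_ker p1 p2 p3 (A : 'M[K]_(p1, p2)) (B : 'M[K]_(p1, p3)) :
  (kermx A <= kermx B)%MS -> (\rank B <= \rank A)%N.
Proof.
move=> /mxrankS; rewrite !mxrank_ker.
have := rank_leq_row A; have := rank_leq_row B.
by move: (\rank A) (\rank B) => a b; clear; lia.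
Qed.

Lemma row_form k l (A : 'M[K]_(k, p)) (J : 'M[K]_p) (B : 'M[K]_(l, p)) i j :
  row i A *m J *m (row j B)^T = ((A *m J *m B^T) i j)%:M.
Proof.
apply/matrixP => a b; rewrite !ord1 -row_mul [RHS]mxE eqxx mulr1n !mxE.
by apply: eq_bigr => a' _; rewrite !mxE.
Qed.

(** The left-hand side is c L J Q J L^T, a symmetric matrix, whereas L J L^T is antisymmetric;
    transposition produces the sign. When the rows of L are eigenvectors, this says that J pairs an
    eigenvalue k only with - k. *)
Lemma anticomm_form (L J Q D : 'M[K]_p) (c : K) :
  J^T = - J -> Q^T = Q -> D^T = D -> c *: (L *m J *m Q) = D *m L ->
  D *m (L *m J *m L^T) = - (L *m J *m L^T *m D).
Proof.
move=> JT QT DT LK.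
have E : D *m (L *m J *m L^T) = c *: (L *m J *m Q *m J *m L^T).
  by rewrite 2!mulmxA -LK -!scalemxAl.
rewrite E; have := congr1 trmx E; rewrite linearZ /= !trmx_mul trmxK JT QT DT.
by rewrite !(mulNmx, mulmxN) opprK !mulmxA.
Qed.

End anticommutation.

Section symplectic_structure.
Variables (R : realType) (n : nat).
Local Notation C := R[i].
Local Notation m := (n + n)%N.
Local Notation ii := ('i%C : C).

(** X J Y^T = x . eta - xi . y has the opposite sign to [symplectic_form]; it is the commutator
    pairing of the letters x and - h D of the transposed operator. *)
Definition Jmx : 'M[C]_m := block_mx 0 1%:M (- 1%:M) 0.

Lemma JmxJ : Jmx *m Jmx = - 1%:M.
Proof.
rewrite /Jmx mulmx_block !mul0mx !mulmx0 !mul1mx mulNmx mul1mx !addr0 !add0r.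
by rewrite (scalar_mx_block n n) opp_block_mx !oppr0.
Qed.

Lemma Jmx_tr : Jmx^T = - Jmx.
Proof.
by rewrite /Jmx tr_block_mx opp_block_mx !trmx0 !oppr0 opprK linearN /= !trmx1.
Qed.

Lemma Jmx_conj : map_mx (@conjc R) Jmx = Jmx.
Proof.
by rewrite /Jmx map_block_mx !map_mx0 map_mxN map_mx1.
Qed.

Lemma mul_row_Jmx k (a b : 'M[C]_(k, n)) :
  row_mx a b *m Jmx = row_mx (- b) a.
Proof.
by rewrite /Jmx mul_row_block !mulmx0 mulmxN !mulmx1 add0r addr0.
Qed.

(** With the letters x_k and i h d_k, row j stands for the operator (M x)_j + h d_j, which
    annihilates exp (- x M x / 2h). *)
Definition annmx (M : 'M[C]_n) : 'M[C]_(n, m) := row_mx M (- ii%:M).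

(** For symmetric M the right-hand side is 2 i times Re M at y: positivity of the Hermitian form - i
    l J l^H on the plane spanned by the rows is positivity of Re M. *)
Lemma annmx_form (M : 'M[C]_n) (y : 'rV[C]_n) :
  y *m annmx M *m Jmx *m (y *m annmx M)^H =
  ii *: (y *m M^H *m y^H + y *m M *m y^H).
Proof.
have -> : y *m annmx M = row_mx (y *m M) (- (ii *: y)).
  by rewrite /annmx mul_mx_row mulmxN mul_mx_scalar.
rewrite mul_row_Jmx opprK map_row_mx tr_row_mx mul_row_col ctrM mulmxA.
have -> : (- (ii *: y))^H = ii *: y^H.
  rewrite map_mxN map_mxZ linearN linearZ /= -scaleNr; congr (_ *: _).
  by apply/eqP; rewrite eq_complex /= oppr0 opprK !eqxx.
by rewrite -!scalemxAl -scalemxAr scalerDr.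
Qed.

(** The eigenvectors of l -> 2i l J Q are split by the sign of Re k. Positivity of Re Q is the
    Lyapunov inequality for the Hermitian form - i l J l^H, so this form is definite on each half,
    while vectors (x, 0) are isotropic for it. Hence each half projects injectively to the xi
    variables, and by dimension bijectively. The half Re k < 0 becomes the graph [annmx M]; the half
    Re k > 0 provides the ladder vectors [g]; the dual vectors [d] come from the inverse of the Gram
    matrix of J. *)
Lemma symplectic_structure (Q F : 'M[C]_m) :
  Q^T = Q -> (forall X : 'rV[R]_m, X != 0 -> 0 < qf (map_mx (@complex.Re R) Q) X) ->
  Q = F *m Jmx -> diagonalizable F ->
  exists (M : 'M[C]_n) (I : finType) (g d : I -> 'rV[C]_m) (kap : I -> C),
  [/\ M^T = M /\
      (forall x : 'rV[R]_n, x != 0 -> 0 < qf (map_mx (@complex.Re R) M) x),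
      forall i, 0 < complex.Re (kap i) /\
        (2 * ii) *: (g i *m Jmx *m Q) = kap i *: g i,
      forall i k, g i *m Jmx *m (g k)^T = 0 /\
        - ii *: (d i *m Jmx *m (g k)^T) = ((i == k)%:R)%:M,
      (forall i, (d i <= annmx M)%MS) /\ (annmx M *m Jmx *m Q <= annmx M)%MS &
      forall l : 'rV[C]_m, exists (a : I -> C) (y : 'rV[C]_n),
        l = \sum_i a i *: g i + y *m annmx M].
Proof.
move=> Qs Qpos QF [P Pu /(diagonalizable_forP _ Pu) FD].
pose D : 'rV[C]_m := \row_i (P *m F *m invmx P) i i.
have PF : P *m F = diag_mx D *m P.
  rewrite -[LHS](mulmxKV Pu); congr (_ *m _); apply/matrixP => i j.
  rewrite [RHS]mxE; have [<-|ij] := eqVneq i j; first by rewrite mulr1n [RHS]mxE.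
  by rewrite FD.
(* Since Q = F J and J J = -1, the rows of P J are eigenvectors of l -> l J Q. *)
pose Lm := P *m Jmx.
have JJ : Jmx *m Jmx = - 1%:M by exact: JmxJ.
have Ju : Jmx \in unitmx.
  suff : Jmx *m (- Jmx) = 1%:M by case/mulmx1_unit.
  by rewrite mulmxN JJ opprK.
have Lu : Lm \in unitmx by rewrite unitmx_mul Pu.
pose k i := - (2 * ii) * D ord0 i.
pose K := diag_mx (\row_i k i).
have KE : K = - (2 * ii) *: diag_mx D.
  by apply/matrixP => i j; rewrite !mxE /k !mxE mulrnAr.
have LK : (2 * ii) *: (Lm *m Jmx *m Q) = K *m Lm.
  rewrite KE /Lm -(mulmxA P) JJ mulmxN mulmx1 mulNmx QF.
  by rewrite mulmxA PF !mulmxA -!scalemxAl scalerN scaleNr.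
clearbody Lm.
have i2 : ii * ii = -1 by rewrite -expr2 sqr_i.
pose H := - ii *: (Lm *m Jmx *m Lm^H).
have JH : Jmx^H = - Jmx by rewrite Jmx_conj Jmx_tr.
have HH : H^H = H.
  have E (A : 'M[C]_m) : (A *m Jmx *m A^H)^H = - (A *m Jmx *m A^H).
    by rewrite ctrM conjc_mxK ctrM JH mulNmx mulmxN mulmxA.
  rewrite /H map_mxZ linearZ /= E scalerN -scaleNr; congr (_ *: _); apply/eqP.
  by rewrite eq_complex /= ?oppr0 ?opprK !eqxx.
have Qs1 : (map_mx (@complex.Re R) Q)^T = map_mx (@complex.Re R) Q.
  by apply/matrixP => a b; rewrite !mxE -[in RHS]Qs mxE.
have [c c0 Hc] := posdef_lowerC Qs Qpos.
have Qyy (y : 'rV[C]_m) : y != 0 -> 0 < complex.Re ((y *m Q *m y^H) ord0 ord0).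
  move=> y0; have -> : (y *m Q *m y^H) ord0 ord0 =
      \sum_a \sum_b Q a b * y ord0 b * (y ord0 a)^*%C.
    rewrite mxE; apply: eq_bigr => a _; rewrite !mxE big_distrl /=.
    by apply: eq_bigr => b _; rewrite -[in RHS]Qs mxE [Q b a * _]mulrC.
  apply: lt_le_trans (Hc _); rewrite pmulr_rgt0//.
  have [a ya] : exists a, y ord0 a != 0.
    by apply/existsP; apply: contra_neqT y0 => /existsPn h; apply/rowP => a;
      rewrite mxE; apply/eqP; have := h a; rewrite negbK.
  rewrite (bigD1 a)//= ltr_pwDl ?sumr_ge0// => [|b _]; last exact: sqc_ge0.
  by rewrite lt_neqAle eq_sym sqc_eq0 ya sqc_ge0.
have Hneg (s : 'rV[C]_m) : s != 0 ->
    complex.Re (hform H (\row_j (k j * s ord0 j)) s) < 0.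
  move=> s0.
  have -> : \row_j (k j * s ord0 j) = s *m K.
    by apply/rowP => j; rewrite mul_mx_diag !mxE mulrC.
  pose y := s *m Lm *m Jmx.
  have y0 : y != 0.
    apply: contra_neq s0 => y0; rewrite -[s](mulmxK Lu) -[s *m Lm](mulmxK Ju).
    by rewrite -/y y0 !mul0mx.
  have -> : hform H (s *m K) s = - (2 * (y *m Q *m y^H) ord0 ord0).
    rewrite /hform /H -scalemxAr -!scalemxAl -[X in (_ *: (X *m _)) _ _]mulmxA.
    rewrite (mulmxA K) (mulmxA K) -LK -!scalemxAl -scalemxAr -scalemxAl scalerA.
    rewrite /y !ctrM JH !(mulNmx, mulmxN) !mulmxA ?opprK.
    rewrite mxE [X in - (_ * X)]mxE mulrN opprK; congr (_ * _).
    by rewrite mulNr mulrCA i2 mulrN1 opprK.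
  by rewrite ReN oppr_lt0 mulr_natl mulr2n ReD addr_gt0 ?Qyy.
have [kn0 Hm Hp] := lyapunov_sign HH Hneg.
pose msk (pr : pred 'I_m) : 'M[C]_m := diag_mx (\row_j (pr j)%:R).
have mskE (pr : pred 'I_m) p (s : 'M[C]_(p, m)) i j : (s *m msk pr) i j = (pr j)%:R * s i j.
  by rewrite mul_mx_diag !mxE mulrC.
(* A combination of eigenvectors of one half with zero xi-part is isotropic for H, hence zero by
   definiteness on that half. *)
have key (pr : pred 'I_m) :
    (forall s : 'rV[C]_m, s != 0 -> (forall j, s ord0 j != 0 -> pr j) ->
       hform H s s != 0) ->
    forall p (s : 'M[C]_(p, m)), s *m rsubmx (msk pr *m Lm) = 0 -> s *m msk pr = 0.
  move=> Hpr p s s0; apply/row_matrixP => i; rewrite row0 row_mul.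
  have : row i s *m rsubmx (msk pr *m Lm) = 0 by rewrite -row_mul s0 row0.
  move: (row i s) => {s s0 i} s s0; apply/eqP; apply: contraT => sD0.
  have := Hpr _ sD0.
  have -> : hform H (s *m msk pr) (s *m msk pr) = 0; last first.
    move=> h; suff /h : forall j, (s *m msk pr) ord0 j != 0 -> pr j.
      by rewrite eqxx.
    by move=> j; rewrite mskE; case: (pr j) => //; rewrite mul0r eqxx.
  pose w := s *m msk pr *m Lm.
  have -> : hform H (s *m msk pr) (s *m msk pr) = (- ii *: (w *m Jmx *m w^H)) ord0 ord0.
    rewrite /hform /H -scalemxAr -scalemxAl /w (ctrM (s *m msk pr) Lm).
    by rewrite !mulmxA.
  have wE : w = row_mx (lsubmx w) 0.
    rewrite -[LHS]hsubmxK; congr row_mx; rewrite -s0 /w -mulmxA.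
    by rewrite -[in LHS](hsubmxK (msk pr *m Lm)) mul_mx_row row_mxKr.
  rewrite wE mul_row_Jmx map_row_mx tr_row_mx mul_row_col map_mx0 trmx0 oppr0.
  by rewrite mulmx0 mul0mx addr0 scaler0 mxE.
have rk (pr : pred 'I_m) :
    (forall s : 'rV[C]_m, s != 0 -> (forall j, s ord0 j != 0 -> pr j) ->
       hform H s s != 0) ->
    (\rank (msk pr *m Lm) <= \rank (rsubmx (msk pr *m Lm)))%N.
  move=> Hpr.
  have : (kermx (rsubmx (msk pr *m Lm)) <= kermx (msk pr *m Lm))%MS.
    by apply/sub_kermxP; rewrite mulmxA (key _ Hpr) ?mul0mx ?mulmx_ker.
  exact: mxrank_le_ker.
pose neg : pred 'I_m := [pred j | complex.Re (k j) < 0].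
pose pos : pred 'I_m := [pred j | 0 < complex.Re (k j)].
have Hneg' (s : 'rV[C]_m) : s != 0 -> (forall j, s ord0 j != 0 -> neg j) -> hform H s s != 0.
  exact: Hm.
have Hpos' (s : 'rV[C]_m) : s != 0 -> (forall j, s ord0 j != 0 -> pos j) -> hform H s s != 0.
  exact: Hp.
have D1 : msk neg + msk pos = 1%:M.
  apply/matrixP => i j; rewrite !mxE -mulrnDl; congr (_ *+ _).
  by rewrite /neg /pos /=; have := kn0 i; case: ltgtP => //= _ _;
    rewrite ?addr0 ?add0r.
have LD : Lm = msk neg *m Lm + msk pos *m Lm by rewrite -mulmxDl D1 mul1mx.
set Ln := msk neg *m Lm in LD *.
set Lp := msk pos *m Lm in LD *.
pose U := rsubmx Ln.
(* The ranks of the two halves add up to at least 2n, and each is at most the rank of its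
   xi-projection, which is at most n. *)
have Ufull : row_full U.
  rewrite /row_full eqn_leq rank_leq_col /=.
  have := rk _ Hneg'; have := rk _ Hpos'; rewrite -/Ln -/Lp -/U.
  have := rank_leq_col (rsubmx Lp); have := mxrank_add Ln Lp.
  rewrite -LD mxrank_unit//.
  by move: (\rank Ln) (\rank Lp) (\rank U) (\rank (rsubmx Lp)) => a b c' d; clear; lia.
have [Y YU] := row_fullP Ufull.
(* Forced by the requirement Ln = (i U) (M, - i) and Y U = 1. *)
pose M := - ii *: (Y *m lsubmx Ln).
have iNi : ii * - ii = 1 by rewrite mulrN i2 opprK.
have Nii : - ii * ii = 1 by rewrite mulNr i2 opprK.
have LnE : Ln = (ii *: U) *m annmx M.
  rewrite /annmx mul_mx_row -[LHS]hsubmxK -/U; congr row_mx.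
    rewrite /M -scalemxAl -scalemxAr scalerA iNi scale1r mulmxA.
    have : (U *m Y - 1%:M) *m msk neg = 0.
      by apply: (key _ Hneg'); rewrite -/Ln -/U mulmxBl mul1mx -mulmxA YU mulmx1 subrr.
    move=> E; have : (U *m Y - 1%:M) *m Ln = 0 by rewrite /Ln mulmxA E mul0mx.
    move=> /(congr1 lsubmx); rewrite -[X in _ *m X]hsubmxK mul_mx_row row_mxKl.
    by rewrite linear0 mulmxBl mul1mx => /eqP; rewrite subr_eq0 => /eqP.
  by rewrite mulmxN mul_mx_scalar scalerA i2 scaleN1r opprK.
have annE : annmx M = (- ii *: Y) *m Ln.
  rewrite -[in RHS](hsubmxK Ln) mul_mx_row -/U -!scalemxAl YU /annmx; congr row_mx.
  by rewrite scalemx1 raddfN.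
(* The Gram matrix of J in the eigenbasis. It couples k only to - k, so it vanishes on each half,
   and row i of its inverse [Dm], for Re (k i) > 0, involves only eigenvectors of the annihilating
   half. *)
pose Om := Lm *m Jmx *m Lm^T.
have Omu : Om \in unitmx.
  by rewrite /Om unitmx_mul unitmx_tr Lu andbT unitmx_mul Lu.
have OmT : Om^T = - Om.
  by rewrite /Om trmx_mul trmxK [(Lm *m Jmx)^T]trmx_mul Jmx_tr mulNmx mulmxN mulmxA.
have KT : K^T = K by rewrite /K tr_diag_mx.
have KOm : K *m Om = - (Om *m K) by exact: (anticomm_form Jmx_tr Qs KT LK).
pose Dm := invmx Om.
have KDm : K *m Dm = - (Dm *m K) by exact: anticomm_invmx.
have kE (A B : 'M[C]_m) : K *m A = - (B *m K) ->
    forall i j, k i * A i j = - (B i j * k j).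
  move=> /matrixP E i j; have := E i j; rewrite mul_diag_mx.
  by rewrite [in RHS]mxE mul_mx_diag !mxE.
have Om0 i j : Om i j != 0 -> k i = - k j.
  move=> Oij; apply: (mulIf Oij); rewrite (kE _ _ KOm) mulNr; congr (- _).
  by rewrite mulrC.
have Dm0 i j : Dm i j != 0 -> k i = - k j.
  move=> Oij; apply: (mulIf Oij); rewrite (kE _ _ KDm) mulNr; congr (- _).
  by rewrite mulrC.
have isot (pr : pred 'I_m) : (forall i j, pr i -> pr j -> k i <> - k j) ->
    msk pr *m Om *m msk pr = 0.
  move=> Hpr; apply/matrixP => i j; rewrite mskE mul_diag_mx [RHS]mxE.
  rewrite [X in _ * X]mxE [X in _ * (X * _)]mxE.
  have [pi|_] := boolP (pr i); last by rewrite mul0r mulr0.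
  have [pj|_] := boolP (pr j); last by rewrite mul0r.
  have [->|/Om0 h] := eqVneq (Om i j) 0; first by rewrite !(mulr0, mul0r).
  by case: (Hpr i j pi pj).
have tmsk pr : (msk pr)^T = msk pr by rewrite /msk tr_diag_mx.
have annJ : annmx M *m Jmx *m (annmx M)^T = 0.
  set A := - ii *: Y in annE.
  have -> : annmx M *m Jmx *m (annmx M)^T = A *m (msk neg *m Om *m msk neg) *m A^T.
    by rewrite annE trmx_mul /Ln trmx_mul tmsk /Om !mulmxA.
  rewrite isot ?mulmx0 ?mul0mx// => i j; rewrite /neg /= => ki kj kij.
  by move: ki; rewrite kij ReN; move: kj; lra.
pose I : finType := {i : 'I_m | 0 < complex.Re (k i)}.
exists M, I, (fun i => row (val i) Lm), (fun i => row (val i) (ii *: (Dm *m Lm))), (fun i => k (val i)).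
split.
- have MT : M^T = M.
    move: annJ; rewrite {1}/annmx mul_row_Jmx opprK /annmx tr_row_mx mul_row_col.
    rewrite linearN /= tr_scalar_mx mulmxN mul_scalar_mx mul_mx_scalar => /eqP.
    rewrite subr_eq0 => /eqP /(scalerI _) -> //.
    by apply/eqP => i0; move: i2; rewrite i0 mul0r => /eqP; rewrite eq_sym oppr_eq0 oner_eq0.
  split=> // x x0.
  (* The real vector x is lifted to the element y (M, - i) of the plane; the Lyapunov form at its
     coordinates s is twice Re M at x. *)
  pose y : 'rV[C]_n := map_mx (fun r => r%:C%C) x.
  have y0 : y != 0.
    by apply: contra_neq x0 => /matrixP y0; apply/matrixP => i j; have := y0 i j; rewrite !mxE => -[].
  pose s := y *m (- ii *: Y) *m msk neg.
  have wE : y *m annmx M = s *m Lm by rewrite annE /s /Ln !mulmxA.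
  have s0 : s != 0.
    apply: contra_neq y0 => s0; move: wE; rewrite s0 mul0mx /annmx mul_mx_row.
    move=> /(congr1 rsubmx); rewrite row_mxKr linear0 mulmxN mul_mx_scalar => /eqP.
    rewrite oppr_eq0 scaler_eq0 => /orP[/eqP i0|/eqP//].
    by move: i2; rewrite i0 mul0r => /eqP; rewrite eq_sym oppr_eq0 oner_eq0.
  have := lyapunov_pos HH Hneg s0.
  have -> : hform H s s = (y *m M^H *m y^H) ord0 ord0 + (y *m M *m y^H) ord0 ord0.
    have -> : hform H s s = (- ii *: (s *m Lm *m Jmx *m (s *m Lm)^H)) ord0 ord0.
      by rewrite /hform /H -scalemxAr -scalemxAl (ctrM s Lm) !mulmxA.
    by rewrite -wE annmx_form scalerA Nii scale1r mxE.
  have ReM0 : complex.Re ((y *m M *m y^H) ord0 ord0) = qf (map_mx (@complex.Re R) M) x.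
    rewrite /qf !mxE Re_sum; apply: eq_bigr => b _; rewrite !mxE ReM /= oppr0 mulr0 subr0.
    by rewrite Re_sum; congr (_ * _); apply: eq_bigr => a _; rewrite !mxE ReM /= mul0r subr0.
  have -> : (y *m M^H *m y^H) ord0 ord0 = ((y *m M *m y^H) ord0 ord0)^*%C.
    transitivity (((y *m M *m y^H)^H) ord0 ord0); last by rewrite [LHS]mxE [LHS]mxE.
    by rewrite !ctrM conjc_mxK mulmxA.
  rewrite ReD ReJ ReM0 => L.
  suff : 0 < qf (map_mx (@complex.Re R) M) x + qf (map_mx (@complex.Re R) M) x by lra.
  apply: L => j; rewrite /s mskE; case: (boolP (neg j)) => // _.
  by rewrite mul0r eqxx.
- move=> i; split; first exact: (valP i).
  have := congr1 (row (val i)) LK; rewrite [RHS]row_mul /K row_diag_mx.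
  rewrite -scalemxAl -rowE mxE => <-.
  by rewrite linearZ /= !row_mul.
- move=> i j; rewrite !row_form; split.
    have [->|/Om0 h] := eqVneq (Om (val i) (val j)) 0; first by rewrite raddf0.
    exfalso; have := valP i; have := valP j; rewrite /= h ReN; lra.
  rewrite -!scalemxAl -(mulmxA Dm Lm) -(mulmxA Dm) mulVmx// [X in X%:M]mxE.
  by rewrite -scale_scalar_mx scalerA Nii scale1r mxE (inj_eq val_inj).
- split=> [i|].
    have -> : row (val i) (ii *: (Dm *m Lm)) = (ii *: row (val i) Dm) *m Ln.
      rewrite linearZ /= row_mul -scalemxAl; congr (_ *: _); rewrite /Ln mulmxA.
      congr (_ *m _); apply/rowP => j; rewrite mskE [LHS]mxE [X in _ * X]mxE.
      have [->|/Dm0 h] := eqVneq (Dm (val i) j) 0; first by rewrite mulr0.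
      suff -> : neg j by rewrite mul1r.
      by have := valP i; rewrite /neg /= h ReN; lra.
    by rewrite LnE mulmxA submxMl.
  have i20 : 2 * ii != 0.
    apply/eqP => /(congr1 ( *%R^~ ii)); rewrite -mulrA i2 mul0r mulrN1 => /eqP.
    by rewrite oppr_eq0 pnatr_eq0.
  rewrite -(eqmx_scale _ i20) [in X in (X <= _)%MS]annE /Ln.
  have -> : (2 * ii) *: (- ii *: Y *m (msk neg *m Lm) *m Jmx *m Q) =
      (- ii *: Y) *m msk neg *m ((2 * ii) *: (Lm *m Jmx *m Q)).
    by rewrite -scalemxAr !mulmxA.
  have KN : msk neg *m K = K *m msk neg.
    by apply/matrixP => i j; rewrite mul_diag_mx mul_mx_diag !mxE; case: eqVneq => [->|]; rewrite ?mulr1n ?mulr0n ?mulr0 ?mul0r 1?mulrC.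
  rewrite LK -(mulmxA (- ii *: Y)) (mulmxA (msk neg)) KN -(mulmxA K) -/Ln LnE !mulmxA.
  exact: submxMl.
- move=> l; pose t := l *m invmx Lm.
  exists (fun i => t ord0 (val i)), (t *m (ii *: U)).
  rewrite -mulmxA -LnE -[LHS](mulmxKV Lu) -/t {1}LD mulmxDr addrC; congr (_ + _).
  rewrite /Lp mulmxA mulmx_sum_row.
  transitivity (\sum_(j | pos j) t ord0 j *: row j Lm).
    rewrite [RHS]big_mkcond /=; apply: eq_bigr => j _; rewrite mskE.
    by case: (pos j); rewrite ?mul1r// mul0r scale0r.
  rewrite (reindex_omap (val : I -> 'I_m) insub)/=; last first.
    by move=> j pj; rewrite insubT.
  by apply: eq_bigl => i; rewrite valK eqxx andbT; exact: (valP i).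
Qed.

End symplectic_structure.

(** * Operators satisfying the canonical commutation relations *)

Section seminorm.
Variables (R : realType) (V : lmodType R[i]) (ip : V -> V -> R[i]).
Hypothesis ipL : forall a u v w, ip (a *: u + v) w = a * ip u w + ip v w.
Hypothesis ipJ : forall u v, ip v u = (ip u v)^*%C.
Hypothesis ip_ge0 : forall v, 0 <= complex.Re (ip v v).
Implicit Types (u v w : V) (a : R[i]).

Definition nm v : R := Num.sqrt (complex.Re (ip v v)).

Lemma ip0l w : ip 0 w = 0.
Proof.
by have := ipL 1 0 0 w; rewrite scaler0 addr0 mul1r => /eqP;
  rewrite -subr_eq0 opprD addrA subrr sub0r oppr_eq0 => /eqP.
Qed.

Lemma ipDl u v w : ip (u + v) w = ip u w + ip v w.
Proof. by have := ipL 1 u v w; rewrite scale1r mul1r. Qed.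

Lemma ipZl a u w : ip (a *: u) w = a * ip u w.
Proof. by have := ipL a u 0 w; rewrite addr0 ip0l addr0. Qed.

Lemma ipDr u v w : ip w (u + v) = ip w u + ip w v.
Proof. by rewrite ipJ ipDl rmorphD /= -!ipJ. Qed.

Lemma ipZr a u w : ip w (a *: u) = a^*%C * ip w u.
Proof. by rewrite ipJ ipZl rmorphM /= -ipJ. Qed.

Lemma ip0r w : ip w 0 = 0.
Proof. by rewrite ipJ ip0l conjc0. Qed.

Lemma ip_suml (J : Type) (r : seq J) (P : pred J) (f : J -> V) w :
  ip (\sum_(i <- r | P i) f i) w = \sum_(i <- r | P i) ip (f i) w.
Proof. exact: (big_morph (ip^~ w) (fun u v => ipDl u v w) (ip0l w)). Qed.

Lemma ip_sumr (J : Type) (r : seq J) (P : pred J) (f : J -> V) w :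
  ip w (\sum_(i <- r | P i) f i) = \sum_(i <- r | P i) ip w (f i).
Proof. exact: (big_morph (ip w) (fun u v => ipDr u v w) (ip0r w)). Qed.

Lemma nm_ge0 v : 0 <= nm v. Proof. exact: sqrtr_ge0. Qed.

Lemma nm_sqr v : nm v ^+ 2 = complex.Re (ip v v).
Proof. by rewrite sqr_sqrtr. Qed.

Lemma ipvv v : ip v v = (nm v ^+ 2)%:C%C.
Proof.
rewrite nm_sqr; have := ipJ v v; case: (ip v v) => a b [] /eqP.
by rewrite -subr_eq0 opprK -mulr2n mulrn_eq0 /= => /eqP ->.
Qed.

Lemma nmZ a v : nm (a *: v) = Normc.normc a * nm v.
Proof.
apply: (@pexpIrn _ 2) => //; rewrite ?nnegrE ?nm_ge0 ?mulr_ge0 ?nm_ge0//.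
  by case: a => x y; exact: sqrtr_ge0.
rewrite exprMn normc_sqr nm_sqr ipZl ipZr mulrA ipvv.
by case: a => x y; rewrite /sqc /=; ring.
Qed.

Lemma nm0 : nm 0 = 0. Proof. by rewrite /nm ip0l sqrtr0. Qed.

Lemma nmN v : nm (- v) = nm v.
Proof.
by rewrite -scaleN1r nmZ (_ : Normc.normc _ = 1) ?mul1r//= oppr0 expr0n /= addr0 sqrrN expr1n sqrtr1.
Qed.

(** Cauchy-Schwarz for a form that may be degenerate: against a null vector, a large multiple of
    that vector is used. *)
Lemma Re_ip_le u v : complex.Re (ip u v) <= nm u * nm v.
Proof.
have H (s t : R) : 0 <= s ^+ 2 * nm u ^+ 2 + t ^+ 2 * nm v ^+ 2 - 2 * s * t * complex.Re (ip u v).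
  have := ip_ge0 (s%:C%C *: u + (- t)%:C%C *: v).
  rewrite !(ipDl, ipDr, ipZl, ipZr) (ipJ u v) !(ReD, ImD, ReM, ImM, ReJ, ImJ) /= !nm_sqr.
  have E w : complex.Im (ip w w) = 0 by rewrite ipvv.
  rewrite !E; set p := complex.Re (ip u u); set q := complex.Re (ip v v).
  by set r := complex.Re (ip u v); nra.
have u0 := nm_ge0 u; have v0 := nm_ge0 v.
have [uz|uz] := eqVneq (nm u) 0.
  rewrite uz mul0r; have [|rp] := lerP (complex.Re (ip u v)) 0; first by [].
  have := H ((nm v ^+ 2 + 1) / complex.Re (ip u v)) 1; rewrite uz.
  rewrite (_ : 2 * _ * 1 * _ = 2 * (nm v ^+ 2 + 1)); last by field; rewrite gt_eqF.
  by have := sqr_ge0 (nm v); rewrite expr0n /= mulr0 expr1n; lra.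
have [vz|vz] := eqVneq (nm v) 0.
  rewrite vz mulr0; have [|rp] := lerP (complex.Re (ip u v)) 0; first by [].
  have := H 1 ((nm u ^+ 2 + 1) / complex.Re (ip u v)); rewrite vz.
  rewrite (_ : 2 * 1 * _ * _ = 2 * (nm u ^+ 2 + 1)); last by field; rewrite gt_eqF.
  by have := sqr_ge0 (nm u); rewrite expr0n /= mulr0 expr1n; lra.
have up : 0 < nm u by rewrite lt_neqAle eq_sym uz.
have vp : 0 < nm v by rewrite lt_neqAle eq_sym vz.
have := H (nm v) (nm u).
rewrite (_ : _ - _ = 2 * (nm u * nm v) * (nm u * nm v - complex.Re (ip u v))); last by ring.
by rewrite pmulr_rge0 ?subr_ge0// !mulr_gt0.
Qed.

Lemma normc_ip_le u v : Normc.normc (ip u v) <= nm u * nm v.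
Proof.
have [E|E] := eqVneq (ip u v) 0.
  by rewrite E Normc.normc0 mulr_ge0 ?nm_ge0.
have n0 : 0 < Normc.normc (ip u v).
  rewrite lt_neqAle eq_sym; apply/andP; split.
    by apply: contra_neq E; exact: Normc.eq0_normc.
  by case: (ip u v) => x y; exact: sqrtr_ge0.
have := Re_ip_le ((ip u v)^*%C *: u) v; rewrite ipZl nmZ.
have -> : Normc.normc (ip u v)^*%C = Normc.normc (ip u v).
  by case: (ip u v) => x y /=; rewrite sqrrN.
have -> : complex.Re ((ip u v)^*%C * ip u v) = Normc.normc (ip u v) ^+ 2.
  by rewrite normc_sqr /sqc ReM ReJ ImJ; ring.
by rewrite expr2 -mulrA ler_pM2l.
Qed.

Lemma nmD u v : nm (u + v) <= nm u + nm v.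
Proof.
rewrite -(@ler_pXn2r _ 2) ?nnegrE ?addr_ge0 ?nm_ge0//.
rewrite nm_sqr ipDl !ipDr !ReD (ipJ u v) ReJ -!nm_sqr.
by have := Re_ip_le u v; lra.
Qed.

Lemma nmB u v : nm (u - v) <= nm u + nm v.
Proof. by apply: (le_trans (nmD _ _)); rewrite nmN. Qed.

Lemma nm_sum (J : Type) (r : seq J) (P : pred J) (f : J -> V) :
  nm (\sum_(i <- r | P i) f i) <= \sum_(i <- r | P i) nm (f i).
Proof.
elim: r => [|x r IH]; first by rewrite !big_nil nm0.
by rewrite !big_cons; case: ifP => // _; apply: (le_trans (nmD _ _)); rewrite lerD2l.
Qed.

End seminorm.

Section spans.
Variables (K : fieldType) (V : lmodType K) (I : eqType).
Variables (g : I -> V -> V) (v0 : V).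
Hypothesis gl : forall i a u v, g i (a *: u + v) = a *: g i u + g i v.
Implicit Types (P : pred nat) (t : seq I) (u v w : V).

Definition word t : V := foldr g v0 t.

(** Combinations of words whose length satisfies P: [pred1 D] gives the homogeneous elements of
    degree D, [leq^~ N] the filtration by degree. Words may be dependent or equal; induction on a
    combination takes the place of coordinates. *)
Inductive wspan P : V -> Prop :=
| wspan0 : wspan P 0
| wspan_lin a t v : P (size t) -> wspan P v -> wspan P (a *: word t + v).

Lemma wspan_word P t : P (size t) -> wspan P (word t).
Proof. by move=> Pt; rewrite -[word t]addr0 -[word t]scale1r; apply: wspan_lin => //; exact: wspan0. Qed.

Lemma wspanD P u v : wspan P u -> wspan P v -> wspan P (u + v).
Proof.
move=> uP vP; elim: uP => [|a t w Pt _ IH]; first by rewrite add0r.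
by rewrite -addrA; exact: wspan_lin.
Qed.

Lemma wspanZ P a u : wspan P u -> wspan P (a *: u).
Proof.
elim=> [|b t w Pt _ IH]; first by rewrite scaler0; exact: wspan0.
by rewrite scalerDr scalerA; exact: wspan_lin.
Qed.

Lemma wspan_sum P (J : Type) (r : seq J) (Q : pred J) (f : J -> V) :
  (forall j, Q j -> wspan P (f j)) -> wspan P (\sum_(j <- r | Q j) f j).
Proof. by move=> H; apply: big_ind => //; [exact: wspan0|exact: wspanD]. Qed.

Lemma wspanW P P' u : (forall d, P d -> P' d) -> wspan P u -> wspan P' u.
Proof.
move=> PP; elim=> [|a t w /PP Pt _ IH]; first exact: wspan0.
exact: wspan_lin.
Qed.

Lemma lin0 (f : V -> V) : (forall a u v, f (a *: u + v) = a *: f u + f v) -> f 0 = 0.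
Proof. by move=> fl; have := fl (-1) 0 0; rewrite scaler0 addr0 scaleN1r addNr. Qed.

Lemma wspan_map P P' (f : V -> V) u :
  (forall a u v, f (a *: u + v) = a *: f u + f v) ->
  (forall t, P (size t) -> wspan P' (f (word t))) -> wspan P u -> wspan P' (f u).
Proof.
move=> fl fP; elim=> [|a t w /fP Pt _ IH]; first by rewrite lin0//; exact: wspan0.
by rewrite fl; apply: wspanD => //; exact: wspanZ.
Qed.

Lemma wspan_g P P' i u : (forall d, P d -> P' d.+1) -> wspan P u -> wspan P' (g i u).
Proof.
move=> PP; apply: wspan_map; first exact: gl.
by move=> t Pt; exact: (@wspan_word P' (i :: t) (PP _ Pt)).
Qed.

Lemma wspan_eq_lin (f1 f2 : V -> V) P u :
  (forall a u v, f1 (a *: u + v) = a *: f1 u + f1 v) ->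
  (forall a u v, f2 (a *: u + v) = a *: f2 u + f2 v) ->
  (forall t, P (size t) -> f1 (word t) = f2 (word t)) -> wspan P u -> f1 u = f2 u.
Proof.
move=> l1 l2 E; elim=> [|a t w Pt _ IH]; first by rewrite !lin0.
by rewrite l1 l2 E// IH.
Qed.

Lemma wspan_decomp N u : wspan (fun d => d < N)%N u ->
  exists2 f : nat -> V, (forall d, wspan (pred1 d) (f d)) & u = \sum_(d < N) f d.
Proof.
elim=> [|a t w tN _ [f fd ->]].
  by exists (fun=> 0) => [d|]; [exact: wspan0|rewrite big1].
exists (fun d => if d == size t then a *: word t + f d else f d).
  by move=> d; case: eqP => [->|_] //; apply: wspan_lin => //=.
rewrite [in RHS](bigD1 (Ordinal tN)) //= eqxx [in LHS](bigD1 (Ordinal tN)) //= addrA.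
congr (_ + _); apply: eq_bigr => d; rewrite -val_eqE /=.
by case: eqP.
Qed.

End spans.

(** * Linear and quadratic operators in an abstract representation of the commutation relations *)

Section ccr.
Variables (R : realType) (n : nat) (h : R) (V : lmodType R[i]).
Variable L : 'I_(n + n) -> V -> V.
Hypothesis Ll : forall a c u v, L a (c *: u + v) = c *: L a u + L a v.
Local Notation ii := ('i%C : R[i]).
Local Notation kh := (- ii * h%:C%C).
Hypothesis ccr : forall a b v,
  L a (L b v) = L b (L a v) + (kh * Jmx R n a b) *: v.
Implicit Types (l m : 'rV[R[i]]_(n + n)) (u v w : V).

Let LD a u v : L a (u + v) = L a u + L a v.
Proof. by have := Ll a 1 u v; rewrite !scale1r. Qed.

Let L0 a : L a 0 = 0.
Proof. exact: (lin0 (Ll a)). Qed.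

Let LZ a c u : L a (c *: u) = c *: L a u.
Proof. by have := Ll a c u 0; rewrite L0 !addr0. Qed.

Let Lsum a (J : Type) (r : seq J) (P : pred J) (f : J -> V) :
  L a (\sum_(i <- r | P i) f i) = \sum_(i <- r | P i) L a (f i).
Proof. exact: (big_morph (L a) (LD a) (L0 a)). Qed.

Definition op l v : V := \sum_a l ord0 a *: L a v.

Lemma op_linear l c u v : op l (c *: u + v) = c *: op l u + op l v.
Proof.
rewrite /op scaler_sumr -big_split /=; apply: eq_bigr => a _.
by rewrite Ll scalerDr !scalerA mulrC.
Qed.

Lemma op0r l : op l 0 = 0. Proof. exact: (lin0 (op_linear l)). Qed.

Lemma opDr l u v : op l (u + v) = op l u + op l v.
Proof. by have := op_linear l 1 u v; rewrite !scale1r. Qed.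

Lemma opZr l c u : op l (c *: u) = c *: op l u.
Proof. by have := op_linear l c u 0; rewrite op0r !addr0. Qed.

Lemma opD l m v : op (l + m) v = op l v + op m v.
Proof. by rewrite /op -big_split; apply: eq_bigr => a _; rewrite mxE scalerDl. Qed.

Lemma op0 v : op 0 v = 0.
Proof. by rewrite /op big1// => a _; rewrite mxE scale0r. Qed.

Lemma opZ c l v : op (c *: l) v = c *: op l v.
Proof. by rewrite /op scaler_sumr; apply: eq_bigr => a _; rewrite mxE scalerA. Qed.

Lemma op_sum (J : Type) (r : seq J) (P : pred J) (f : J -> 'rV_(n + n)) v :
  op (\sum_(i <- r | P i) f i) v = \sum_(i <- r | P i) op (f i) v.
Proof. exact: (big_morph (op^~ v) (fun l m => opD l m v) (op0 v)). Qed.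

Lemma op_delta a v : op (delta_mx ord0 a) v = L a v.
Proof.
rewrite /op (bigD1 a) //= mxE !eqxx scale1r big1 ?addr0// => b ba.
by rewrite mxE eqxx (negbTE ba) scale0r.
Qed.

Lemma op_mul k (y : 'rV[R[i]]_k) (A : 'M[R[i]]_(k, n + n)) v :
  op (y *m A) v = \sum_j y ord0 j *: op (row j A) v.
Proof. by rewrite mulmx_sum_row op_sum; apply: eq_bigr => j _; rewrite opZ. Qed.

Lemma op_comm l m v : op l (op m v) =
  op m (op l v) + (kh * (l *m Jmx R n *m m^T) ord0 ord0) *: v.
Proof.
have E (l' m' : 'rV[R[i]]_(n + n)) w : op l' (op m' w) =
    \sum_a \sum_b (l' ord0 a * m' ord0 b) *: L a (L b w).
  rewrite /op; apply: eq_bigr => a _; rewrite Lsum scaler_sumr.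
  by apply: eq_bigr => b _; rewrite LZ scalerA.
rewrite !E mxE mulr_sumr scaler_suml exchange_big.
rewrite /= -big_split /=; apply: eq_bigr => b _.
rewrite mxE mulr_suml mulr_sumr scaler_suml -big_split /=; apply: eq_bigr => a _.
by rewrite ccr scalerDr scalerA [_^T _ _]mxE; congr (_ *: _ + _ *: _); ring.
Qed.

Definition Tq (Q : 'M[R[i]]_(n + n)) v : V := \sum_a \sum_b Q a b *: L a (L b v).

Lemma Tq_linear Q c u v : Tq Q (c *: u + v) = c *: Tq Q u + Tq Q v.
Proof.
rewrite /Tq scaler_sumr -big_split /=; apply: eq_bigr => a _.
rewrite scaler_sumr -big_split /=; apply: eq_bigr => b _.
by rewrite !Ll scalerDr !scalerA mulrC.
Qed.

(** The commutator with a quadratic operator acts on linear ones through the Hamilton map; the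
    factor 2 comes from the symmetry of Q. Eigenvectors of l -> 2i l J Q are thus ladder operators,
    shifting eigenvalues by h k. *)
Lemma Tq_comm (Q : 'M[R[i]]_(n + n)) : Q^T = Q -> forall l v,
  Tq Q (op l v) = op l (Tq Q v) + h%:C%C *: op ((2 * ii) *: (l *m Jmx R n *m Q)) v.
Proof.
move=> Qs.
have Qt a b : Q a b = Q b a by rewrite -{2}Qs mxE.
have Jt a b : Jmx R n a b = - Jmx R n b a.
  by have /matrixP/(_ b a) := Jmx_tr R n; rewrite !mxE.
have H c v : Tq Q (L c v) = L c (Tq Q v) +
    h%:C%C *: op ((2 * ii) *: (delta_mx ord0 c *m Jmx R n *m Q)) v.
  have -> : L c (Tq Q v) = \sum_a \sum_b Q a b *: L c (L a (L b v)).
    rewrite /Tq Lsum; apply: eq_bigr => a _; rewrite Lsum.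
    by apply: eq_bigr => b _; rewrite LZ.
  have -> : Tq Q (L c v) = \sum_a \sum_b Q a b *: L c (L a (L b v)) +
     (\sum_a \sum_b (Q a b * (kh * Jmx R n a c)) *: L b v +
      \sum_a \sum_b (Q a b * (kh * Jmx R n b c)) *: L a v).
    rewrite /Tq -!big_split; apply: eq_bigr => a _; rewrite -!big_split.
    apply: eq_bigr => b _ /=; rewrite (ccr b c) LD LZ (ccr a c (L b v)).
    by rewrite !scalerDr !scalerA addrA.
  congr (_ + _); rewrite exchange_big /=.
  rewrite [X in _ + X](_ : _ = \sum_j \sum_i (Q i j * (kh * Jmx R n i c)) *: L j v); last first.
    by apply: eq_bigr => a _; apply: eq_bigr => b _; rewrite Qt.
  rewrite -mulr2n opZ -sumrMnl /op !scaler_sumr; apply: eq_bigr => a _.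
  rewrite -scaler_suml scalerMnl !scalerA; congr (_ *: _).
  rewrite -mulmxA -rowE [row _ _ _ _]mxE [(_ *m _) c a]mxE -sumrMnl.
  rewrite !mulr_sumr; apply: eq_bigr => b _; rewrite (Jt b c); ring.
move=> l v; rewrite {1}/op.
have TD := Tq_linear Q 1; have T0 : Tq Q 0 = 0 by exact: (lin0 (Tq_linear Q)).
rewrite (big_morph (Tq Q) (id1 := 0) (op1 := +%R)) //; last first.
  by move=> u w; have := TD u w; rewrite !scale1r.
transitivity (\sum_a (l ord0 a *: L a (Tq Q v) + l ord0 a *: (h%:C%C *: op ((2 * ii) *: (delta_mx ord0 a *m Jmx R n *m Q)) v))).
  apply: eq_bigr => a _; rewrite -scalerDr -H.
  by have := Tq_linear Q (l ord0 a) (L a v) 0; rewrite T0 !addr0.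
rewrite big_split /=; congr (_ + _).
transitivity (h%:C%C *: op ((2 * ii) *: ((\sum_a l ord0 a *: delta_mx ord0 a) *m Jmx R n *m Q)) v); last first.
  have -> // : \sum_a l ord0 a *: delta_mx ord0 a = l.
  by rewrite [RHS]row_sum_delta.
rewrite [in RHS]opZ !mulmx_suml op_sum !scaler_sumr; apply: eq_bigr => a _.
by rewrite [in LHS]opZ -!scalemxAl opZ !scalerA; congr (_ *: _); ring.
Qed.

Section generators.
Variables (I : eqType) (g : I -> 'rV[R[i]]_(n + n)) (v0 : V).
Local Notation W := (word (fun i => op (g i)) v0).
Local Notation S := (wspan (fun i => op (g i)) v0).
Let gl i a u v : op (g i) (a *: u + v) = a *: op (g i) u + op (g i) v.
Proof. exact: op_linear. Qed.

(** An operator killing the vacuum commutes with every letter up to a scalar, so moving it through a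
    word never raises the degree. *)
Lemma killer_word k t : op k v0 = 0 -> S (leq^~ (size t)) (op k (W t)).
Proof.
move=> k0; elim: t => [|i t IH]; first by rewrite /= k0; exact: wspan0.
rewrite [W _]/= op_comm; apply: wspanD.
  by apply: (wspan_g gl) IH => d.
by apply: wspanZ; apply: wspan_word => /=.
Qed.

Lemma killer_span k N u : op k v0 = 0 -> S (leq^~ N) u -> S (leq^~ N) (op k u).
Proof.
move=> k0; apply: wspan_map; first exact: op_linear.
move=> t tN; apply: wspanW (killer_word t k0) => d /= dt.
exact: leq_trans tN.
Qed.

Hypothesis ggen : forall l, exists (s : seq I) (a : I -> R[i]) k,
  l = \sum_(i <- s) a i *: g i + k /\ op k v0 = 0.

Lemma op_span l N u : S (leq^~ N) u -> S (leq^~ N.+1) (op l u).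
Proof.
move=> uN; have [s [a [k [-> k0]]]] := ggen l.
rewrite opD; apply: wspanD; last first.
  by apply: wspanW (killer_span k0 uN) => d /= /leqW.
rewrite op_sum; apply: wspan_sum => i _; rewrite opZ; apply: wspanZ.
exact: (wspan_g gl) uN.
Qed.

(** Used in both directions between two generating families, this shows that they induce the same
    filtration. *)
Lemma word_op_span (I' : Type) (g' : I' -> 'rV[R[i]]_(n + n)) t :
  S (leq^~ (size t)) (foldr (fun i => op (g' i)) v0 t).
Proof.
elim: t => [|i t IH] /=; first exact: (wspan_word (fun i => op (g i)) v0 (t := [::])).
exact: op_span.
Qed.

End generators.

End ccr.

(** * Spectral projections by Lagrange interpolation at integer eigenvalues *)

Section lagrange.
Variables (R : realType) (V : lmodType R[i]) (nmV : V -> R).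
Hypothesis nm_ge0 : forall v, 0 <= nmV v.
Hypothesis nmZ : forall a v, nmV (a *: v) = Normc.normc a * nmV v.
Hypothesis nmB : forall u v, nmV (u - v) <= nmV u + nmV v.
Variable X : V -> V.
Hypothesis Xl : forall a u v, X (a *: u + v) = a *: X u + X v.

Definition lagr_step (k m : nat) (w : V) : V :=
  ((k%:R - m%:R : R[i])^-1) *: (X w - m%:R *: w).

(** The Lagrange polynomial of the node k among 0, ..., N, evaluated at X: on sums of eigenvectors
    with eigenvalues among the nodes it is the projection to the eigenvalue k. *)
Definition lagr (N k : nat) (w : V) : V :=
  foldr (lagr_step k) w [seq m <- iota 0 N.+1 | m != k].

Lemma lagr_step_linear k m a u v :
  lagr_step k m (a *: u + v) = a *: lagr_step k m u + lagr_step k m v.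
Proof.
rewrite /lagr_step Xl [m%:R *: (_ + _)]scalerDr opprD addrACA.
have -> : a *: X u - m%:R *: (a *: u) = a *: (X u - m%:R *: u).
  by rewrite scalerBr !scalerA mulrC.
by rewrite scalerDr !scalerA mulrC.
Qed.

Lemma lagr_linear N k a u v : lagr N k (a *: u + v) = a *: lagr N k u + lagr N k v.
Proof. by rewrite /lagr; elim: [seq _ <- _ | _] => //= m s ->; rewrite lagr_step_linear. Qed.

Lemma lagr_eigen N k c w : X w = c%:R *: w -> (c <= N)%N ->
  lagr N k w = (c == k)%:R *: w.
Proof.
move=> Xw cN; rewrite /lagr.
have stE m a : lagr_step k m (a *: w) = (((c%:R - m%:R) / (k%:R - m%:R)) * a) *: w.
  have XZ : X (a *: w) = a *: X w.
    by have := Xl a w 0; rewrite (lin0 Xl) !addr0.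
  by rewrite /lagr_step XZ Xw !scalerA -scalerBl scalerA; congr (_ *: _); ring.
set s := [seq _ <- _ | _].
have sk : {in s, forall m, m != k} by move=> m; rewrite mem_filter => /andP[].
have -> : foldr (lagr_step k) w s = (\prod_(m <- s) ((c%:R - m%:R) / (k%:R - m%:R) : R[i])) *: w.
  by elim: (s) => [|m r IH]; [rewrite big_nil scale1r|rewrite /= IH big_cons stE].
congr (_ *: _); have [ck|ck] := eqVneq c k.
  rewrite big_seq big1// => m /sk mk; rewrite ck divff// subr_eq0 eqr_nat.
  by rewrite eq_sym.
have cs : c \in s by rewrite mem_filter ck mem_iota /= add0n ltnS.
by rewrite (big_rem _ cs) /= subrr mul0r mul0r.
Qed.

(** The denominators multiply to k! (N - k)!, which is N! divided by a binomial coefficient at most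
    2^N; so the norm is at most 2^N (B + N)^N / N!, and x^N / N! <= e^x. With B of order N the bound
    is exponential in N. Stability of S is asked because X is bounded on S only. *)
Lemma lagr_bound (S : V -> Prop) (B : R) N k w : 0 <= B ->
  (forall a u v, S u -> S v -> S (a *: u + v)) ->
  (forall u, S u -> S (X u)) -> (forall u, S u -> nmV (X u) <= B * nmV u) ->
  (k <= N)%N -> S w ->
  S (lagr N k w) /\ nmV (lagr N k w) <= expR (B + 2 * N%:R) * nmV w.
Proof.
move=> B0 Sl SX XB kN Sw; rewrite /lagr.
have nat_normc m : (m != k) -> Normc.normc ((k%:R - m%:R : R[i])^-1) =
    `|k%:R - m%:R : R|^-1.
  move=> mk; rewrite Normc.normcV; congr (_^-1).
  rewrite (_ : k%:R - m%:R = ((k%:R - m%:R : R))%:C%C) /=; last first.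
    by rewrite rmorphB /= !rmorph_nat.
  by rewrite expr0n /= addr0 sqrtr_sqr.
have normc_nat (m : nat) : Normc.normc (m%:R : R[i]) = m%:R.
  rewrite (_ : m%:R = (m%:R : R)%:C%C) /=; last by rewrite rmorph_nat.
  by rewrite expr0n /= addr0 sqrtr_sqr ger0_norm.
set s := [seq _ <- _ | _].
have sk : {in s, forall m, (m != k) && (m <= N)%N}.
  by move=> m; rewrite mem_filter mem_iota /= add0n ltnS => /andP[-> ->].
have [Sf nf] : S (foldr (lagr_step k) w s) /\ nmV (foldr (lagr_step k) w s) <=
    (\prod_(m <- s) ((B + N%:R) / `|k%:R - m%:R|)) * nmV w.
  elim: (s) sk => [|m r IH] sk /=; first by rewrite big_nil mul1r.
  have [|Sr nr] := IH; first by move=> x xr; apply: sk; rewrite inE xr orbT.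
  have /andP[mk mN] := sk m (mem_head _ _).
  move: (foldr _ _ _) Sr nr => u Su nu.
  have S0 : S 0 by have := Sl (-1) u u Su Su; rewrite scaleN1r addNr.
  split.
    rewrite -[lagr_step _ _ _]addr0; apply: (Sl _ _ _ _ S0).
    by rewrite addrC -scaleNr; apply: Sl => //; exact: SX.
  rewrite big_cons /lagr_step nmZ nat_normc// [_ / _]mulrC -!mulrA.
  rewrite ler_wpM2l ?invr_ge0//; apply: (le_trans (nmB _ _)).
  rewrite nmZ normc_nat; apply: (@le_trans _ _ ((B + N%:R) * nmV u)).
    rewrite mulrDl lerD ?XB// ler_wpM2r// ler_nat//.
  by rewrite ler_wpM2l// addr_ge0.
split=> //; apply: (le_trans nf); rewrite ler_wpM2r//.
have -> : \prod_(m <- s) ((B + N%:R) / `|k%:R - m%:R|) =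
   (B + N%:R) ^+ N / (k`! * (N - k)`!)%:R.
  rewrite big_split /= big_const_seq; congr (_ * _).
    have -> : count xpredT s = N.
      rewrite count_predT size_filter; have := count_predC (pred1 k) (iota 0 N.+1).
      rewrite size_iota count_uniq_mem ?iota_uniq// mem_iota add0n ltnS leq0n kN.
      by rewrite add1n => -[E]; rewrite -[RHS]E; apply: eq_count.
    by rewrite iter_mulr mulr1.
  rewrite big_filter prodfV; congr (_^-1).
  rewrite -/(index_iota 0 N.+1) (@big_cat_nat _ _ _ k) //=; last exact: leqW.
  rewrite natrM; congr (_ * _).
    rewrite big_mkcond big_nat_rev /= add0n fact_prod natr_prod big_add1 /=.
    rewrite big_nat [in RHS]big_nat; apply: eq_bigr => i /andP[_ ik].
    rewrite ifT; last by rewrite neq_ltn; apply/orP; left; lia.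
    rewrite -natrB; last lia.
    by rewrite normr_nat; congr (_%:R); lia.
  rewrite big_ltn_cond ?ltnS// eqxx /= big_mkcond fact_prod natr_prod.
  rewrite -{1}[k.+1]add1n big_addn subSn//.
  rewrite big_nat [in RHS]big_nat; apply: eq_bigr => i /andP[i1 _].
  rewrite ifT; last by rewrite neq_ltn; apply/orP; right; lia.
  by rewrite distrC natrD addrK normr_nat.
have BN0 : 0 <= B + N%:R by rewrite addr_ge0.
have fE : (k`! * (N - k)`!)%:R = N`!%:R / 'C(N, k)%:R :> R.
  rewrite -(bin_fact kN) [in RHS]natrM mulrAC divff ?mul1r//.
  by rewrite pnatr_eq0 -lt0n bin_gt0.
rewrite fE.
have -> : (B + N%:R) ^+ N / (N`!%:R / 'C(N, k)%:R) =
    'C(N, k)%:R * ((B + N%:R) ^+ N / N`!%:R).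
  by rewrite invfM invrK [RHS]mulrC -mulrA.
have -> : B + 2 * N%:R = N%:R + (B + N%:R) by ring.
rewrite expRD; apply: ler_pM => //.
- by rewrite mulr_ge0 ?exprn_ge0 ?invr_ge0.
- apply: (@le_trans _ _ (2 ^+ N)).
    rewrite -natrX ler_nat; have := expnDn 1 1 N; rewrite addn1 => ->.
    rewrite (bigD1 (Ordinal (leq_ltn_trans kN (ltnSn N)))) //=.
    by rewrite !exp1n !muln1 leq_addr.
  rewrite -[N%:R]mul1r expRM_natr; apply: lerXn2r; rewrite ?nnegrE ?expR_ge0//.
  by have := expR_ge1Dx (1 : R); lra.
- case: (N) => [|N']; first by rewrite expr0 fact0 divr1 addr0 -expR0 ler_expR.
  have := expR_ge1Dxn N' (_ : 0 <= B + N'.+1%:R).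
  by move=> /(_ (addr_ge0 B0 (ler0n _ _))); lra.
Qed.

End lagrange.

(** * Upper and lower bounds for complex quadratic forms *)

Section quadratic_bounds.
Variables (R : realType) (p : nat).
Implicit Types A : 'M[R[i]]_p.

Lemma normc_ge0 (x : R[i]) : 0 <= Normc.normc x.
Proof. by case: x => ? ?; exact: sqrtr_ge0. Qed.

Lemma normcJ' (x : R[i]) : Normc.normc x^*%C = Normc.normc x.
Proof. by case: x => ? ? /=; rewrite sqrrN. Qed.

Lemma mx_upper A : exists2 c, 0 < c & forall v : 'I_p -> R[i],
  complex.Re (\sum_a \sum_b A a b * v b * (v a)^*%C) <= c * \sum_a sqc (v a).
Proof.
exists (1 + \sum_a \sum_b Normc.normc (A a b)).
  by rewrite ltr_pwDl// sumr_ge0// => a _; rewrite sumr_ge0// => b _; exact: normc_ge0.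
move=> v; set S := \sum_a sqc (v a).
have S0 : 0 <= S by apply: sumr_ge0 => a _; exact: sqc_ge0.
have vS a : sqc (v a) <= S.
  by rewrite /S (bigD1 a)//= lerDl sumr_ge0// => b _; exact: sqc_ge0.
rewrite mulrDl mul1r -[leLHS]add0r; apply: lerD => //.
rewrite Re_sum mulr_suml; apply: ler_sum => a _.
rewrite Re_sum mulr_suml; apply: ler_sum => b _.
apply: (le_trans (Re_le_normc _)); rewrite !Normc.normcM normcJ' -mulrA.
rewrite ler_wpM2l ?normc_ge0//.
have := vS a; have := vS b; rewrite -!normc_sqr.
have := normc_ge0 (v a); have := normc_ge0 (v b).
by have := sqr_ge0 (Normc.normc (v a) - Normc.normc (v b)); nra.
Qed.

(* The inverse of the (complexified) positive definite matrix 2 Re M. *)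
Lemma posdef_inv_lowerC (M : 'M[R[i]]_p) : M^T = M ->
  (forall x : 'rV[R]_p, x != 0 -> 0 < qf (map_mx (@complex.Re R) M) x) ->
  let G := invmx (M + map_mx (@conjc R) M) in
  [/\ M + map_mx (@conjc R) M \in unitmx, G^T = G, map_mx (@conjc R) G = G &
    exists2 c, 0 < c & forall v : 'I_p -> R[i],
      c * \sum_a sqc (v a) <= complex.Re (\sum_a \sum_b G a b * v b * (v a)^*%C)].
Proof.
move=> MT Mpos G.
pose A : 'M[R]_p := 2 *: map_mx (@complex.Re R) M.
have GA : M + map_mx (@conjc R) M = map_mx (real_complex R) A.
  apply/matrixP => i j; rewrite !mxE; case: (M i j) => a b /=.
  by apply/eqP; rewrite eq_complex /= subrr eqxx andbT; apply/eqP; ring.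
have qA x : qf A x = 2 * qf (map_mx (@complex.Re R) M) x.
  by rewrite /qf -scalemxAr -scalemxAl mxE.
have Au : A \in unitmx.
  rewrite -row_free_unit -kermx_eq0; apply/rowV0P => v /sub_kermxP vA.
  apply/eqP; apply/negP => /negP/Mpos; suff -> : qf (map_mx (@complex.Re R) M) v = 0 by rewrite ltxx.
  by apply: (mulfI (x := 2)) => //; rewrite -qA /qf vA mul0mx mxE mulr0.
have AT : A^T = A.
  by apply/matrixP => i j; rewrite !mxE -[in RHS]MT mxE.
have GE : G = map_mx (real_complex R) (invmx A) by rewrite /G GA map_invmx.
have AVT : (invmx A)^T = invmx A by rewrite trmx_inv AT.
have GAT : G^T = G.
  by rewrite GE; move: AVT; move: (invmx A) => Z ZT; apply/matrixP => i j; rewrite !mxE -[in RHS]ZT mxE.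
split => //.
- by rewrite GA map_unitmx.
- by rewrite GE -map_mx_comp; apply/matrixP => i j; rewrite !mxE /= oppr0.
apply: posdef_lowerC => // X X0.
have -> : map_mx (@complex.Re R) G = invmx A.
  by rewrite GE -map_mx_comp; apply/matrixP => i j; rewrite !mxE.
have -> : qf (invmx A) X = qf A (X *m invmx A).
  by rewrite /qf mulmxKV// trmx_mul trmx_inv AT mulmxA.
rewrite qA mulr_gt0// Mpos//; apply: contra_neq X0 => X0.
by rewrite -[X](mulmxKV Au) X0 mul0mx.
Qed.

End quadratic_bounds.

(** * Estimates in the Fock space *)

Section fock.
Variables (R : realType) (n : nat) (Q : 'M[R[i]]_(n + n)) (M : 'M[R[i]]_n).
Variables (I : finType) (g d : I -> 'rV[R[i]]_(n + n)) (kap : I -> R[i]).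
Local Notation ii := ('i%C : R[i]).
Local Notation J := (Jmx R n).
Local Notation ann := (annmx M).
Hypothesis Qs : Q^T = Q.
Hypothesis MT : M^T = M.
Hypothesis geig : forall i, (2 * ii) *: (g i *m J *m Q) = kap i *: g i.
Hypothesis gg : forall i k, g i *m J *m (g k)^T = 0.
Hypothesis dg : forall i k, - ii *: (d i *m J *m (g k)^T) = ((i == k)%:R)%:M.
Hypothesis dann : forall i, (d i <= ann)%MS.
Hypothesis annQ : (ann *m J *m Q <= ann)%MS.
Hypothesis gspan : forall l : 'rV[R[i]]_(n + n),
  exists (a : I -> R[i]) (y : 'rV[R[i]]_n), l = \sum_i a i *: g i + y *m ann.
Variable c1 : R.
Hypothesis c1p : 0 < c1.
Hypothesis c1Q : forall v : 'I_(n + n) -> R[i],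
  c1 * \sum_a sqc (v a) <= complex.Re (\sum_a \sum_b Q a b * v b * (v a)^*%C).
Local Notation Gam := (M + map_mx (@conjc R) M).
Local Notation G := (invmx Gam).
Hypothesis Gu : Gam \in unitmx.
Hypothesis GT : G^T = G.
Hypothesis GJ : map_mx (@conjc R) G = G.
Variable c2 : R.
Hypothesis c2p : 0 < c2.
Hypothesis c2G : forall v : 'I_n -> R[i],
  c2 * \sum_a sqc (v a) <= complex.Re (\sum_a \sum_b G a b * v b * (v a)^*%C).
Hypothesis Gam_ge0 : forall j, 0 <= complex.Re (Gam j j).

(** The creation operators: conjugating coefficients gives the adjoint, because every letter [L a]
    will be symmetric. *)
Definition cremx : 'M[R[i]]_(n, n + n) := map_mx (@conjc R) ann.

Lemma cremxE : cremx = row_mx (map_mx (@conjc R) M) (ii%:M).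
Proof.
rewrite /cremx /annmx map_row_mx; congr row_mx.
rewrite map_mxN map_scalar_mx -raddfN; congr _%:M.
by apply/eqP; rewrite eq_complex /= oppr0 opprK !eqxx.
Qed.

Lemma ann_cre : ann *m J *m cremx^T = ii *: Gam.
Proof.
have MJT : (map_mx (@conjc R) M)^T = map_mx (@conjc R) M.
  by apply/matrixP => i j; rewrite !mxE -[in RHS]MT mxE.
rewrite cremxE /annmx mul_row_Jmx opprK tr_row_mx mul_row_col.
by rewrite MJT tr_scalar_mx mul_scalar_mx mul_mx_scalar scalerDr addrC.
Qed.

Lemma cre_cre : cremx *m J *m cremx^T = 0.
Proof.
have MJT : (map_mx (@conjc R) M)^T = map_mx (@conjc R) M.
  by apply/matrixP => i j; rewrite !mxE -[in RHS]MT mxE.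
rewrite cremxE mul_row_Jmx tr_row_mx mul_row_col MJT tr_scalar_mx.
by rewrite mulNmx mul_scalar_mx mul_mx_scalar addNr.
Qed.

(** Coefficients of l on the annihilators, and [dec1] those on the creators: the xi-components give
    the difference of the two, the x-components then a linear system with matrix M + conj M. *)
Definition dec2 (l : 'rV[R[i]]_(n + n)) : 'rV[R[i]]_n :=
  (lsubmx l + ii *: (rsubmx l *m map_mx (@conjc R) M)) *m G.
Definition dec1 (l : 'rV[R[i]]_(n + n)) : 'rV[R[i]]_n := dec2 l - ii *: rsubmx l.

Lemma decE l : l = dec1 l *m cremx + dec2 l *m ann.
Proof.
rewrite cremxE /annmx !mul_mx_row add_row_mx -[LHS]hsubmxK; congr row_mx.
  rewrite /dec1 mulmxBl addrAC -mulmxDr.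
  by rewrite [map_mx _ _ + M]addrC /dec2 mulmxKV// -scalemxAl addrK.
rewrite mulmxN !mul_mx_scalar /dec1 scalerBr scalerA -expr2 sqr_i scaleN1r opprK.
by rewrite addrAC subrr add0r.
Qed.

(** Serves annihilators and creators alike: c2^-1 comes from the lower bound of the oscillator, the
    trace from the commutator in |c' u|^2 = |c u|^2 + h Gam |u|^2, where c' is the adjoint of c. *)
Definition cstN : R := Num.sqrt (c2^-1 + \sum_j complex.Re (Gam j j)).

(* Bounds the norm of [op l] on polynomials of degree at most N by
   [cstOp l * sqrt (h (N + 1))]. *)
Definition cstOp l : R :=
  \sum_j (Normc.normc (dec1 l ord0 j) + Normc.normc (dec2 l ord0 j)) * cstN.

Lemma cstOp_ge0 l : 0 <= cstOp l.
Proof.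
by apply: sumr_ge0 => j _; rewrite mulr_ge0 ?sqrtr_ge0 ?addr_ge0 ?normc_ge0.
Qed.

Definition cstT (A : 'M[R[i]]_(n + n)) : R := \sum_a \sum_b
  Normc.normc (A a b) * (cstOp (delta_mx ord0 a) * cstOp (delta_mx ord0 b)).

Lemma cstT_ge0 A : 0 <= cstT A.
Proof.
by apply: sumr_ge0 => a _; apply: sumr_ge0 => b _; rewrite !mulr_ge0 ?cstOp_ge0 ?normc_ge0.
Qed.

(** Bounds the number operators by [cstX] (N + 1) in degree at most N, uniformly in h: the two
    letters give a factor h, which their normalization by h^-1 cancels. *)
Definition cstX : R := \sum_i cstOp (g i) * cstOp (d i).

Lemma cstX_ge0 : 0 <= cstX.
Proof. by apply: sumr_ge0 => i _; rewrite mulr_ge0 ?cstOp_ge0. Qed.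

Section representation.
Variables (h : R) (V : lmodType R[i]) (L : 'I_(n + n) -> V -> V).
Variables (ip : V -> V -> R[i]) (v0 : V).
Hypothesis h0 : 0 < h.
Hypothesis Ll : forall a c u v, L a (c *: u + v) = c *: L a u + L a v.
Hypothesis ccr : forall a b v,
  L a (L b v) = L b (L a v) + (- ii * h%:C%C * J a b) *: v.
Hypothesis ipL : forall a u v w, ip (a *: u + v) w = a * ip u w + ip v w.
Hypothesis ipJ : forall u v, ip v u = (ip u v)^*%C.
Hypothesis ip_ge0 : forall v, 0 <= complex.Re (ip v v).
Hypothesis Lsym : forall a u v, ip (L a u) v = ip u (L a v).
(** Positivity on scalars carries over to vectors. In the model by functions it holds pointwise,
    under the integral. *)
Hypothesis ip_pos : forall p (A : 'M[R[i]]_p) (c : R),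
  (forall v : 'I_p -> R[i], c * \sum_a sqc (v a) <=
     complex.Re (\sum_a \sum_b A a b * v b * (v a)^*%C)) ->
  forall f : 'I_p -> V, c * \sum_a nm ip (f a) ^+ 2 <=
     complex.Re (\sum_a \sum_b A a b * ip (f b) (f a)).
Hypothesis vac : forall j, op L (row j ann) v0 = 0.
Hypothesis vac_uniq : forall w, (forall j, op L (row j ann) w = 0) ->
  exists c, w = c *: v0.
Local Notation cj j := (op L (row j ann)).
Local Notation cs j := (op L (row j cremx)).
Local Notation W := (word (fun j => op L (row j cremx)) v0).
Local Notation S N := (wspan (fun j => op L (row j cremx)) v0 (leq^~ N)).
Local Notation Wg := (word (fun i => op L (g i)) v0).
Local Notation Sg N := (wspan (fun i => op L (g i)) v0 (leq^~ N)).
Hypothesis gen : forall v, exists N, S N v.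
Local Notation nrm := (nm ip).
Hypothesis nv0 : 0 < nrm v0.
Local Notation opl := (op_linear Ll).
Local Notation T := (Tq L Q).
Implicit Types (u v w r : V).

Let nmge0 := nm_ge0 ip.
#[local] Hint Resolve nmge0 : core.

Lemma vac_mul (y : 'rV[R[i]]_n) : op L (y *m ann) v0 = 0.
Proof. by rewrite op_mul big1// => j _; rewrite vac scaler0. Qed.

Lemma vac_sub (l : 'rV[R[i]]_(n + n)) : (l <= ann)%MS -> op L l v0 = 0.
Proof. by move=> /submxP[y ->]; exact: vac_mul. Qed.

Lemma cj_cs j k u : cj j (cs k u) = cs k (cj j u) + (h%:C%C * Gam j k) *: u.
Proof.
rewrite (op_comm Ll ccr) row_form ann_cre; congr (_ + _ *: _).
rewrite [X in _ * X = _]mxE eqxx mulr1n [X in _ * X = _]mxE mulrA; congr (_ * _).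
by rewrite mulrAC mulNr -expr2 sqr_i opprK mul1r.
Qed.

Lemma cs_cs j k u : cs j (cs k u) = cs k (cs j u).
Proof.
by rewrite (op_comm Ll ccr) row_form cre_cre !mxE mul0rn mulr0 scale0r addr0.
Qed.

(** The oscillator H = sum of G_jk c'_j c_k, with c'_j the creators. Taking for G the inverse of the
    commutator matrix makes each creator raise H by exactly h, so a word of length D has eigenvalue
    h D. *)
Definition Hmx : 'M[R[i]]_(n + n) := cremx^T *m G *m ann.

Lemma Hop_E u : Tq L Hmx u = \sum_j \sum_k G j k *: cs j (cj k u).
Proof.
have E j k : cs j (cj k u) =
    \sum_a \sum_b (cremx j a * ann k b) *: L a (L b u).
  rewrite {1}/op; apply: eq_bigr => a _; rewrite [row _ _ _ _]mxE.
  rewrite /op (big_morph (L a) (id1 := 0) (op1 := +%R)); last 2 first.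
  - by move=> x y; have := Ll a 1 x y; rewrite !scale1r.
  - exact: (lin0 (Ll a)).
  rewrite scaler_sumr; apply: eq_bigr => b _; rewrite [row _ _ _ _]mxE.
  have -> : L a (ann k b *: L b u) = ann k b *: L a (L b u).
    by have := Ll a (ann k b) (L b u) 0; rewrite (lin0 (Ll a)) !addr0.
  by rewrite scalerA.
transitivity (\sum_j \sum_k \sum_a \sum_b (G j k * (cremx j a * ann k b)) *: L a (L b u)); last first.
  apply: eq_bigr => j _; apply: eq_bigr => k _; rewrite E scaler_sumr.
  by apply: eq_bigr => a _; rewrite scaler_sumr; apply: eq_bigr => b _; rewrite scalerA.
under [RHS]eq_bigr do rewrite exchange_big /=.
rewrite [RHS]exchange_big /=; apply: eq_bigr => a _.
under [RHS]eq_bigr do rewrite exchange_big /=.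
rewrite [RHS]exchange_big /=; apply: eq_bigr => b _.
under [RHS]eq_bigr do rewrite -scaler_suml.
rewrite -scaler_suml; congr (_ *: _); rewrite exchange_big /= /Hmx [LHS]mxE.
apply: eq_bigr => k _; rewrite [(_ *m G) _ _]mxE mulr_suml; apply: eq_bigr => j _.
by rewrite [_^T _ _]mxE; ring.
Qed.

Let Hopl := Tq_linear Ll Hmx.

Lemma Hop_cs l u : Tq L Hmx (cs l u) = cs l (Tq L Hmx u) + h%:C%C *: cs l u.
Proof.
have csZ c x : cs l (c *: x) = c *: cs l x by exact: (opZr Ll).
have csD x y : cs l (x + y) = cs l x + cs l y by exact: (opDr Ll).
have cs_sum (P : 'I_n -> V) : cs l (\sum_j P j) = \sum_j cs l (P j).
  by apply: (big_morph (op L (row l cremx)) csD); exact: (op0r Ll).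
rewrite !Hop_E cs_sum.
transitivity (\sum_j \sum_k (G j k *: cs l (cs j (cj k u)) +
   (h%:C%C * (G j k * Gam k l)) *: cs j u)).
  apply: eq_bigr => j _; apply: eq_bigr => k _.
  rewrite cj_cs (opDr Ll) (opZr Ll) scalerDr scalerA (cs_cs j l).
  by congr (_ + _ *: _); ring.
under eq_bigr do rewrite big_split /=.
rewrite big_split /=; congr (_ + _).
  by apply: eq_bigr => j _; rewrite cs_sum; apply: eq_bigr => k _; rewrite csZ.
have GG j : \sum_k h%:C%C * (G j k * Gam k l) = h%:C%C * (j == l)%:R.
  rewrite -mulr_sumr; congr (_ * _).
  by have /matrixP/(_ j l) := mulVmx Gu; rewrite mxE [in RHS]mxE.
under eq_bigr do rewrite -scaler_suml GG.
rewrite (bigD1 l) //= eqxx mulr1 big1 ?addr0// => j jl.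
by rewrite (negbTE jl) mulr0 scale0r.
Qed.

Lemma Hop_v0 : Tq L Hmx v0 = 0.
Proof.
rewrite Hop_E big1// => j _; rewrite big1// => k _.
by rewrite vac (op0r Ll) scaler0.
Qed.

Lemma Hop_word t : Tq L Hmx (W t) = (h * (size t)%:R)%:C%C *: W t.
Proof.
elim: t => [|l t IH]; first by rewrite /= Hop_v0 mulr0 scale0r.
rewrite [W _]/= Hop_cs IH (opZr Ll) -scalerDl; congr (_ *: _).
by rewrite -rmorphD /= -natr1 mulrDr mulr1.
Qed.

Lemma Hop_hom D u : wspan (fun j => op L (row j cremx)) v0 (pred1 D) u ->
  Tq L Hmx u = (h * D%:R)%:C%C *: u.
Proof.
apply: (wspan_eq_lin (f2 := fun u => (h * D%:R)%:C%C *: u)); first exact: Hopl.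
  by move=> a x y; rewrite scalerDr !scalerA mulrC.
by move=> t /eqP <-; exact: Hop_word.
Qed.

Lemma op_adj l u v : ip (op L l u) v = ip u (op L (map_mx (@conjc R) l) v).
Proof.
rewrite /op (ip_suml ipL) (ip_sumr ipL ipJ); apply: eq_bigr => a _.
by rewrite (ipZl ipL) (ipZr ipL ipJ) mxE conjcK Lsym.
Qed.

Lemma Tq_form (A : 'M[R[i]]_(n + n)) u v :
  ip (Tq L A u) v = \sum_a \sum_b A a b * ip (L b u) (L a v).
Proof.
rewrite /Tq (ip_suml ipL); apply: eq_bigr => a _; rewrite (ip_suml ipL).
by apply: eq_bigr => b _; rewrite (ipZl ipL) Lsym.
Qed.

Lemma Tq_adj (A : 'M[R[i]]_(n + n)) u v : ip (Tq L A u) v = ip u (Tq L A^H v).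
Proof.
rewrite Tq_form ipJ Tq_form rmorph_sum exchange_big /=; apply: eq_bigr => b _.
rewrite rmorph_sum; apply: eq_bigr => a _.
by rewrite rmorphM /= -ipJ !mxE conjcK.
Qed.

Lemma Hmx_herm : Hmx^H = Hmx.
Proof.
rewrite /Hmx !ctrM GJ GT mulmxA; congr (_ *m _ *m _).
by apply/matrixP => i j; rewrite !mxE conjcK.
Qed.

(** Eigenvectors of the symmetric operator H for the distinct real eigenvalues h D and h D'. *)
Lemma hom_orth D D' u v : D != D' ->
  wspan (fun j => op L (row j cremx)) v0 (pred1 D) u ->
  wspan (fun j => op L (row j cremx)) v0 (pred1 D') v -> ip u v = 0.
Proof.
move=> DD uD vD; have := Tq_adj Hmx u v.
rewrite Hmx_herm (Hop_hom uD) (Hop_hom vD) (ipZl ipL) (ipZr ipL ipJ).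
rewrite conjc_real => /eqP; rewrite -subr_eq0 -mulrBl mulf_eq0 => /orP[|/eqP//].
rewrite -rmorphB /= -mulrBr => /eqP [] /eqP; rewrite mulf_eq0 (gt_eqF h0) /=.
by rewrite subr_eq0 eqr_nat (negbTE DD).
Qed.

Section decomposition.
Variables (D : nat) (f : nat -> V).
Hypothesis fh : forall e, wspan (fun j => op L (row j cremx)) v0 (pred1 e) (f e).

Lemma ip_decomp (P P' : pred nat) (c : nat -> R[i]) :
  ip (\sum_(e < D | P e) c e *: f e) (\sum_(e < D | P' e) f e) =
  \sum_(e < D | P e && P' e) c e * ip (f e) (f e).
Proof.
rewrite (ip_suml ipL) big_mkcondr /=; apply: eq_bigr => e Pe.
rewrite (ipZl ipL) (ip_sumr ipL ipJ); case: ifP => Pe'; last first.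
  rewrite big1 ?mulr0// => e' Pe2; apply: hom_orth (fh _) (fh _).
  by apply: contraFN Pe' => /eqP ->.
rewrite (bigD1 e)//= big1 ?addr0// => e' /andP[_ ee'].
by apply: hom_orth (fh _) (fh _); rewrite eq_sym.
Qed.

Lemma nm_decomp (P : pred nat) :
  nrm (\sum_(e < D | P e) f e) ^+ 2 = \sum_(e < D | P e) nrm (f e) ^+ 2.
Proof.
rewrite (nm_sqr ip_ge0).
have := ip_decomp P P (fun=> 1); under eq_bigr do rewrite scale1r.
move=> ->; rewrite Re_sum; apply: eq_big => [e|e _]; first by rewrite andbb.
by rewrite mul1r (nm_sqr ip_ge0).
Qed.

Lemma Hop_decomp (P : pred nat) :
  complex.Re (ip (Tq L Hmx (\sum_(e < D | P e) f e)) (\sum_(e < D | P e) f e)) =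
  \sum_(e < D | P e) h * e%:R * nrm (f e) ^+ 2.
Proof.
rewrite (big_morph (Tq L Hmx) (id1 := 0) (op1 := +%R)); last 2 first.
- by move=> x y; have := Hopl 1 x y; rewrite !scale1r.
- exact: (lin0 Hopl).
under eq_bigr => e _ do rewrite (Hop_hom (fh e)).
rewrite (ip_decomp P P (fun e => (h * e%:R)%:C%C)) Re_sum.
apply: eq_big => [e|e _]; first by rewrite andbb.
by rewrite ReM /= mul0r subr0 (nm_sqr ip_ge0).
Qed.

End decomposition.

Lemma hom_in N e u : (e <= N)%N -> wspan (fun j => op L (row j cremx)) v0 (pred1 e) u -> S N u.
Proof. by move=> eN; apply: wspanW => e' /eqP ->. Qed.

Lemma S_decomp N u : S N u -> exists2 f : nat -> V,
  (forall e, wspan (fun j => op L (row j cremx)) v0 (pred1 e) (f e)) &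
  u = \sum_(e < N.+1) f e.
Proof. by move=> uN; apply: wspan_decomp; apply: wspanW uN => e /=; rewrite ltnS. Qed.

Lemma ip_pos_Tq (A : 'M[R[i]]_(n + n)) (c : R) :
  (forall v : 'I_(n + n) -> R[i], c * \sum_a sqc (v a) <=
     complex.Re (\sum_a \sum_b A a b * v b * (v a)^*%C)) ->
  forall u, c * \sum_a nrm (L a u) ^+ 2 <= complex.Re (ip (Tq L A u) u).
Proof. by move=> cA u; rewrite Tq_form; apply: (ip_pos cA). Qed.

Lemma Hop_lower u :
  c2 * \sum_j nrm (cj j u) ^+ 2 <= complex.Re (ip (Tq L Hmx u) u).
Proof.
suff -> : ip (Tq L Hmx u) u = \sum_j \sum_k G j k * ip (cj k u) (cj j u).
  exact: (ip_pos c2G).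
rewrite Hop_E (ip_suml ipL); apply: eq_bigr => j _; rewrite (ip_suml ipL).
apply: eq_bigr => k _; rewrite (ipZl ipL) op_adj; congr (_ * ip _ (op L _ _)).
by apply/rowP => a; rewrite !mxE conjcK.
Qed.

Definition sN N := Num.sqrt (h * N.+1%:R).

Lemma sN_sqr N : sN N ^+ 2 = h * N.+1%:R.
Proof. by rewrite sqr_sqrtr// mulr_ge0// ltW. Qed.

Lemma sN_ge0 N : 0 <= sN N. Proof. exact: sqrtr_ge0. Qed.

Lemma sN_le N N' : (N <= N')%N -> sN N <= sN N'.
Proof. by move=> NN; rewrite /sN ler_wsqrtr// ler_pM2l// ler_nat. Qed.

Lemma cstN_sqr : cstN ^+ 2 = c2^-1 + \sum_j complex.Re (Gam j j).
Proof. by rewrite sqr_sqrtr// addr_ge0 ?invr_ge0 ?sumr_ge0// ltW. Qed.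

(** c2 |c_j u|^2 <= <H u, u>, and H is at most h N in degree at most N by orthogonality of the
    homogeneous parts. *)
Lemma nm_cj2 N u j : S N u -> nrm (cj j u) ^+ 2 <= c2^-1 * (h * N%:R) * nrm u ^+ 2.
Proof.
move=> uN; rewrite -mulrA ler_pdivlMl//.
apply: (@le_trans _ _ (c2 * \sum_j nrm (cj j u) ^+ 2)).
  by rewrite ler_pM2l// (bigD1 j)//= lerDl sumr_ge0// => k _; exact: sqr_ge0.
apply: (le_trans (Hop_lower u)).
have [f fh ->] := S_decomp uN; rewrite (Hop_decomp _ fh predT) (nm_decomp _ fh predT).
rewrite mulr_sumr; apply: ler_sum => e _; rewrite ler_wpM2r ?sqr_ge0//.
by rewrite ler_pM2l// ler_nat -ltnS.
Qed.

Lemma nm_cj N u j : S N u -> nrm (cj j u) <= cstN * sN N * nrm u.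
Proof.
move=> uN; rewrite -(@ler_pXn2r _ 2) ?nnegrE ?mulr_ge0 ?sqrtr_ge0 ?sN_ge0//.
apply: (le_trans (nm_cj2 j uN)); rewrite !exprMn sN_sqr cstN_sqr.
rewrite ler_wpM2r ?sqr_ge0// ler_pM ?invr_ge0 ?mulr_ge0 ?(ltW c2p) ?(ltW h0)//.
  by rewrite lerDl sumr_ge0.
by rewrite ler_pM2l// ler_nat.
Qed.

Lemma nm_cs N u j : S N u -> nrm (cs j u) <= cstN * sN N * nrm u.
Proof.
move=> uN; rewrite -(@ler_pXn2r _ 2) ?nnegrE ?mulr_ge0 ?sqrtr_ge0 ?sN_ge0//.
rewrite !exprMn sN_sqr cstN_sqr (nm_sqr ip_ge0).
have -> : ip (cs j u) (cs j u) = ip (cj j (cs j u)) u.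
  rewrite [RHS]op_adj; congr (ip _ (op L _ u)).
  by apply/rowP => a; rewrite !mxE.
rewrite cj_cs (ipDl ipL) (ipZl ipL) ReD.
have -> : ip (cs j (cj j u)) u = ip (cj j u) (cj j u).
  rewrite [LHS]op_adj; congr (ip _ (op L _ u)).
  by apply/rowP => a; rewrite !mxE conjcK.
rewrite -(nm_sqr ip_ge0) (ipvv ipJ ip_ge0) -mulrA ReM /= mul0r subr0.
rewrite (ReM (Gam j j)) /= mulr0 subr0.
apply: (le_trans (lerD (nm_cj2 j uN) (lexx _))).
set x := nrm u ^+ 2; have x0 : 0 <= x by exact: sqr_ge0.
have GS : complex.Re (Gam j j) <= \sum_j complex.Re (Gam j j).
  by rewrite [leRHS](bigD1 j)//= lerDl sumr_ge0.
have a0 : 0 <= c2^-1 by rewrite invr_ge0 ltW.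
have := Gam_ge0 j; move: (complex.Re _) (\sum_j _) (c2^-1) GS a0 => y Y a yY a0 y0.
rewrite -natr1 -subr_ge0 (_ : _ - _ = (a + Y * N%:R + (Y - y)) * (h * x)); last by ring.
have Y0 : 0 <= Y by exact: le_trans yY.
by rewrite mulr_ge0 ?(mulr_ge0 (ltW h0))// addr_ge0 ?subr_ge0// addr_ge0// mulr_ge0.
Qed.

Lemma nm_op N l u : S N u -> nrm (op L l u) <= cstOp l * sN N * nrm u.
Proof.
move=> uN; rewrite [in leLHS](decE l) opD !op_mul.
apply: (le_trans (nmD ipL ipJ ip_ge0 _ _)).
rewrite /cstOp !mulr_suml; under [leRHS]eq_bigr do rewrite mulrDl 2!mulrDl.
rewrite big_split /=.
by apply: lerD; apply: (le_trans (nm_sum ipL ipJ ip_ge0 _ _ _)); apply: ler_sum => j _;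
  rewrite (nmZ ipL ipJ ip_ge0) -!mulrA ler_wpM2l ?normc_ge0// mulrA;
  [exact: nm_cs|exact: nm_cj].
Qed.

Lemma cre_gen (l : 'rV[R[i]]_(n + n)) : exists (s : seq 'I_n) (a : 'I_n -> R[i]) k,
  l = \sum_(i <- s) a i *: row i cremx + k /\ op L k v0 = 0.
Proof.
exists (index_enum 'I_n), (fun j => dec1 l ord0 j), (dec2 l *m ann).
by rewrite -mulmx_sum_row -decE vac_mul.
Qed.

Lemma S_op N l u : S N u -> S N.+1 (op L l u).
Proof. exact: (op_span Ll ccr cre_gen). Qed.

(** Each letter costs at most a constant times sqrt (h (N + 2)), since the outer one acts on an
    element of degree up to N + 1. *)
Lemma nm_Tq N A r : S N r -> nrm (Tq L A r) <= cstT A * (h * N.+2%:R) * nrm r.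
Proof.
move=> rN; rewrite /Tq /cstT.
apply: (le_trans (nm_sum ipL ipJ ip_ge0 _ _ _)); rewrite !mulr_suml; apply: ler_sum => a _.
apply: (le_trans (nm_sum ipL ipJ ip_ge0 _ _ _)); rewrite !mulr_suml; apply: ler_sum => b _.
rewrite (nmZ ipL ipJ ip_ge0) -!mulrA ler_wpM2l ?normc_ge0//.
have r1 : S N.+1 (L b r) by rewrite -op_delta; exact: S_op.
have := nm_op (delta_mx ord0 a) r1; rewrite op_delta => /le_trans; apply.
have := nm_op (delta_mx ord0 b) rN; rewrite op_delta => H.
rewrite -!mulrA; apply: ler_wpM2l; first exact: cstOp_ge0.
apply: (@le_trans _ _ (sN N.+1 * (cstOp (delta_mx ord0 b) * sN N.+1 * nrm r))).
  rewrite ler_wpM2l ?sN_ge0//; apply: (le_trans H).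
  by rewrite ler_wpM2r// ler_wpM2l ?cstOp_ge0// sN_le.
have := sN_sqr N.+1; rewrite le_eqVlt expr2 => E; apply/orP; left; apply/eqP.
by rewrite [h * _]mulrA -E; ring.
Qed.

Lemma g_gen (l : 'rV[R[i]]_(n + n)) : exists (s : seq I) (a : I -> R[i]) k,
  l = \sum_(i <- s) a i *: g i + k /\ op L k v0 = 0.
Proof.
have [a [y ->]] := gspan l; exists (index_enum I), a, (y *m ann).
by rewrite vac_mul.
Qed.

(** With the converse below, the spectral and the orthogonal gradings share one filtration: each
    family generates all letters modulo operators killing the vacuum. *)
Lemma Sg_S N u : Sg N u -> S N u.
Proof.
elim=> [|a t v tN _ IH]; first exact: wspan0.
apply: wspanD => //; apply: wspanZ.
apply: wspanW (word_op_span Ll ccr cre_gen g t) => e /= et.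
exact: leq_trans tN.
Qed.

Lemma S_Sg N u : S N u -> Sg N u.
Proof.
elim=> [|a t v tN _ IH]; first exact: wspan0.
apply: wspanD => //; apply: wspanZ.
apply: wspanW (word_op_span Ll ccr g_gen (fun j => row j cremx) t) => e /= et.
exact: leq_trans tN.
Qed.

Lemma d_g i k u : op L (d i) (op L (g k) u) =
  op L (g k) (op L (d i) u) + (h * (i == k)%:R)%:C%C *: u.
Proof.
rewrite (op_comm Ll ccr); congr (_ + _ *: _).
rewrite mulrAC; have /matrixP/(_ ord0 ord0) := dg i k.
rewrite [LHS]mxE [RHS]mxE eqxx mulr1n => ->.
by rewrite rmorphM /= rmorph_nat mulrC.
Qed.

Lemma g_g i k u : op L (g i) (op L (g k) u) = op L (g k) (op L (g i) u).
Proof. by rewrite (op_comm Ll ccr) gg mxE mulr0 scale0r addr0. Qed.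

(** The number operator of mode i: [d i] acts as the derivation dual to [g i], so the eigenvalue on
    a word is the number of its letters i. *)
Definition Nop i u : V := (h^-1)%:C%C *: op L (g i) (op L (d i) u).

Lemma Nop_linear i a u v : Nop i (a *: u + v) = a *: Nop i u + Nop i v.
Proof. by rewrite /Nop !(op_linear Ll) scalerDr !scalerA mulrC. Qed.

Lemma h_hV (x : V) : h%:C%C *: ((h^-1)%:C%C *: x) = x.
Proof. by rewrite scalerA -rmorphM /= divff ?gt_eqF// scale1r. Qed.

Lemma Nop_word i t : Nop i (Wg t) = (count_mem i t)%:R *: Wg t.
Proof.
elim: t => [|k t IH].
  by rewrite /Nop /= (vac_sub (dann i)) (op0r Ll) scaler0 scale0r.
rewrite /Nop [Wg _]/= d_g (opDr Ll) (opZr Ll) g_g scalerDr.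
have -> : (h^-1)%:C%C *: op L (g k) (op L (g i) (op L (d i) (Wg t))) =
    op L (g k) (Nop i (Wg t)) by rewrite /Nop (opZr Ll).
rewrite IH (opZr Ll) scalerA -rmorphM /= mulKf ?gt_eqF// rmorph_nat.
have [<-|_] := eqVneq i k; first by rewrite natrD scalerDl addrC.
by rewrite scale0r addr0.
Qed.

Definition zev (z0 : R[i]) (nu : I -> nat) : R[i] :=
  z0 + h%:C%C * \sum_i kap i * (nu i)%:R.

(** The plane of annihilators is stable under l -> l J Q, so they all kill T v0 as well. *)
Lemma T_vac : exists z0, T v0 = z0 *: v0.
Proof.
apply: vac_uniq => j; have := Tq_comm Ll ccr Qs (row j ann) v0.
rewrite vac (lin0 (Tq_linear Ll Q)) opZ vac_sub ?scaler0 ?addr0//.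
by rewrite -!row_mul (submx_trans (row_sub _ _)).
Qed.

Lemma T_word z0 t : T v0 = z0 *: v0 ->
  T (Wg t) = zev z0 (fun i => count_mem i t) *: Wg t.
Proof.
move=> T0; elim: t => [|k t IH].
  by rewrite [Wg _]/= T0 /zev big1 ?mulr0 ?addr0// => i _; rewrite mulr0.
rewrite [Wg _]/= (Tq_comm Ll ccr Qs) IH geig opZ (opZr Ll) scalerA -scalerDl.
congr (_ *: _); rewrite /zev -addrA -mulrDr; congr (_ + _ * _).
rewrite [in RHS](eq_bigr (fun i => kap i * (count_mem i t)%:R + kap i * (i == k)%:R)); last first.
  by move=> i _; rewrite /= natrD mulrDr addrC eq_sym.
rewrite big_split /=; congr (_ + _); rewrite (bigD1 k)//= eqxx mulr1 big1 ?addr0//.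
by move=> i ik; rewrite (negbTE ik) mulr0.
Qed.

(** Operators are bounded in each degree, so [d i] maps null vectors to null vectors; but it maps
    the word i t to h times the number of letters i in it, a positive multiple of the word t. *)
Lemma word_neq0 t : 0 < nrm (Wg t).
Proof.
elim: t => [|i t IH]; first exact: nv0.
rewrite lt_neqAle nmge0 andbT eq_sym; apply/eqP => W0.
have : S (size t).+1 (Wg (i :: t)) by apply: Sg_S; exact: wspan_word.
move=> /(nm_op (d i)); rewrite W0 mulr0 [Wg _]/= d_g eqxx mulr1.
have -> : op L (g i) (op L (d i) (Wg t)) = (h * (count_mem i t)%:R)%:C%C *: Wg t.
  by rewrite -[LHS]h_hV -/(Nop i _) Nop_word scalerA rmorphM /= rmorph_nat.
rewrite -scalerDl -rmorphD /= (nmZ ipL ipJ ip_ge0) leNgt => /negP; apply.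
rewrite mulr_gt0//= expr0n /= addr0 sqrtr_sqr normr_gt0 gt_eqF//.
by rewrite ltr_wpDl// mulr_ge0// ltW.
Qed.

Definition cstE N := expR (cstX * N.+1%:R + 2 * N%:R) : R.

Lemma nm_Nop N i u : S N u -> S N (Nop i u) /\ nrm (Nop i u) <= cstX * N.+1%:R * nrm u.
Proof.
move=> uN.
have du : S N (op L (d i) u) by apply: (killer_span Ll ccr _ uN); exact: vac_sub.
split.
  apply: Sg_S; move: (S_Sg uN); apply: wspan_map; first exact: Nop_linear.
  by move=> t tN; rewrite Nop_word; apply: wspanZ; exact: wspan_word.
rewrite /Nop (nmZ ipL ipJ ip_ge0) /= expr0n /= addr0 sqrtr_sqr ger0_norm ?invr_ge0 ?(ltW h0)//.
rewrite ler_pdivrMl//; apply: (le_trans (nm_op (g i) du)).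
apply: (@le_trans _ _ (cstOp (g i) * sN N * (cstOp (d i) * sN N * nrm u))).
  by rewrite ler_wpM2l ?mulr_ge0 ?cstOp_ge0 ?sN_ge0// nm_op.
rewrite (_ : _ * _ = (cstOp (g i) * cstOp (d i)) * (sN N ^+ 2 * nrm u)); last by ring.
rewrite sN_sqr [leRHS](_ : _ = cstX * (h * N.+1%:R * nrm u)); last by ring.
rewrite ler_wpM2r ?mulr_ge0// ?(ltW h0)// /cstX (bigD1 i)//= lerDl sumr_ge0// => k _.
by rewrite mulr_ge0 ?cstOp_ge0.
Qed.

(** For s = [enum I], the joint spectral projection of the number operators to the multi-index nu,
    in degree at most N. *)
Definition Pi N (s : seq I) (nu : I -> nat) u : V :=
  foldr (fun i w => lagr (Nop i) N (nu i) w) u s.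

Lemma Pi_linear N s nu a u v : Pi N s nu (a *: u + v) = a *: Pi N s nu u + Pi N s nu v.
Proof.
by rewrite /Pi; elim: s => //= i s ->; rewrite (lagr_linear (@Nop_linear i)).
Qed.

Lemma Pi_word N s nu t : (forall i, nu i <= N)%N -> (size t <= N)%N ->
  Pi N s nu (Wg t) = (all (fun i => count_mem i t == nu i) s)%:R *: Wg t.
Proof.
move=> nuN tN; elim: s => [|i s IH] /=; first by rewrite scale1r.
rewrite IH; set b := all _ _.
have := lagr_linear (@Nop_linear i) N (nu i) b%:R (Wg t) 0.
rewrite (lin0 (lagr_linear (@Nop_linear i) N (nu i))) !addr0 => ->.
rewrite (lagr_eigen (@Nop_linear i) _ (Nop_word i t)); last first.
  exact: leq_trans (count_size _ _) tN.
by rewrite scalerA mulrC -natrM mulnb.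
Qed.

Lemma Pi_bound N s nu u : (forall i, nu i <= N)%N -> S N u ->
  S N (Pi N s nu u) /\ nrm (Pi N s nu u) <= cstE N ^+ size s * nrm u.
Proof.
move=> nuN uN; elim: s => [|i s [IH1 IH2]] /=; first by rewrite expr0 mul1r.
have XB w : S N w -> nrm (Nop i w) <= cstX * N.+1%:R * nrm w by move=> /(nm_Nop i)[].
have XS w : S N w -> S N (Nop i w) by move=> /(nm_Nop i)[].
have B0 : 0 <= cstX * N.+1%:R by rewrite mulr_ge0 ?cstX_ge0.
have Sl a x y : S N x -> S N y -> S N (a *: x + y).
  by move=> xN yN; apply: wspanD => //; exact: wspanZ.
have [P1 P2] := lagr_bound (nm_ge0 ip) (nmZ ipL ipJ ip_ge0) (nmB ipL ipJ ip_ge0)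
  B0 Sl XS XB (nuN i) IH1.
split => //; apply: (le_trans P2).
by rewrite exprS -mulrA ler_wpM2l ?expR_ge0.
Qed.

Lemma Pi_sum N u : S N u ->
  \sum_(nu : {ffun I -> 'I_N.+1}) Pi N (enum I) (fun i => nu i) u = u.
Proof.
move=> /S_Sg; pose f1 w := \sum_(nu : {ffun I -> 'I_N.+1}) Pi N (enum I) (fun i => nu i) w.
apply: (wspan_eq_lin (f1 := f1) (f2 := id)) => //.
  move=> a x y; rewrite scaler_sumr -big_split /=; apply: eq_bigr => nu _.
  exact: Pi_linear.
move=> t /= tN; pose nu0 : {ffun I -> 'I_N.+1} := [ffun i => inord (count_mem i t)].
have nuN (nu : {ffun I -> 'I_N.+1}) i : (nu i <= N)%N by rewrite -ltnS.
have cN i : (count_mem i t < N.+1)%N by rewrite ltnS (leq_trans (count_size _ _)).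
rewrite /f1 (bigD1 nu0)//= Pi_word// (_ : all _ _ = true); last first.
  by apply/allP => i _; rewrite ffunE inordK.
rewrite scale1r big1 ?addr0// => nu nunu0; rewrite Pi_word//.
rewrite (_ : all _ _ = false) ?scale0r//; apply: contra_neqF nunu0 => /allP H.
apply/ffunP => i; apply: val_inj; rewrite ffunE /= inordK//.
by have /eqP -> := H i (mem_enum _ _).
Qed.

Definition cstK N : R := #|{ffun I -> 'I_N.+1}|%:R * cstE N ^+ #|I|.

(** T is diagonal on words, so the component of (T - z) u at nu is z_nu - z times that of u. Each
    component of u thus loses only 1 / del to the first power, and the components are summed. *)
Lemma low_estimate z0 N z del u : T v0 = z0 *: v0 -> 0 < del ->
  (forall nu, del <= Normc.normc (zev z0 nu - z)) -> S N u ->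
  nrm u <= cstK N / del * nrm (T u - z *: u).
Proof.
move=> T0 dp dist uN; set r := T u - z *: u.
have nuN (nu : {ffun I -> 'I_N.+1}) i : (nu i <= N)%N by rewrite -ltnS.
have rE (nu : {ffun I -> 'I_N.+1}) : Pi N (enum I) (fun i => nu i) r =
    (zev z0 (fun i => nu i) - z) *: Pi N (enum I) (fun i => nu i) u.
  pose f1 w := Pi N (enum I) (fun i => nu i) (T w - z *: w).
  apply: (wspan_eq_lin (f1 := f1) (f2 := fun w => _ *: Pi _ _ _ w) _ _ _ (S_Sg uN)).
  - move=> a x y; rewrite /f1 (Tq_linear Ll) scalerDr opprD addrACA -Pi_linear.
    by congr (Pi _ _ _ (_ + _)); rewrite scalerBr !scalerA mulrC.
  - by move=> a x y; rewrite Pi_linear scalerDr !scalerA mulrC.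
  - move=> t /= tN; rewrite /f1 (T_word t T0) -scalerBl.
    have := Pi_linear N (enum I) (fun i => nu i) (zev z0 (fun i => count_mem i t) - z) (Wg t) 0.
    rewrite (lin0 (Pi_linear N (enum I) (fun i => nu i))) !addr0 => ->.
    rewrite Pi_word//; case: (boolP (all _ _)) => [/allP H|_]; last by rewrite !scale0r !scaler0.
    congr ((_ + _ * _ - _) *: _); apply: eq_bigr => i _.
    by have /eqP -> := H i (mem_enum _ _).
have rN : S N r.
  apply: Sg_S; move: (S_Sg uN); apply: (wspan_map (f := fun u => T u - z *: u)).
    move=> a x y; rewrite (Tq_linear Ll) scalerDr opprD addrACA.
    by congr (_ + _); rewrite scalerBr !scalerA mulrC.
  by move=> t tN; rewrite (T_word t T0) -scalerBl; apply: wspanZ; exact: wspan_word.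
rewrite -[in leLHS](Pi_sum uN); apply: (le_trans (nm_sum ipL ipJ ip_ge0 _ _ _)).
rewrite /cstK -sum1_card natr_sum !mulr_suml; apply: ler_sum => nu _.
rewrite mul1r mulrAC ler_pdivlMr//.
apply: (@le_trans _ _ (nrm (Pi N (enum I) (fun i => nu i) r))).
  by rewrite rE (nmZ ipL ipJ ip_ge0) mulrC ler_wpM2r.
have [_] := Pi_bound (enum I) (nuN nu) rN.
by rewrite -cardE.
Qed.

Variable c5 : R.
Hypothesis c5p : 0 < c5.
Hypothesis c5H : forall v : 'I_(n + n) -> R[i],
  complex.Re (\sum_a \sum_b Hmx a b * v b * (v a)^*%C) <= c5 * \sum_a sqc (v a).

Lemma Hop_upper u : complex.Re (ip (Tq L Hmx u) u) <= c5 * \sum_a nrm (L a u) ^+ 2.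
Proof.
have := ip_pos_Tq (A := - Hmx) (c := - c5) _ u.
have E (f : 'I_(n + n) -> 'I_(n + n) -> R[i]) :
    \sum_a \sum_b (- Hmx) a b * f a b = - \sum_a \sum_b Hmx a b * f a b.
  rewrite -sumrN; apply: eq_bigr => a _; rewrite -sumrN; apply: eq_bigr => b _.
  by rewrite mxE mulNr.
rewrite !Tq_form E ReN mulNr lerN2; apply => v.
have -> : \sum_a \sum_b (- Hmx) a b * v b * (v a)^*%C =
    - \sum_a \sum_b Hmx a b * v b * (v a)^*%C.
  transitivity (\sum_a \sum_b (- Hmx) a b * (v b * (v a)^*%C)).
    by apply: eq_bigr => a _; apply: eq_bigr => b _; rewrite mulrA.
  by rewrite E; congr (- _); apply: eq_bigr => a _; apply: eq_bigr => b _; rewrite mulrA.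
by rewrite ReN mulNr lerN2.
Qed.

(** Let v be the part of w of degree greater than N and wl the rest. T preserves the filtration, so
    (T - z) wl is orthogonal to v; pairing (T - z) w with v leaves Re <(T - z) v, v>, which is at
    least |v|^2 because Re T >= B + 1 in these degrees. The low part then falls under [low_estimate]
    as soon as (T - z) wl is controlled. *)
Lemma fock_apriori z0 N z (B del : R) w : T v0 = z0 *: v0 -> Normc.normc z <= B ->
  B + 1 <= c1 / c5 * (h * N.+1%:R) -> 0 < del ->
  (forall nu, del <= Normc.normc (zev z0 nu - z)) ->
  nrm w <= (cstK N / del * (1 + cstT Q^H * (h * N.+2%:R) + B) + 1) * nrm (T w - z *: w).
Proof.
move=> T0 zB NB dp dist; set gw := T w - z *: w.
have [D0 wD] := gen w; have [f fh wE] := S_decomp wD; set D := D0.+1 in wE.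
pose wl := \sum_(e < D | (e <= N)%N) f e; pose v := \sum_(e < D | ~~ (e <= N)%N) f e.
have wlv : w = wl + v by rewrite wE (bigID (fun e : 'I_D => (e <= N)%N)).
have wlN : S N wl by apply: wspan_sum => e eN; exact: hom_in (fh e).
pose r := T wl - z *: wl.
have rN : S N r.
  apply: Sg_S; move: (S_Sg wlN); apply: (wspan_map (f := fun u => T u - z *: u)).
    move=> a x y; rewrite (Tq_linear Ll) scalerDr opprD addrACA.
    by congr (_ + _); rewrite scalerBr !scalerA mulrC.
  by move=> t tN; rewrite (T_word t T0) -scalerBl; apply: wspanZ; exact: wspan_word.
have orth x : S N x -> ip x v = 0.
  move=> /S_decomp[f' f'h ->]; rewrite (ip_suml ipL) big1// => e _.
  rewrite (ip_sumr ipL ipJ) big1// => e' e'N; apply: hom_orth (f'h _) (fh _).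
  by apply: contraNneq e'N => <-; rewrite -ltnS.
have gE : gw = r + (T v - z *: v).
  by rewrite /gw /r wlv -{1}[wl]scale1r (Tq_linear Ll) scale1r scalerDr opprD addrACA.
have B0 : 0 <= B by exact: le_trans (normc_ge0 _) zB.
have zRe (y : V) : complex.Re (z * ip y y) <= B * nrm y ^+ 2.
  apply: (le_trans (Re_le_normc _)); rewrite Normc.normcM (ipvv ipJ ip_ge0) /=.
  by rewrite expr0n /= addr0 sqrtr_sqr ger0_norm ?sqr_ge0// ler_wpM2r ?sqr_ge0.
have vg : nrm v <= nrm gw.
  have Hv : h * N.+1%:R * nrm v ^+ 2 <= complex.Re (ip (Tq L Hmx v) v).
    rewrite /v (Hop_decomp D fh (fun e => ~~ (e <= N)%N)).
    rewrite (nm_decomp D fh (fun e => ~~ (e <= N)%N)) mulr_sumr; apply: ler_sum => e eN.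
    by rewrite ler_wpM2r ?sqr_ge0// ler_pM2l// ler_nat ltnNge.
  have Tv : (B + 1) * nrm v ^+ 2 <= complex.Re (ip (T v) v).
    apply: (@le_trans _ _ (c1 / c5 * (h * N.+1%:R) * nrm v ^+ 2)).
      by rewrite ler_wpM2r ?sqr_ge0.
    apply: le_trans (ip_pos_Tq c1Q v); rewrite -!mulrA ler_pM2l//.
    by rewrite ler_pdivrMl// mulrA; apply: le_trans Hv (Hop_upper v).
  have gv : complex.Re (ip gw v) = complex.Re (ip (T v) v) - complex.Re (z * ip v v).
    rewrite gE (ipDl ipL) (orth _ rN) add0r (ipDl ipL) -scaleNr (ipZl ipL).
    by rewrite mulNr ReD ReN.
  have [->|v0'] := eqVneq (nrm v) 0; first exact: nmge0.
  have vp : 0 < nrm v by rewrite lt_neqAle eq_sym v0' nmge0.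
  rewrite -(ler_pM2r vp); apply: le_trans (Re_ip_le ipL ipJ ip_ge0 _ _).
  by rewrite gv; have := zRe v; rewrite -expr2; lra.
set K := cstT Q^H * (h * N.+2%:R).
have K0 : 0 <= K by rewrite mulr_ge0 ?cstT_ge0// mulr_ge0// ltW.
(* T v is not controlled by v, whose degree is arbitrary; so in <T v, r> the operator is moved to r,
   of degree at most N, where its adjoint is bounded. *)
have rg : nrm r <= (1 + K + B) * nrm gw.
  have E : ip r r = ip gw r - ip v (Tq L Q^H r) + z * ip v r.
    have E1 x y : y = x + (T v - z *: v) -> ip x x = ip y x - ip (T v) x + z * ip v x.
      by move=> ->; rewrite !(ipDl ipL) -scaleNr (ipZl ipL); ring.
    by rewrite -Tq_adj; exact: E1.
  have [->|r0'] := eqVneq (nrm r) 0.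
    by rewrite mulr_ge0// !addr_ge0.
  have rp : 0 < nrm r by rewrite lt_neqAle eq_sym r0' nmge0.
  rewrite -(ler_pM2r rp) -expr2 (nm_sqr ip_ge0) E !ReD ReN.
  have e1 := Re_ip_le ipL ipJ ip_ge0 gw r.
  have e2 : - complex.Re (ip v (Tq L Q^H r)) <= nrm gw * (K * nrm r).
    have := Re_ip_le ipL ipJ ip_ge0 (- v) (Tq L Q^H r).
    rewrite -scaleN1r (ipZl ipL) mulN1r ReN scaleN1r (nmN ipL ipJ ip_ge0) => /le_trans; apply.
    by apply: ler_pM => //; exact: nm_Tq.
  have e3 : complex.Re (z * ip v r) <= B * (nrm gw * nrm r).
    apply: (le_trans (Re_le_normc _)); rewrite Normc.normcM.
    apply: ler_pM => //; rewrite ?normc_ge0//.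
    by apply: (le_trans (normc_ip_le ipL ipJ ip_ge0 _ _)); rewrite ler_wpM2r.
  apply: (le_trans (lerD (lerD e1 e2) e3)).
  by rewrite le_eqVlt; apply/orP; left; apply/eqP; ring.
rewrite {1}wlv; apply: (le_trans (nmD ipL ipJ ip_ge0 _ _)).
rewrite mulrDl mul1r lerD//.
apply: (le_trans (low_estimate T0 dp dist wlN)); rewrite -(mulrA _ (1 + K + B)) ler_wpM2l//.
by rewrite mulr_ge0 ?invr_ge0 ?(ltW dp)// mulr_ge0// exprn_ge0// expR_ge0.
Qed.

(** C0 is the value of h N beyond which Re T exceeds B + 1. The first summand bounds h times the
    exponent of [cstK]; in the second, 1 + cstT (C0 + 2) + B is the factor of the a priori estimate
    and 2 cstT + B an upper bound of del. *)
Definition cstA (B : R) : R :=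
  let C0 := (B + 1) / (c1 / c5) in
  (C0 + 1) * (cstX + 3) * #|I|%:R +
  (1 + cstT Q^H * (C0 + 2) + B + 2 * cstT Q + B) + 1.

Lemma zvac_bound z0 : T v0 = z0 *: v0 -> Normc.normc z0 <= cstT Q * (h * 2).
Proof.
move=> T0; have : S 0 v0 by exact: (wspan_word (fun j => op L (row j cremx)) v0 (t := [::])).
by move=> /(nm_Tq Q); rewrite T0 (nmZ ipL ipJ ip_ge0) ler_pM2r.
Qed.

Lemma cstK_bound N (x : R) : N.+1%:R <= x ->
  cstK N <= expR (x * ((cstX + 3) * #|I|%:R)).
Proof.
move=> Nx; rewrite /cstK card_ffun card_ord natrX -exprMn mulrA expRM_natr.
apply: lerXn2r; rewrite ?nnegrE ?mulr_ge0 ?expR_ge0//.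
apply: (@le_trans _ _ (expR (N.+1%:R * (cstX + 3)))); last first.
  by rewrite ler_expR ler_wpM2r// addr_ge0// cstX_ge0.
have -> : N.+1%:R * (cstX + 3) = (N%:R + 1) + (cstX * N.+1%:R + 2 * N%:R + 2) :> R.
  by rewrite -natr1; ring.
rewrite expRD; apply: ler_pM; rewrite ?expR_ge0//.
  by have := expR_ge1Dx (N%:R : R); rewrite expRD -natr1; have := expR_ge1Dx (1 : R);
    have := expR_ge0 (N%:R : R); nra.
by rewrite ler_expR lerDl.
Qed.

Lemma fock_estimate z0 z (B del : R) w : h <= 1 -> T v0 = z0 *: v0 ->
  Normc.normc z <= B -> 0 < del ->
  (forall nu, del <= Normc.normc (zev z0 nu - z)) ->
  nrm w <= cstA B * expR (cstA B / h) / del * nrm (T w - z *: w).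
Proof.
move=> h1 T0 zB dp dist.
have B0 : 0 <= B by exact: le_trans (normc_ge0 _) zB.
pose C0 := (B + 1) / (c1 / c5).
have C00 : 0 <= C0 by rewrite /C0 mulr_ge0 ?invr_ge0 ?divr_ge0 ?(ltW c1p) ?(ltW c5p)// addr_ge0.
(* Then h (N + 1) > C0, as the a priori estimate requires, while N <= C0 / h. *)
pose N := Num.truncn (C0 / h).
have Nge : C0 / h < N.+1%:R by rewrite truncnS_gt.
have Nle : N%:R <= C0 / h by rewrite truncn_le// divr_ge0// ltW.
have HN : B + 1 <= c1 / c5 * (h * N.+1%:R).
  rewrite mulrC -ler_pdivrMr ?divr_gt0// -/C0.
  by rewrite mulrC -ler_pdivrMr// ltW.
apply: (le_trans (fock_apriori w T0 zB HN dp dist)); rewrite ler_wpM2r//.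
have hN : h * N.+2%:R <= C0 + 2.
  rewrite -addn2 natrD mulrDr lerD//; last by lra.
  by rewrite mulrC -ler_pdivlMr.
(* Since del <= |z_0 - z|, the summand of the a priori bound that has no factor 1 / del is at most a
   constant divided by del. *)
have dle : del <= 2 * cstT Q + B.
  apply: (le_trans (dist (fun=> 0%N))); rewrite /zev big1 ?mulr0 ?addr0; last by move=> *; rewrite mulr0.
  apply: (le_trans (le_normcD _ _)); rewrite normcN lerD//.
  apply: (le_trans (zvac_bound T0)); rewrite mulrC.
  by have := cstT_ge0 Q; nra.
have hV : 1 <= h^-1 by rewrite invr_ge1 ?unitf_gt0.
have KN : cstK N <= expR ((C0 + 1) / h * ((cstX + 3) * #|I|%:R)).
  by apply: cstK_bound; rewrite -natr1 mulrDl mul1r lerD.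
set c9 := (C0 + 1) * (cstX + 3) * #|I|%:R.
set A1 := 1 + cstT Q^H * (C0 + 2) + B + 2 * cstT Q + B.
have AE : cstA B = c9 + A1 + 1 by [].
have c90 : 0 <= c9 by rewrite !mulr_ge0// ?addr_ge0// cstX_ge0.
have A10 : 0 <= A1.
  by rewrite /A1; have := cstT_ge0 Q; have := cstT_ge0 Q^H; nra.
rewrite AE.
have e1 : 1 <= expR (c9 / h).
  by rewrite -expR0 ler_expR divr_ge0// ltW.
have KN' : cstK N <= expR (c9 / h).
  by apply: (le_trans KN); rewrite le_eqVlt; apply/orP; left; apply/eqP; congr expR; rewrite /c9; ring.
apply: (@le_trans _ _ (A1 * expR (c9 / h) / del)); last first.
  rewrite ler_pM2r ?invr_gt0//; apply: ler_pM; rewrite ?expR_ge0//; first by lra.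
  by rewrite ler_expR ler_pM2r ?invr_gt0//; lra.
rewrite ler_pdivlMr// mulrDl mul1r [X in X + _]mulrAC divfK ?gt_eqF//.
rewrite (_ : A1 = (1 + cstT Q^H * (C0 + 2) + B) + (2 * cstT Q + B)); last by rewrite /A1; ring.
rewrite mulrDl lerD//; last by have := cstT_ge0 Q; nra.
rewrite mulrC; apply: ler_pM => //.
- by rewrite !addr_ge0// mulr_ge0 ?cstT_ge0// mulr_ge0// ltW.
- by rewrite mulr_ge0// exprn_ge0// expR_ge0.
- by rewrite lerD2r lerD2l ler_wpM2l ?cstT_ge0.
Qed.

Lemma fock_surjective z0 z : T v0 = z0 *: v0 -> (forall nu, zev z0 nu != z) ->
  forall r, exists w, T w - z *: w = r.
Proof.
move=> T0 zn r; have [N /S_Sg] := gen r; elim=> [|a t v tN _ [w <-]].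
  by exists 0; rewrite (lin0 (Tq_linear Ll Q)) scaler0 subr0.
pose c := (zev z0 (fun i => count_mem i t) - z)^-1.
exists ((a * c) *: Wg t + w); rewrite (Tq_linear Ll) (T_word t T0) scalerDr opprD addrACA.
congr (_ + _); rewrite !scalerA -scalerBl; congr (_ *: _).
by rewrite [z * _]mulrC -mulrBr -mulrA mulVf ?mulr1// subr_eq0.
Qed.

Lemma fock_eigenvector z0 (nu : I -> nat) : T v0 = z0 *: v0 ->
  exists w, 0 < nrm w /\ T w = zev z0 nu *: w.
Proof.
move=> T0; pose t := flatten [seq nseq (nu i) i | i <- enum I].
exists (Wg t); split; first exact: word_neq0.
rewrite (T_word t T0); congr ((_ + _ * _) *: _); apply: eq_bigr => i _.
congr (_ * _%:R); rewrite /t count_flatten -map_comp sumnE big_map.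
rewrite big_enum /= (bigD1 i)//= count_nseq /= eqxx mul1n.
by rewrite big1 ?addn0// => k ki; rewrite count_nseq /= (negbTE ki).
Qed.

End representation.
End fock.

(** * Integration and differentiation on R^n *)

Section real_integral.
Context d (T : measurableType d) (R : realType) (mu : {measure set T -> \bar R}).
Implicit Types (f g : T -> R).

Definition intg f := mu.-integrable setT (EFin \o f).
Local Notation Rint f := (Rintegral mu setT f).

Lemma intg_meas f : intg f -> measurable_fun setT f.
Proof. by move=> /integrableP[/measurable_EFinP]. Qed.

Lemma intg_le f g : measurable_fun setT f -> intg g ->
  (forall x, `|f x| <= g x) -> intg f.
Proof.
move=> mf ig fg; apply: (le_integrable _ _ _ ig) => //.
  exact/measurable_EFinP.
by move=> x _ /=; rewrite lee_fin (le_trans (fg x))// ler_norm.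
Qed.

Lemma intgD f g : intg f -> intg g -> intg (fun x => f x + g x).
Proof.
by move=> fi gi; apply: eq_integrable (integrableD _ fi gi) => //.
Qed.

Lemma intgZ a f : intg f -> intg (fun x => a * f x).
Proof. by move=> fi; apply: eq_integrable (integrableZl _ a fi) => //. Qed.

Lemma intgN f : intg f -> intg (fun x => - f x).
Proof. by move=> fi; apply: eq_integrable (integrableN fi) => //. Qed.

Lemma intgB f g : intg f -> intg g -> intg (fun x => f x - g x).
Proof. by move=> fi gi; apply: intgD => //; exact: intgN. Qed.

Lemma intg0 : intg (fun=> 0).
Proof. exact: integrable0. Qed.

Lemma RintD f g : intg f -> intg g -> Rint (fun x => f x + g x) = Rint f + Rint g.
Proof. exact: RintegralD. Qed.

Lemma RintB f g : intg f -> intg g -> Rint (fun x => f x - g x) = Rint f - Rint g.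
Proof. exact: RintegralB. Qed.

Lemma RintZ a f : intg f -> Rint (fun x => a * f x) = a * Rint f.
Proof. exact: RintegralZl. Qed.

Lemma RintN f : intg f -> Rint (fun x => - f x) = - Rint f.
Proof.
move=> fi; rewrite -mulN1r -RintZ//; congr Rintegral.
by apply/funext => x; rewrite mulN1r.
Qed.

Lemma Rint0 : Rint (fun=> 0) = 0.
Proof. by rewrite /Rintegral integral0. Qed.

Lemma Rint_le f g : intg f -> intg g -> (forall x, f x <= g x) -> Rint f <= Rint g.
Proof. by move=> fi gi fg; apply: le_Rintegral => // x _. Qed.

Lemma Rint_ge0 f : (forall x, 0 <= f x) -> 0 <= Rint f.
Proof. by move=> f0; apply: Rintegral_ge0. Qed.

Lemma integral_Rint f : intg f -> (\int[mu]_x (f x)%:E)%E = (Rint f)%:E.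
Proof. by move=> fi; rewrite /Rintegral fineK//; exact: integrable_fin_num. Qed.

Lemma Rint_dct (f_ : nat -> T -> R) f g :
  (forall k, measurable_fun setT (f_ k)) -> (forall x, f_ ^~ x @ \oo --> f x) ->
  intg g -> (forall k x, `|f_ k x| <= g x) ->
  intg f /\ (Rint (f_ k) @[k --> \oo] --> Rint f).
Proof.
move=> mf_ cf ig fg.
have mf : measurable_fun setT f by apply: (measurable_fun_cvg mf_) => x _; exact: cf.
have [||||fi _ H] := @dominated_convergence _ _ _ mu setT measurableT
  (fun k x => (f_ k x)%:E) (EFin \o f) (EFin \o g) _ _ _ ig.
- by move=> k; exact/measurable_EFinP.
- exact/measurable_EFinP.
- by apply/aeW => x _; apply/fine_cvgP; split; [exact: nearW|exact: cf].
- by apply/aeW => x k _; rewrite lee_fin.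
split=> //.
by apply: fine_cvg; rewrite -integral_Rint.
Qed.

End real_integral.

Section complex_integral.
Context d (T : measurableType d) (R : realType) (mu : {measure set T -> \bar R}).
Implicit Types (u v : T -> R[i]).
Local Notation Rint f := (Rintegral mu setT f).
Local Notation Re := (@complex.Re R).
Local Notation Im := (@complex.Im R).
Local Notation intg := (intg mu).

Definition cmeas u := measurable_fun setT (fun x => Re (u x)) /\
  measurable_fun setT (fun x => Im (u x)).

Definition cintg u := intg (fun x => Re (u x)) /\ intg (fun x => Im (u x)).

Definition cint u : R[i] := (Rint (fun x => Re (u x)) +i* Rint (fun x => Im (u x)))%C.

Lemma cmeas_cst c : cmeas (fun=> c).
Proof. by split; exact: measurable_cst. Qed.

Lemma cmeasD u v : cmeas u -> cmeas v -> cmeas (fun x => u x + v x).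
Proof.
move=> [u1 u2] [v1 v2]; split.
  by under eq_fun do rewrite ReD; exact: measurable_funD.
by under eq_fun do rewrite ImD; exact: measurable_funD.
Qed.

Lemma cmeasM u v : cmeas u -> cmeas v -> cmeas (fun x => u x * v x).
Proof.
move=> [u1 u2] [v1 v2]; split.
  under eq_fun do rewrite ReM.
  by apply: measurable_funB; exact: measurable_funM.
under eq_fun do rewrite ImM.
by apply: measurable_funD; exact: measurable_funM.
Qed.

Lemma cmeasJ u : cmeas u -> cmeas (fun x => (u x)^*%C).
Proof.
move=> [u1 u2]; split; first by under eq_fun do rewrite ReJ.
by under eq_fun do rewrite ImJ; exact: measurableT_comp.
Qed.

Lemma cmeasZ c u : cmeas u -> cmeas (fun x => c * u x).
Proof. by move=> mu'; apply: cmeasM => //; exact: cmeas_cst. Qed.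

Lemma cmeasR (m : T -> R) : measurable_fun setT m -> cmeas (fun x => (m x)%:C%C).
Proof. by move=> mm; split=> //=; exact: measurable_cst. Qed.

Lemma cmeas_sqc u : cmeas u -> measurable_fun setT (fun x => sqc (u x)).
Proof.
by move=> [u1 u2]; rewrite /sqc; apply: measurable_funD; exact: measurable_funX.
Qed.

Lemma cmeas_cvg (u_ : nat -> T -> R[i]) u : (forall k, cmeas (u_ k)) ->
  (forall x, Re (u_ k x) @[k --> \oo] --> Re (u x)) ->
  (forall x, Im (u_ k x) @[k --> \oo] --> Im (u x)) -> cmeas u.
Proof.
move=> mu_ cr ci; split.
  by apply: (measurable_fun_cvg (fun k => (mu_ k).1)) => x _; exact: cr.
by apply: (measurable_fun_cvg (fun k => (mu_ k).2)) => x _; exact: ci.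
Qed.

Lemma cintgD u v : cintg u -> cintg v -> cintg (fun x => u x + v x).
Proof.
move=> [u1 u2] [v1 v2]; split.
  by under eq_fun do rewrite ReD; exact: intgD.
by under eq_fun do rewrite ImD; exact: intgD.
Qed.

Lemma cintgZ c u : cintg u -> cintg (fun x => c * u x).
Proof.
move=> [u1 u2]; split.
  under eq_fun do rewrite ReM.
  by apply: intgB; exact: intgZ.
under eq_fun do rewrite ImM.
by apply: intgD; exact: intgZ.
Qed.

Lemma cintg0 : cintg (fun=> 0).
Proof. by split; exact: intg0. Qed.

Lemma cintD u v : cintg u -> cintg v ->
  cint (fun x => u x + v x) = cint u + cint v.
Proof.
move=> [u1 u2] [v1 v2]; rewrite /cint.
apply/eqP; rewrite eq_complex /= -!RintD//; apply/andP.
by split; apply/eqP; congr Rintegral; apply/funext => x; rewrite (ReD, ImD).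
Qed.

Lemma cintZ c u : cintg u -> cint (fun x => c * u x) = c * cint u.
Proof.
move=> [u1 u2]; rewrite /cint; case: c => a b.
apply/eqP; rewrite eq_complex /=; apply/andP; split; apply/eqP.
  rewrite -!RintZ// -RintB; [|exact: intgZ..].
  by congr Rintegral; apply/funext => x; rewrite ReM.
rewrite -!RintZ// -RintD; [|exact: intgZ..].
by congr Rintegral; apply/funext => x; rewrite ImM.
Qed.

Lemma cint0 : cint (fun=> 0) = 0.
Proof. by rewrite /cint Rint0. Qed.

Lemma cintJ u : cintg u -> cint (fun x => (u x)^*%C) = (cint u)^*%C.
Proof.
move=> [u1 u2]; rewrite /cint /= -RintN//.
apply/eqP; rewrite eq_complex /=; apply/andP.
by split; apply/eqP; congr Rintegral; apply/funext => x; rewrite (ReJ, ImJ).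
Qed.

Lemma cintg_sum (J : Type) (r : seq J) (P : pred J) (f : J -> T -> R[i]) :
  (forall j, cintg (f j)) -> cintg (fun x => \sum_(j <- r | P j) f j x).
Proof.
move=> fi; elim: r => [|j r IH]; first by under eq_fun do rewrite big_nil; exact: cintg0.
under eq_fun do rewrite big_cons; case: (P j) => //.
exact: cintgD.
Qed.

Lemma cint_sum (J : Type) (r : seq J) (P : pred J) (f : J -> T -> R[i]) :
  (forall j, cintg (f j)) ->
  cint (fun x => \sum_(j <- r | P j) f j x) = \sum_(j <- r | P j) cint (f j).
Proof.
move=> fi; elim: r => [|j r IH].
  by under eq_fun do rewrite big_nil; rewrite big_nil cint0.
under eq_fun do rewrite big_cons; rewrite big_cons; case: (P j) => //.
by rewrite cintD// ?IH//; exact: cintg_sum.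
Qed.

Lemma cint_dct (u_ : nat -> T -> R[i]) u (g : T -> R) :
  (forall k, cmeas (u_ k)) ->
  (forall x, Re (u_ k x) @[k --> \oo] --> Re (u x)) ->
  (forall x, Im (u_ k x) @[k --> \oo] --> Im (u x)) ->
  intg g -> (forall k x, Normc.normc (u_ k x) <= g x) ->
  [/\ cintg u, Re (cint (u_ k)) @[k --> \oo] --> Re (cint u) &
   Im (cint (u_ k)) @[k --> \oo] --> Im (cint u)].
Proof.
move=> mu_ cr ci ig ug.
have nR (z : R[i]) : `|Re z| <= Normc.normc z.
  by case: z => a b /=; rewrite -sqrtr_sqr ler_wsqrtr// lerDl sqr_ge0.
have nI (z : R[i]) : `|Im z| <= Normc.normc z.
  by case: z => a b /=; rewrite -sqrtr_sqr ler_wsqrtr// lerDr sqr_ge0.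
have [|r1 r2] := Rint_dct (fun k => (mu_ k).1) cr ig.
  by move=> k x; apply: (le_trans (nR _)).
have [|i1 i2] := Rint_dct (fun k => (mu_ k).2) ci ig.
  by move=> k x; apply: (le_trans (nI _)).
by split.
Qed.

Definition sqint u := cmeas u /\ intg (fun x => sqc (u x)).

Lemma sqint_prod u v : sqint u -> sqint v -> cintg (fun x => u x * v x).
Proof.
move=> [mu' iu] [mv iv].
have mm := cmeasM mu' mv.
have H x : Normc.normc (u x * v x) <= sqc (u x) + sqc (v x).
  rewrite Normc.normcM -!normc_sqr.
  have := normc_ge0 (u x); have := normc_ge0 (v x).
  by have := sqr_ge0 (Normc.normc (u x) - Normc.normc (v x)); nra.
have nR (z : R[i]) : `|Re z| <= Normc.normc z.
  by case: z => a b /=; rewrite -sqrtr_sqr ler_wsqrtr// lerDl sqr_ge0.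
have nI (z : R[i]) : `|Im z| <= Normc.normc z.
  by case: z => a b /=; rewrite -sqrtr_sqr ler_wsqrtr// lerDr sqr_ge0.
split; apply: (intg_le _ (intgD iu iv)); try by case: mm.
  by move=> x; apply: le_trans (H x); exact: nR.
by move=> x; apply: le_trans (H x); exact: nI.
Qed.

Lemma sqcD_le (x y : R[i]) : sqc (x + y) <= 2 * sqc x + 2 * sqc y.
Proof.
case: x y => [a b] [c e]; rewrite /sqc /=.
by have := sqr_ge0 (a - c); have := sqr_ge0 (b - e); nra.
Qed.

Lemma sqintD u v : sqint u -> sqint v -> sqint (fun x => u x + v x).
Proof.
move=> [mu' iu] [mv iv]; split; first exact: cmeasD.
apply: (intg_le _ (intgD (intgZ 2 iu) (intgZ 2 iv))).
  by apply: cmeas_sqc; exact: cmeasD.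
by move=> x; rewrite ger0_norm ?sqc_ge0// sqcD_le.
Qed.

Lemma sqintZ c u : sqint u -> sqint (fun x => c * u x).
Proof.
move=> [mu' iu]; split; first exact: cmeasZ.
by under eq_fun do rewrite sqcM; exact: intgZ.
Qed.

Lemma sqint0 : sqint (fun=> 0).
Proof.
split; first exact: cmeas_cst.
by under eq_fun do rewrite /sqc /= expr0n addr0; exact: intg0.
Qed.

Lemma sqintJ u : sqint u -> sqint (fun x => (u x)^*%C).
Proof.
by move=> [m i]; split; [exact: cmeasJ|under eq_fun do rewrite sqcJ].
Qed.

Definition l2pred : {pred T -> R[i]} := mem [set u | sqint u].

Lemma l2predP u : reflect (sqint u) (u \in l2pred).
Proof. by apply: (iffP idP); rewrite /l2pred inE. Qed.

Lemma l2pred_submod : submod_closed l2pred.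
Proof.
split; first by apply/l2predP; exact: sqint0.
move=> a u v /l2predP iu /l2predP iv; apply/l2predP.
by apply: sqintD => //; exact: sqintZ.
Qed.

HB.instance Definition _ := GRing.isSubmodClosed.Build _ _ l2pred l2pred_submod.

(** Makes the abstract seminorm inequalities available for functions. No quotient by null functions
    is taken, the form being allowed to be degenerate. *)
Record l2t := L2T { l2f :> T -> R[i]; l2P : l2f \in l2pred }.
HB.instance Definition _ := [isSub of l2t for l2f].
HB.instance Definition _ := [Choice of l2t by <:].
HB.instance Definition _ := [SubChoice_isSubLmodule of l2t by <:].

Definition ipL (u v : l2t) : R[i] := cint (fun x => u x * (v x)^*%C).

Lemma l2_sqint (u : l2t) : sqint u. Proof. exact/l2predP/l2P. Qed.

Lemma ipL_cintg (u v : l2t) : cintg (fun x => u x * (v x)^*%C).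
Proof. by apply: sqint_prod; [exact: l2_sqint|apply: sqintJ; exact: l2_sqint]. Qed.

Lemma ipL_linear a (u v w : l2t) : ipL (a *: u + v) w = a * ipL u w + ipL v w.
Proof.
rewrite /ipL -cintZ; last exact: ipL_cintg.
rewrite -cintD; [|by apply: cintgZ; exact: ipL_cintg|exact: ipL_cintg].
congr cint; apply/funext => x; rewrite (_ : (a *: u + v) x = a * u x + v x)//.
by rewrite mulrDl mulrA.
Qed.

Lemma ipL_J (u v : l2t) : ipL v u = (ipL u v)^*%C.
Proof.
rewrite /ipL -cintJ; last exact: ipL_cintg.
by congr cint; apply/funext => x; rewrite rmorphM /= conjcK mulrC.
Qed.

Lemma ipLvv (u : l2t) : Re (ipL u u) = Rint (fun x => sqc (u x)).
Proof.
rewrite /ipL /cint /=; congr Rintegral; apply/funext => x.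
by rewrite /sqc ReM ReJ ImJ; ring.
Qed.

Lemma ipL_ge0 (u : l2t) : 0 <= Re (ipL u u).
Proof. by rewrite ipLvv; apply: Rint_ge0 => x; exact: sqc_ge0. Qed.

End complex_integral.

(** * Partial derivatives of complex functions on R^n *)

Section directional.
Variables (R : realType) (n : nat).
Implicit Types (f g : 'rV[R]_n -> R) (u v : 'rV[R]_n -> R[i]) (j : 'I_n) (x : 'rV[R]_n).

(** Brings directional derivatives back to one real variable, where the chain rule applies. *)
Lemma is_derive_line f x (w : 'rV[R]_n) df :
  is_derive x w f df <-> is_derive (0 : R) 1 (fun t : R => f (t *: w + x)) df.
Proof.
have E : (fun h : R => h^-1 *: (((fun t : R => f (t *: w + x)) \o shift (0 : R)) (h *: (1 : R)) - f ((0 : R) *: w + x)))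
    = (fun h : R => h^-1 *: ((f \o shift x) (h *: w) - f x)).
  by apply/funext => h /=; rewrite addr0 scale0r add0r [h *: 1]mulr1.
by split=> -[d1 d2]; split; move: d1 d2; rewrite /derivable /derive E.
Qed.

Lemma is_derive_compR f (g : R -> R) x (w : 'rV[R]_n) df dg :
  is_derive x w f df -> is_derive (f x) 1 g dg ->
  is_derive x w (fun y => g (f y)) (dg * df).
Proof.
move=> /is_derive_line fd gd; apply/is_derive_line.
pose F := fun t : R => f (t *: w + x).
have gd' : is_derive (F 0) 1 g dg by rewrite /F scale0r add0r.
exact: (@is_derive1_comp R g F 0 dg df gd' fd).

Qed.

Lemma is_derive_coord x j i :
  is_derive x (ebase R j) (fun y : 'rV[R]_n => y ord0 i) (j == i)%:R.
Proof.
apply/is_derive_line.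
have -> : (fun t : R => (t *: ebase R j + x) ord0 i) =
    (fun t => (j == i)%:R * t + x ord0 i).
  by apply/funext => t; rewrite !mxE eqxx /= eq_sym mulrC.
by apply: is_derive_eq; rewrite addr0 [_ *: _]mulr1.
Qed.

Definition cder j u x (du : R[i]) :=
  is_derive x (ebase R j) (fun y => complex.Re (u y)) (complex.Re du) /\
  is_derive x (ebase R j) (fun y => complex.Im (u y)) (complex.Im du).

Lemma cder_partial j u x du : cder j u x du -> partialC j u x = du.
Proof.
move=> [d1 d2]; rewrite /partialC; apply/eqP; rewrite eq_complex /=.
by rewrite (@derive_val _ _ _ _ _ _ _ d1) (@derive_val _ _ _ _ _ _ _ d2) !eqxx.
Qed.

Lemma cder_eq j u x du du' : cder j u x du -> du = du' -> cder j u x du'.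
Proof. by move=> ? <-. Qed.

Lemma cder_cst j c x : cder j (fun=> c) x 0.
Proof. by split; exact: is_derive_cst. Qed.

Lemma cderD j u v x du dv : cder j u x du -> cder j v x dv ->
  cder j (fun y => u y + v y) x (du + dv).
Proof.
move=> [u1 u2] [v1 v2]; split.
  by under eq_fun do rewrite ReD; rewrite ReD; exact: is_deriveD.
by under eq_fun do rewrite ImD; rewrite ImD; exact: is_deriveD.
Qed.

Lemma cderM j u v x du dv : cder j u x du -> cder j v x dv ->
  cder j (fun y => u y * v y) x (du * v x + u x * dv).
Proof.
move=> [u1 u2] [v1 v2]; split.
  under eq_fun do rewrite ReM.
  apply: is_derive_eq.
  by rewrite /GRing.scale /= ReD !ReM; ring.
under eq_fun do rewrite ImM.
apply: is_derive_eq.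
by rewrite /GRing.scale /= ImD !ImM; ring.
Qed.

Lemma cder_sum j (J : Type) (r : seq J) (f : J -> 'rV[R]_n -> R[i]) df x :
  (forall k, cder j (f k) x (df k)) ->
  cder j (fun y => \sum_(k <- r) f k y) x (\sum_(k <- r) df k).
Proof.
move=> fd; elim: r => [|k r IH].
  by rewrite big_nil; under eq_fun do rewrite big_nil; exact: cder_cst.
by rewrite big_cons; under eq_fun do rewrite big_cons; exact: cderD.
Qed.

Lemma cder_coord j x i :
  cder j (fun y : 'rV[R]_n => (y ord0 i)%:C%C) x (j == i)%:R.
Proof.
split => /=; last first.
  have -> : complex.Im ((j == i)%:R : R[i]) = 0 by case: (j == i).
  exact: is_derive_cst.
have -> : complex.Re ((j == i)%:R : R[i]) = (j == i)%:R by case: (j == i).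
exact: is_derive_coord.
Qed.

Definition cexp (z : R[i]) : R[i] :=
  (expR (complex.Re z) * cos (complex.Im z) +i* (expR (complex.Re z) * sin (complex.Im z)))%C.

Lemma normc_cexp z : Normc.normc (cexp z) = expR (complex.Re z).
Proof.
rewrite /= !exprMn -mulrDr cos2Dsin2 mulr1 sqrtr_sqr ger0_norm// expR_ge0//.
Qed.

Lemma cder_cexp j u x du : cder j u x du ->
  cder j (fun y => cexp (u y)) x (du * cexp (u x)).
Proof.
move=> [u1 u2].
have e1 := is_derive_compR u1 (is_derive_expR _).
have c1 := is_derive_compR u2 (is_derive_cos _).
have s1 := is_derive_compR u2 (is_derive_sin _).
split => /=.
  apply: is_derive_eq.
  by rewrite /GRing.scale /= ReM /=; ring.
apply: is_derive_eq.
by rewrite /GRing.scale /= ImM /=; ring.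
Qed.

End directional.

Section cont_functions.
Variables (R : realType) (n : nat).
Implicit Types (u v : 'rV[R]_n -> R[i]).

Definition ccont u := continuous (fun y : 'rV[R]_n => complex.Re (u y)) /\
  continuous (fun y : 'rV[R]_n => complex.Im (u y)).

Lemma ccont_cst c : ccont (fun=> c).
Proof. by split; exact: cst_continuous. Qed.

Lemma ccontD u v : ccont u -> ccont v -> ccont (fun y => u y + v y).
Proof.
move=> [u1 u2] [v1 v2]; split=> x.
  by under eq_fun do rewrite ReD; exact: (continuousD (u1 x) (v1 x)).
by under eq_fun do rewrite ImD; exact: (continuousD (u2 x) (v2 x)).
Qed.

Lemma ccontM u v : ccont u -> ccont v -> ccont (fun y => u y * v y).
Proof.
move=> [u1 u2] [v1 v2]; split=> x.
  under eq_fun do rewrite ReM.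
  exact: (continuousB (continuousM (u1 x) (v1 x)) (continuousM (u2 x) (v2 x))).
under eq_fun do rewrite ImM.
exact: (continuousD (continuousM (u1 x) (v2 x)) (continuousM (u2 x) (v1 x))).
Qed.

Lemma ccont_sum (J : Type) (r : seq J) (f : J -> 'rV[R]_n -> R[i]) :
  (forall k, ccont (f k)) -> ccont (fun y => \sum_(k <- r) f k y).
Proof.
move=> fd; elim: r => [|k r IH].
  by under eq_fun do rewrite big_nil; exact: ccont_cst.
by under eq_fun do rewrite big_cons; exact: ccontD.
Qed.

Lemma ccont_coord i : ccont (fun y : 'rV[R]_n => (y ord0 i)%:C%C).
Proof.
split=> /=; last exact: cst_continuous.
exact: (@coord_continuous R 1 n ord0 i).
Qed.

Lemma ccont_cexp u : ccont u -> ccont (fun y => cexp (u y)).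
Proof.
move=> [u1 u2].
have e1 (x : 'rV[R]_n) := continuous_comp (u1 x) (@continuous_expR R (complex.Re (u x))).
have c1 (x : 'rV[R]_n) := continuous_comp (u2 x) (@continuous_cos R (complex.Im (u x))).
have s1 (x : 'rV[R]_n) := continuous_comp (u2 x) (@continuous_sin R (complex.Im (u x))).
by split=> x /=; [exact: (continuousM (e1 x) (c1 x))|exact: (continuousM (e1 x) (s1 x))].
Qed.

Lemma cmeas_coord i : cmeas (fun y : 'rV[R]_n => (y ord0 i)%:C%C).
Proof. by split => /=; [exact: measurable_row_coord|exact: measurable_cst]. Qed.

Lemma cmeas_cexp u : cmeas u -> cmeas (fun y => cexp (u y)).
Proof.
move=> [u1 u2]; split=> /=; apply: measurable_funM.
- by apply: measurableT_comp => //; exact: measurable_expR.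
- apply: (measurableT_comp (f := @cos R)) => //.
  by apply: continuous_measurable_fun; exact: continuous_cos.
- by apply: measurableT_comp => //; exact: measurable_expR.
- apply: (measurableT_comp (f := @sin R)) => //.
  by apply: continuous_measurable_fun; exact: continuous_sin.
Qed.

Lemma cmeas_sum d (T : measurableType d) (J : Type) (r : seq J) (f : J -> T -> R[i]) :
  (forall k, cmeas (f k)) -> cmeas (fun y => \sum_(k <- r) f k y).
Proof.
move=> fd; elim: r => [|k r IH].
  by under eq_fun do rewrite big_nil; exact: cmeas_cst.
by under eq_fun do rewrite big_cons; exact: cmeasD.
Qed.

End cont_functions.

(** * Polynomials in n variables as functions *)

Section mpoly_functions.
Variables (R : realType) (n : nat).
Local Notation Pol := (mpoly.mpoly n R[i]).
Local Notation X i := (mpolyX R[i] (mnm1 i)).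

Lemma mpoly_rect (P : Pol -> Prop) :
  (forall c, P (mpolyC n c)) -> (forall p q, P p -> P q -> P (p + q)) ->
  (forall i p, P p -> P (X i * p)) -> forall p, P p.
Proof.
move=> PC PD PX p; elim/mpolyind: p => [|c m p _ _ Pp].
  by rewrite -mpolyC0.
apply: PD Pp; rewrite -mul_mpolyC mulrC mpolyXE_id.
elim: (index_enum _) => [|i r IH]; first by rewrite big_nil mul1r.
rewrite big_cons -mulrA; move: (_ * mpolyC n c) IH => q Pq.
by elim: (m i) => [|k IHk]; rewrite ?expr0 ?mul1r// exprS -mulrA; exact: PX.
Qed.

Definition pev (p : Pol) (x : 'rV[R]_n) : R[i] := meval (fun i => (x ord0 i)%:C%C) p.

Lemma pevC c x : pev (mpolyC n c) x = c. Proof. exact: mevalC. Qed.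
Lemma pevD p q x : pev (p + q) x = pev p x + pev q x. Proof. exact: mevalD. Qed.
Lemma pevM p q x : pev (p * q) x = pev p x * pev q x. Proof. exact: mevalM. Qed.
Lemma pevZ c p x : pev (c *: p) x = c * pev p x. Proof. exact: mevalZ. Qed.
Lemma pevX i x : pev (X i) x = (x ord0 i)%:C%C. Proof. exact: mevalXU. Qed.

Lemma cder_pev j p x : cder j (pev p) x (pev (mderiv j p) x).
Proof.
elim/mpoly_rect: p => [c|p q dp dq|i p dp].
- rewrite mderivC (_ : pev 0 x = 0); last exact: meval0.
  by rewrite (_ : pev _ = fun=> c); [exact: cder_cst|apply/funext => y; rewrite pevC].
- rewrite mderivD pevD (_ : pev _ = fun y => pev p y + pev q y); first exact: cderD.
  by apply/funext => y; rewrite pevD.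
- rewrite (_ : pev _ = fun y => (y ord0 i)%:C%C * pev p y); last first.
    by apply/funext => y; rewrite pevM pevX.
  apply: (cder_eq (cderM (cder_coord j x i) dp)).
  rewrite mderivM pevD !pevM pevX; congr (_ * _ + _).
  rewrite mderivX mnm1E pevZ eq_sym; case: eqP => [->|_]; last by rewrite mul0r.
  rewrite mul1r (_ : mnm_sub _ _ = mnm0); last by apply/mnmP => k; rewrite mnmBE mnm0E subnn.
  by rewrite /pev mpolyX0 meval1.
Qed.

Lemma ccont_pev p : ccont (pev p).
Proof.
elim/mpoly_rect: p => [c|p q dp dq|i p dp].
- rewrite (_ : pev _ = fun=> c); first exact: ccont_cst.
  by apply/funext => y; rewrite pevC.
- rewrite (_ : pev _ = fun y => pev p y + pev q y); first exact: ccontD.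
  by apply/funext => y; rewrite pevD.
- rewrite (_ : pev _ = fun y => (y ord0 i)%:C%C * pev p y); last first.
    by apply/funext => y; rewrite pevM pevX.
  by apply: ccontM => //; exact: ccont_coord.
Qed.

Lemma cmeas_pev p : cmeas (pev p).
Proof.
elim/mpoly_rect: p => [c|p q dp dq|i p dp].
- rewrite (_ : pev _ = fun=> c); first exact: cmeas_cst.
  by apply/funext => y; rewrite pevC.
- rewrite (_ : pev _ = fun y => pev p y + pev q y); first exact: cmeasD.
  by apply/funext => y; rewrite pevD.
- rewrite (_ : pev _ = fun y => (y ord0 i)%:C%C * pev p y); last first.
    by apply/funext => y; rewrite pevM pevX.
  by apply: cmeasM => //; exact: cmeas_coord.
Qed.

Definition nsq (x : 'rV[R]_n) : R := \sum_i x ord0 i ^+ 2.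

Lemma nsq_ge0 x : 0 <= nsq x.
Proof. by apply: sumr_ge0 => i _; exact: sqr_ge0. Qed.

(** By induction, a factor x_i costs half of the exponent: |x_i| <= 1 + x_i^2, and |x|^2 is at most
    a constant times exp (e |x|^2 / 2). *)
Lemma pev_growth p (e : R) : 0 < e ->
  exists2 C, 0 <= C & forall x, Normc.normc (pev p x) <= C * expR (e * nsq x).
Proof.
elim/mpoly_rect: p e => [c|p q dp dq|i p dp] e e0.
- exists (Normc.normc c) => [|x]; first exact: normc_ge0.
  rewrite pevC ler_peMr ?normc_ge0//; apply: le_trans (expR_ge1Dx _).
  by rewrite lerDl mulr_ge0 ?nsq_ge0// ltW.
- have [C1 C10 H1] := dp _ e0; have [C2 C20 H2] := dq _ e0.
  exists (C1 + C2); first exact: addr_ge0.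
  by move=> x; rewrite pevD (le_trans (le_normcD _ _))// mulrDl lerD.
- have e2 : 0 < e / 2 by rewrite divr_gt0.
  have [C C0 H] := dp _ e2; exists ((1 + (e / 2)^-1) * C).
    by rewrite mulr_ge0// addr_ge0// invr_ge0 ltW.
  move=> x; rewrite pevM pevX Normc.normcM.
  have -> : e * nsq x = e / 2 * nsq x + e / 2 * nsq x by field.
  rewrite expRD mulrACA; apply: ler_pM => //; rewrite ?normc_ge0//.
  rewrite /= expr0n /= addr0 sqrtr_sqr.
  have xs : x ord0 i ^+ 2 <= nsq x.
    by rewrite /nsq (bigD1 i)//= lerDl sumr_ge0// => k _; exact: sqr_ge0.
  have E := expR_ge1Dx (e / 2 * nsq x).
  have E1 : 1 <= expR (e / 2 * nsq x) by apply: le_trans E; rewrite lerDl mulr_ge0 ?nsq_ge0// ltW.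
  apply: (@le_trans _ _ (1 + nsq x)).
    have : `|x ord0 i| <= 1 + x ord0 i ^+ 2.
      have <- : `|x ord0 i| ^+ 2 = x ord0 i ^+ 2 by rewrite real_normK ?num_real.
      by have := sqr_ge0 (`|x ord0 i| - 1); nra.
    by move/le_trans; apply; rewrite lerD2l.
  rewrite mulrDl mul1r lerD// ler_pdivlMl//.
  by lra.
Qed.

End mpoly_functions.

(** * Lebesgue measure on R^n: Gaussians and integration along lines *)

Section integral_Rn.
Variable R : realType.
Local Notation leb := (@lebesgue_measure R).
Local Notation lam n := (lebesgue_Rn R n).

Lemma ge0_integral_cons n (g : 'rV[R]_n.+1 -> \bar R) :
  measurable_fun setT g -> (forall x, 0 <= g x)%E ->
  (\int[lam n.+1]_x g x = \int[leb \x lam n]_p g (row_cons p))%E.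
Proof.
move=> mg g0.
exact: (@ge0_integral_pushforward _ _ _ _ _ (@row_cons R n) (@measurable_row_cons R n)
  (leb \x lam n)%E setT g measurableT mg (fun y _ => g0 y)).
Qed.

Lemma intg_cons n (f : 'rV[R]_n.+1 -> R) : measurable_fun setT f ->
  intg (lam n.+1) f <->
  (leb \x lam n)%E.-integrable setT (fun p => (f (row_cons p))%:E).
Proof.
move=> mf; have mf' : measurable_fun setT (fun p => (f (row_cons p))%:E).
  apply/measurable_EFinP; apply: (measurableT_comp mf); exact: measurable_row_cons.
have E : (\int[lam n.+1]_x `|(f x)%:E| = \int[leb \x lam n]_p `|(f (row_cons p))%:E|)%E.
  by apply: ge0_integral_cons => //; apply: measurableT_comp => //; exact/measurable_EFinP.
split => /integrableP[_ H]; apply/integrableP; split => //.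
- by rewrite -E.
- exact/measurable_EFinP.
- by rewrite E.
Qed.

Lemma integral_cons n (f : 'rV[R]_n.+1 -> R) : intg (lam n.+1) f ->
  (\int[lam n.+1]_x (f x)%:E = \int[leb \x lam n]_p (f (row_cons p))%:E)%E.
Proof.
move=> fi; have mf := intg_meas fi; have /(intg_cons mf) fi' := fi.
apply: (@integral_pushforward _ _ _ _ _ (@row_cons R n) (@measurable_row_cons R n)
  (leb \x lam n)%E setT (EFin \o f)) => //.
exact/measurable_EFinP.
Qed.

Lemma row_cons0 n (p : measurableTypeR R * 'rV[R]_n) : row_cons p ord0 ord0 = p.1.
Proof. by have := congr1 fst (row_consK p). Qed.

Lemma row_consS n (p : measurableTypeR R * 'rV[R]_n) i : row_cons p ord0 (lift ord0 i) = p.2 ord0 i.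
Proof. by have /(congr1 snd)/rowP/(_ i) := row_consK p; rewrite mxE. Qed.

Lemma nsq_row_cons n (p : measurableTypeR R * 'rV[R]_n) : nsq (row_cons p) = p.1 ^+ 2 + nsq p.2.
Proof.
by rewrite /nsq big_ord_recl row_cons0; congr (_ + _); apply: eq_bigr => i _; rewrite row_consS.
Qed.

Lemma measurable_nsq n : measurable_fun setT (@nsq R n).
Proof.
by apply: measurable_sum => i; apply: measurable_funX; exact: measurable_row_coord.
Qed.

Lemma measurable_gauss n (e : R) : measurable_fun setT (fun x : 'rV[R]_n => expR (- e * nsq x)).
Proof.
apply: measurableT_comp; first exact: measurable_expR.
by apply: measurable_funM; [exact: measurable_cst|exact: measurable_nsq].
Qed.

(** A multiple of the normal density of variance 1 / (2e). *)
Lemma gauss1_intg (e : R) : 0 < e -> intg leb (fun t => expR (- e * t ^+ 2)).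
Proof.
move=> e0; pose s := Num.sqrt ((2 * e)^-1).
have s2 : s ^+ 2 = (2 * e)^-1 by rewrite sqr_sqrtr// invr_ge0 mulr_ge0// ltW.
have s0 : s != 0 by rewrite -(sqrf_eq0 s) s2 invr_eq0 mulf_neq0// gt_eqF.
have H := intgZ (normal_peak s)^-1 (integrable_normal_pdf 0 s).
apply: eq_integrable H => // t _ /=; congr EFin.
rewrite normal_pdfE// mulKf ?gt_eqF ?normal_peak_gt0// /normal_fun subr0 s2.
by congr expR; field; rewrite gt_eqF.
Qed.

Lemma gauss_intg n (e : R) : 0 < e -> intg (lam n) (fun x => expR (- e * nsq x)).
Proof.
move=> e0; elim: n => [|n IH].
  have m0 : measurable_fun setT (fun x : 'rV[R]_0 => (expR (- e * nsq x))%:E).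
    by apply/measurable_EFinP; exact: measurable_gauss.
  have m1 : measurable_fun setT (fun x : 'rV[R]_0 => `|(expR (- e * nsq x))%:E|%E).
    exact: measurableT_comp.
  by apply/integrableP; split => //=; rewrite (integral_dirac _ measurableT m1) diracT mul1e ltry.
apply/(intg_cons (measurable_gauss _)).
have mm : measurable_fun setT (fun p : measurableTypeR R * 'rV[R]_n =>
    (expR (- e * nsq (row_cons p)))%:E).
  apply/measurable_EFinP; apply: (measurableT_comp (measurable_gauss e)).
  exact: measurable_row_cons.
have [_ ] := (@integrable12ltyP _ _ _ _ R leb (lam n) _ mm); apply => /=.
set K := Rintegral (lam n) setT (fun x => expR (- e * nsq x)).
under eq_integral => x _.
  rewrite (_ : (\int[_]_y _)%E = (K * expR (- e * x ^+ 2))%:E); last first.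
    rewrite /K mulrC -RintZ// -integral_Rint; last exact: intgZ.
    apply: eq_integral => y _; rewrite nsq_row_cons /= ger0_norm ?expR_ge0//.
    by rewrite mulrDr expRD.
  over.
rewrite (integral_Rint (intgZ K (gauss1_intg e0))) ltry//.
Qed.

Definition upd n (x : 'rV[R]_n) (j : 'I_n) (t : R) : 'rV[R]_n :=
  \row_i (if i == j then t else x ord0 i).

(** Fubini by splitting off the first coordinate: either it is the direction j, and the inner
    integrals vanish, or the induction hypothesis applies to the slices. *)
Lemma Rint_slice n (j : 'I_n) (f : 'rV[R]_n -> R) : intg (lam n) f ->
  (forall x, (\int[leb]_t (f (upd x j t))%:E = 0)%E) ->
  Rintegral (lam n) setT f = 0.
Proof.
elim: n j f => [[]//|n IH j f fi fx].
have mf := intg_meas fi; have /(intg_cons mf) fi' := fi.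
rewrite /Rintegral (integral_cons fi).
case: (unliftP ord0 j) => [k|] jE; subst j.
  rewrite -(integral12_prod_meas1 fi').
  rewrite (@ae_eq_integral _ _ _ leb setT (cst 0%E)) ?integral0//.
  - exact: (measurable_fubini_F fi').
  (* The slice is integrable for almost every t only, which suffices for the outer integral. *)
  - apply: filterS (ae_integrable1 fi') => t it _ /=.
    transitivity ((Rintegral (lam n) setT (fun y => f (row_cons (t, y))))%:E).
      exact: (integral_Rint it).
    rewrite (IH k) // => y.
    rewrite -[RHS](fx (row_cons (t, y))); apply: eq_integral => s _; congr (f _)%:E.
    apply/rowP => i; rewrite [in RHS]mxE; case: (unliftP ord0 i) => [i'|] ->.
      by rewrite !row_consS (inj_eq (@lift_inj _ _)) mxE.
    by rewrite !row_cons0.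
rewrite -(integral21_prod_meas1 fi') integral0_eq// => y _.
rewrite -[RHS](fx (row_cons (0 : measurableTypeR R, y))); apply: eq_integral => t _; congr (f _)%:E.
apply/rowP => i; rewrite [in RHS]mxE; case: (unliftP ord0 i) => [i'|] ->.
  by rewrite !row_consS.
by rewrite eqxx !row_cons0.
Qed.

End integral_Rn.

(** * Integration by parts under Gaussian decay *)

Section parts.
Variable R : realType.
Local Notation leb := (@lebesgue_measure R).
Local Notation lam n := (lebesgue_Rn R n).

(** The fundamental theorem on [- (k + 1), k + 1]: the boundary terms are O (1 / (k + 1)), since exp
    (e s^2) >= e s for s >= 1, and dominated convergence handles the integrals. *)
Lemma Rint_deriv0 (phi dphi : R -> R) (C e : R) : 0 < e ->
  (forall t : R, is_derive t 1 phi (dphi t)) -> continuous dphi -> intg leb dphi ->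
  (forall t, `|phi t| <= C * expR (- e * t ^+ 2)) ->
  Rintegral leb setT dphi = 0.
Proof.
move=> e0 dp cd di bd.
pose K k : set R := `[- (k.+1%:R : R), k.+1%:R]%classic.
have FTC k : Rintegral leb setT (fun t => dphi t * \1_(K k) t) =
    phi k.+1%:R - phi (- k.+1%:R).
  transitivity (Rintegral leb (K k) dphi).
    rewrite [RHS]Rintegral_mkcond; congr Rintegral.
    by apply/funext => t; rewrite patchE indicE; case: ifP => _; rewrite ?mulr1 ?mulr0.
  rewrite /Rintegral (@continuous_FTC2 R dphi phi)//.
  - by rewrite ltrNl (lt_trans _ (ltr0Sn _ _))// oppr_lt0.
  - by apply: continuous_subspaceT => x; exact: cd.
  - split=> [x _||].
    + by apply: ex_derive.
    + apply: cvg_at_right_filter; apply: differentiable_continuous.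
      by apply/derivable1_diffP; apply: ex_derive.
    + apply: cvg_at_left_filter; apply: differentiable_continuous.
      by apply/derivable1_diffP; apply: ex_derive.
  - by move=> x _; rewrite derive1E derive_val.
have mdp : measurable_fun setT dphi by exact: intg_meas di.
have [||||_ L] := @Rint_dct _ _ _ leb (fun k t => dphi t * \1_(K k) t) dphi (fun t => `|dphi t|).
- by move=> k; apply: measurable_funM => //; apply: measurable_indic; exact: measurable_itv.
- move=> t; apply: cvg_near_cst; near=> k.
  rewrite indicE mem_set ?mulr1//; rewrite /K /= in_itv /= -ler_norml.
  have : (Num.truncn `|t| <= k)%N by near: k; exact: nbhs_infty_ge.
  move=> tk; apply: ltW; apply: (lt_le_trans (truncnS_gt _)); by rewrite ler_nat.
- exact: integrable_norm.
- move=> k t; rewrite normrM ler_piMr// indicE.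
  by case: (t \in K k); rewrite ?normr1 ?normr0.
have C0 : 0 <= C.
  by have := le_trans (normr_ge0 _) (bd 0); rewrite pmulr_lge0// expR_gt0.
have B k : `|phi k.+1%:R - phi (- k.+1%:R)| <= 2 * C / e * harmonic k.
  apply: (le_trans (ler_normB _ _)).
  apply: (@le_trans _ _ (2 * C * expR (- e * k.+1%:R ^+ 2))).
    by apply: (le_trans (lerD (bd _) (bd _))); rewrite sqrrN -mulrA mulr_natl mulr2n.
  rewrite -[leRHS]mulrA; apply: ler_wpM2l; first by rewrite mulr_ge0.
  rewrite mulNr expRN -invfM lef_pV2 ?posrE ?expR_gt0 ?mulr_gt0//.
  apply: le_trans (expR_ge1Dx _); rewrite ler_wpDl// ler_pM2l// expr2.
  by rewrite ler_peMr// ler1n.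
have L0 : Rintegral leb setT (fun t => dphi t * \1_(K k) t) @[k --> \oo] --> 0.
  apply/norm_cvg0P; apply: (@squeeze_cvgr _ _ _ _ (cst 0) (fun k => 2 * C / e * harmonic k)).
  - by apply: nearW => k; rewrite normr_ge0 FTC B.
  - exact: cvg_cst.
  - by rewrite -[X in _ --> X](mulr0 (2 * C / e)); apply: cvgMl_tmp; exact: cvg_harmonic.
exact: (cvg_unique _ L L0).
Unshelve. all: by end_near. Qed.

Lemma upd_line n (x : 'rV[R]_n) j t : upd x j t = t *: ebase R j + upd x j 0.
Proof.
apply/rowP => i; rewrite !mxE eqxx /=; case: eqP => _; first by rewrite mulr1 addr0.
by rewrite mulr0 add0r.
Qed.

Lemma nsq_upd n (x : 'rV[R]_n) j t : t ^+ 2 <= nsq (upd x j t).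
Proof.
rewrite /nsq (bigD1 j)//= mxE eqxx lerDl sumr_ge0// => i _; exact: sqr_ge0.
Qed.

Lemma Rint_partial n j (f f' : 'rV[R]_n -> R) (C e : R) : 0 < e ->
  (forall x, is_derive x (ebase R j) f (f' x)) -> continuous f' ->
  measurable_fun setT f' ->
  (forall x, `|f x| <= C * expR (- e * nsq x)) ->
  (forall x, `|f' x| <= C * expR (- e * nsq x)) ->
  Rintegral (lam n) setT f' = 0.
Proof.
move=> e0 df cf mf bf bf'.
have C0 : 0 <= C.
  by have := le_trans (normr_ge0 _) (bf 0); rewrite pmulr_lge0// expR_gt0.
have fi : intg (lam n) f' by apply: (intg_le mf (intgZ C (gauss_intg n e0)) bf').
apply: (@Rint_slice _ _ j) => // x.
have cupd : continuous (fun t : R => upd x j t).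
  rewrite (_ : (fun t => _) = fun t => t *: ebase R j + upd x j 0); last first.
    by apply/funext => s; exact: upd_line.
  by move=> t; apply: cvgD; [apply: cvgZr_tmp; exact: cvg_id|exact: cvg_cst].
have ci : continuous (fun t : R => f' (upd x j t)).
  by move=> t; apply: (continuous_comp (f := fun t => upd x j t)); [exact: cupd|exact: cf].
have bd (F : 'rV[R]_n -> R) : (forall x, `|F x| <= C * expR (- e * nsq x)) ->
    forall t, `|F (upd x j t)| <= C * expR (- e * t ^+ 2).
  move=> bF t; apply: (le_trans (bF _)); rewrite ler_wpM2l// ler_expR.
  by rewrite ler_nM2l ?oppr_lt0// nsq_upd.
have di : intg leb (fun t => f' (upd x j t)).
  apply: (intg_le _ (intgZ C (gauss1_intg e0)) (bd _ bf')).
  exact: continuous_measurable_fun.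
rewrite (integral_Rint di); congr EFin.
apply: (@Rint_deriv0 (fun t => f (upd x j t)) _ C e) => //.
- move=> t; have /is_derive_line := df (upd x j t) => d0.
  pose psi s := f (s *: ebase R j + upd x j t).
  have E : (fun s => f (upd x j s)) = psi \o shift (- t).
    apply/funext => s; rewrite /psi /= (upd_line x j s) (upd_line x j t) addrA -scalerDl.
    by rewrite subrK.
  rewrite E -[f' _]mulr1; apply: is_derive1_comp => /=; first by rewrite subrr.
  by rewrite -[X in is_derive _ _ _ X]addr0; apply: is_deriveD.
- exact: bd.
Qed.

Lemma cderJ n j u (x : 'rV[R]_n) du : cder j u x du ->
  cder j (fun y => (u y)^*%C) x du^*%C.
Proof.
move=> [u1 u2]; split; first by under eq_fun do rewrite ReJ; rewrite ReJ.
by under eq_fun do rewrite ImJ; rewrite ImJ; exact: is_deriveN.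
Qed.

Lemma cint_partial n j (u du : 'rV[R]_n -> R[i]) (C e : R) : 0 < e ->
  (forall x, cder j u x (du x)) -> ccont du -> cmeas du ->
  (forall x, Normc.normc (u x) <= C * expR (- e * nsq x)) ->
  (forall x, Normc.normc (du x) <= C * expR (- e * nsq x)) ->
  cint (lam n) du = 0.
Proof.
move=> e0 d [c1 c2] [m1 m2] bu bd.
have nI (z : R[i]) : `|complex.Im z| <= Normc.normc z.
  by case: z => a b /=; rewrite -sqrtr_sqr ler_wsqrtr// lerDr sqr_ge0.
have nR (z : R[i]) : `|complex.Re z| <= Normc.normc z.
  by case: z => a b /=; rewrite -sqrtr_sqr ler_wsqrtr// lerDl sqr_ge0.
rewrite /cint (Rint_partial e0 (fun x => (d x).1) c1 m1 (C := C)).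
- rewrite (Rint_partial e0 (fun x => (d x).2) c2 m2 (C := C))//.
  + by move=> x; apply: le_trans (bu x).
  + by move=> x; apply: le_trans (bd x).
- by move=> x; apply: le_trans (bu x).
- by move=> x; apply: le_trans (bd x).
Qed.

End parts.

(** * Polynomials times a Gaussian *)

Section polynomial_representation.
Variables (R : realType) (n : nat) (M : 'M[R[i]]_n) (h : R).
Local Notation Pol := (mpoly.mpoly n R[i]).
Local Notation X i := (mpolyX R[i] (mnm1 i)).
Local Notation ii := ('i%C : R[i]).
Local Notation lam := (lebesgue_Rn R n).
Hypothesis MT : M^T = M.
Hypothesis Mpos : forall x : 'rV[R]_n, x != 0 -> 0 < qf (map_mx (@complex.Re R) M) x.
Hypothesis h0 : 0 < h.
Implicit Types (p r : Pol) (x : 'rV[R]_n).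

Definition quadp : Pol :=
  (- (2 * h)^-1)%:C%C *: \sum_a \sum_b M a b *: (X a * X b).

Lemma conj_mul (a b : R[i]) : (a * b)^*%C = a^*%C * b^*%C.
Proof. by rewrite rmorphM. Qed.

Lemma mderiv_sum j (K : Type) (s : seq K) (P : pred K) (f : K -> Pol) :
  mderiv j (\sum_(k <- s | P k) f k) = \sum_(k <- s | P k) mderiv j (f k).
Proof. exact: (big_morph (mderiv j) (mderivD j) (mderiv0 _ j)). Qed.

Lemma pev0 x : pev (0 : Pol) x = 0.
Proof. by rewrite -mpolyC0 pevC. Qed.

Lemma pev_sum (K : Type) (s : seq K) (P : pred K) (f : K -> Pol) x :
  pev (\sum_(k <- s | P k) f k) x = \sum_(k <- s | P k) pev (f k) x.
Proof. exact: (big_morph (fun p => pev p x) (fun p r => pevD p r x) (pev0 x)). Qed.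

Lemma mderiv_quadp j : mderiv j quadp = (- h^-1)%:C%C *: \sum_b M j b *: X b.
Proof.
have dX a : mderiv j (X a) = mpolyC n (a == j)%:R.
  rewrite mderivX mnm1E; case: eqP => [->|_]; last by rewrite scale0r mpolyC0.
  rewrite (_ : mnm_sub _ _ = mnm0); last by apply/mnmP => k; rewrite mnmBE mnm0E subnn.
  by rewrite scale1r mpolyX0.
have MM a b : M a b = M b a by rewrite -{1}MT mxE.
rewrite /quadp mderivZ mderiv_sum.
transitivity ((- (2 * h)^-1)%:C%C *: (\sum_a (M a j *: X a) + \sum_b (M j b *: X b))).
  congr (_ *: _); rewrite [Y in _ + Y](_ : _ = \sum_a \sum_b (if a == j then M a b *: X b else 0)); last first.
    rewrite [RHS](bigD1 j)//= eqxx [Y in _ = _ + Y]big1 ?addr0// => a /negbTE ->.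
    exact: big1.
  rewrite -big_split /=; apply: eq_bigr => a _; rewrite mderiv_sum.
  transitivity (\sum_b ((if b == j then M a b *: X a else 0) + (if a == j then M a b *: X b else 0))).
    apply: eq_bigr => b _; rewrite mderivZ mderivM !dX scalerDr addrC.
    congr (_ + _); case: ifP => _.
    - by rewrite mpolyC1 mulr1.
    - by rewrite mpolyC0 mulr0 scaler0.
    - by rewrite mpolyC1 mul1r.
    - by rewrite mpolyC0 mul0r scaler0.
  by rewrite big_split /= -big_mkcond big_pred1_eq.
rewrite (eq_bigr (fun b => M j b *: X b)) => [|a _]; last by rewrite MM.
rewrite -mulr2n -scalerMnr scalerMnl -rmorphMn /=; congr (_%:C%C *: _).
by rewrite -mulr_natl; field; rewrite gt_eqF.
Qed.

Definition gss x : R[i] := cexp (pev quadp x).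
Definition ev p x : R[i] := pev p x * gss x.
(** The derivative conjugated by the Gaussian: d_j (p G) = (dpol j p) G for G = exp of [quadp]. *)
Definition dpol j p : Pol := mderiv j p + mderiv j quadp * p.

Lemma evZD c p r x : ev (c *: p + r) x = c * ev p x + ev r x.
Proof. by rewrite /ev pevD pevZ mulrDl mulrA. Qed.

Lemma ev0 x : ev 0 x = 0.
Proof. by rewrite /ev pev0 mul0r. Qed.

Lemma evD p r x : ev (p + r) x = ev p x + ev r x.
Proof. by rewrite /ev pevD mulrDl. Qed.

Lemma evZ c p x : ev (c *: p) x = c * ev p x.
Proof. by rewrite /ev pevZ mulrA. Qed.

Lemma ev_sum (K : Type) (s : seq K) (P : pred K) (f : K -> Pol) x :
  ev (\sum_(k <- s | P k) f k) x = \sum_(k <- s | P k) ev (f k) x.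
Proof. exact: (big_morph (fun p => ev p x) (fun p r => evD p r x) (ev0 x)). Qed.

Lemma evX j p x : ev (X j * p) x = (x ord0 j)%:C%C * ev p x.
Proof. by rewrite /ev pevM pevX mulrA. Qed.

Lemma cder_ev j p x : cder j (ev p) x (ev (dpol j p) x).
Proof.
apply: (cder_eq (cderM (cder_pev j p x) (cder_cexp (cder_pev j quadp x)))).
by rewrite /ev /dpol pevD pevM mulrDl; congr (_ + _); rewrite mulrCA mulrA.
Qed.

Lemma ccont_ev p : ccont (ev p).
Proof. by apply: ccontM; [exact: ccont_pev|apply: ccont_cexp; exact: ccont_pev]. Qed.

Lemma cmeas_ev p : cmeas (ev p).
Proof. by apply: cmeasM; [exact: cmeas_pev|apply: cmeas_cexp; exact: cmeas_pev]. Qed.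

Lemma gss_decay : exists2 e, 0 < e & forall x, Normc.normc (gss x) <= expR (- e * nsq x).
Proof.
have [|c c0 Hc] := @posdef_lower _ _ (map_mx (@complex.Re R) M) _ Mpos.
  by apply/matrixP => i j; rewrite !mxE -[in LHS]MT mxE.
exists ((2 * h)^-1 * c) => [|x]; first by rewrite mulr_gt0// invr_gt0 mulr_gt0.
rewrite normc_cexp ler_expR.
rewrite pevZ pev_sum.
rewrite (_ : \sum_(i < n) _ = \sum_a \sum_b M a b * (x ord0 a * x ord0 b)%:C%C); last first.
  apply: eq_bigr => a _; rewrite pev_sum; apply: eq_bigr => b _.
  by rewrite pevZ pevM !pevX rmorphM.
rewrite ReM /= mul0r subr0 mulNr mulNr lerN2 -mulrA ler_pM2l ?invr_gt0 ?mulr_gt0//.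
apply: (le_trans (Hc x)); rewrite Re_sum qfE le_eqVlt; apply/orP; left; apply/eqP.
apply: eq_bigr => a _; rewrite Re_sum; apply: eq_bigr => b _.
by rewrite ReM /= mulr0 subr0 mxE mulrAC mulrA.
Qed.

Lemma ev_decay p : exists C e, [/\ 0 <= C, 0 < e &
  forall x, Normc.normc (ev p x) <= C * expR (- e * nsq x)].
Proof.
have [e e0 He] := gss_decay; have e2 : 0 < e / 2 by rewrite divr_gt0.
have [C C0 HC] := pev_growth p e2; exists C, (e / 2); split=> // x.
rewrite Normc.normcM (le_trans (ler_pM (normc_ge0 _) (normc_ge0 _) (HC x) (He x)))//.
by rewrite -mulrA -expRD le_eqVlt; apply/orP; left; apply/eqP; congr (_ * expR _); field.
Qed.

Lemma sqint_ev p : sqint lam (ev p).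
Proof.
have [C [e [C0 e0 H]]] := ev_decay p; split; first exact: cmeas_ev.
have e2 : 0 < 2 * e by rewrite mulr_gt0.
apply: (intg_le _ (intgZ (C ^+ 2) (gauss_intg n e2))).
  by apply: cmeas_sqc; exact: cmeas_ev.
move=> x; rewrite ger0_norm ?sqc_ge0// -normc_sqr.
rewrite (_ : - (2 * e) * nsq x = - e * nsq x + - e * nsq x); last by ring.
by rewrite expRD -expr2 -exprMn ler_pXn2r ?nnegrE ?normc_ge0 ?mulr_ge0 ?expR_ge0.
Qed.

(** The letters x_j and i h d_j = - h D_j: transposition for the bilinear pairing changes the sign
    of D_j. Elements are recorded by their polynomial factor alone, the Gaussian being restored by
    [ev]. *)
Definition Lp (a : 'I_(n + n)) p : Pol :=
  match fintype.split a with
  | inl j => X j * p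
  | inr j => (ii * h%:C%C) *: dpol j p
  end.

Lemma dpol_linear j c p r : dpol j (c *: p + r) = c *: dpol j p + dpol j r.
Proof.
by rewrite /dpol mderivD mderivZ mulrDr -scalerAr scalerDr addrACA.
Qed.

Lemma Lp_linear a c p r : Lp a (c *: p + r) = c *: Lp a p + Lp a r.
Proof.
rewrite /Lp; case: fintype.split => j; first by rewrite mulrDr -scalerAr.
by rewrite dpol_linear scalerDr !scalerA mulrC.
Qed.

Lemma mderiv_var j a : mderiv j (X a) = mpolyC n (a == j)%:R.
Proof.
rewrite mderivX mnm1E; case: eqP => [->|_]; last by rewrite scale0r mpolyC0.
rewrite (_ : mnm_sub _ _ = mnm0); last by apply/mnmP => k; rewrite mnmBE mnm0E subnn.
by rewrite scale1r mpolyX0.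
Qed.

Lemma dpolX j a p : dpol j (X a * p) = X a * dpol j p + (a == j)%:R *: p.
Proof.
rewrite /dpol mderivM mderiv_var mul_mpolyC mulrDr [in RHS]addrC addrA.
by congr (_ + _); rewrite mulrCA.
Qed.

Lemma dpolC j k p : dpol j (dpol k p) = dpol k (dpol j p).
Proof.
rewrite /dpol !mderivD !mderivM (mderiv_comm k j p) (mderiv_comm k j quadp).
by ring.
Qed.

Lemma Lp_ccr a b p :
  Lp a (Lp b p) = Lp b (Lp a p) + (- ii * h%:C%C * Jmx R n a b) *: p.
Proof.
rewrite /Jmx /Lp; case: (split_ordP a) => i ->; case: (split_ordP b) => j ->;
  rewrite ?(unsplitK (inl _)) ?(unsplitK (inr _)).
- by rewrite block_mxEul mxE mulr0 scale0r addr0 mulrCA.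
- rewrite block_mxEur [1%:M _ _]mxE -scalerAr dpolX scalerDr scalerA -addrA -scalerDl.
  by rewrite -mulrDl mulNr subrr mul0r scale0r addr0.
- rewrite block_mxEdl mxE [1%:M _ _]mxE dpolX scalerDr scalerAr scalerA.
  by rewrite eq_sym mulrN !mulNr opprK.
- have Z k c r : dpol k (c *: r) = c *: dpol k r.
    have := dpol_linear k c r 0; rewrite addr0 => ->.
    by rewrite /dpol mderiv0 mulr0 !addr0.
  by rewrite block_mxEdr mxE mulr0 scale0r addr0 !Z dpolC.
Qed.

Definition ipp p r : R[i] := cint lam (fun x => ev p x * (ev r x)^*%C).

Lemma ipp_cintg p r : cintg lam (fun x => ev p x * (ev r x)^*%C).
Proof. by apply: sqint_prod; [|apply: sqintJ]; exact: sqint_ev. Qed.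

Lemma ipp_linear c p r w : ipp (c *: p + r) w = c * ipp p w + ipp r w.
Proof.
rewrite /ipp -cintZ; last exact: ipp_cintg.
rewrite -cintD; [|by apply: cintgZ; exact: ipp_cintg|exact: ipp_cintg].
by congr cint; apply/funext => x; rewrite evZD mulrDl mulrA.
Qed.

Lemma ippJ p r : ipp r p = (ipp p r)^*%C.
Proof.
rewrite /ipp -cintJ; last exact: ipp_cintg.
congr cint; apply/funext => x.
by rewrite [RHS]conj_mul conjcK mulrC.
Qed.

Lemma ippvv p : complex.Re (ipp p p) = Rintegral lam setT (fun x => sqc (ev p x)).
Proof.
rewrite /ipp /cint /=; congr Rintegral; apply/funext => x.
by rewrite /sqc ReM ReJ ImJ; ring.
Qed.

Lemma ipp_ge0 p : 0 <= complex.Re (ipp p p).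
Proof. by rewrite ippvv; apply: Rint_ge0 => x; exact: sqc_ge0. Qed.

(** The integral of d_j of the product of the two functions, the second conjugated, vanishes by
    Gaussian decay. The smallest of the four decay rates serves for the product and its
    derivative. *)
Lemma ipp_dpol j p r : ipp (dpol j p) r = - ipp p (dpol j r).
Proof.
apply/eqP; rewrite -addr_eq0 /ipp -cintD; [|exact: ipp_cintg..].
have [C1 [e1 [C10 e10 H1]]] := ev_decay p.
have [C2 [e2 [C20 e20 H2]]] := ev_decay r.
have [D1 [f1 [D10 f10 K1]]] := ev_decay (dpol j p).
have [D2 [f2 [D20 f20 K2]]] := ev_decay (dpol j r).
pose e := Num.min (Num.min e1 e2) (Num.min f1 f2).
have e0 : 0 < e by rewrite !lt_min e10 e20 f10 f20.
have W (a b x y A B : R) : 0 <= x -> 0 <= y -> 0 <= A -> 0 <= B ->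
    x <= A * a -> a <= b -> y <= B -> x * y <= A * B * b.
  move=> x0 y0 A0 B0 xa ab yB; rewrite mulrAC; apply: ler_pM => //.
  by apply: (le_trans xa); exact: ler_wpM2l.
have G f x : e <= f -> expR (- f * nsq x) <= expR (- e * nsq x).
  by move=> ef; rewrite ler_expR ler_wpM2r ?nsq_ge0// lerN2.
have G1 C f x z : 0 <= C -> 0 < f -> Normc.normc z <= C * expR (- f * nsq x) -> Normc.normc z <= C.
  move=> C0 f0 /le_trans; apply; rewrite ler_piMr// expR_le1.
  by rewrite mulNr oppr_le0 mulr_ge0 ?nsq_ge0// ltW.
have [ee1 ee2 ef1] : [/\ e <= e1, e <= e2 & e <= f1] by rewrite !ge_min !lexx ?orbT.
apply/eqP; apply: (cint_partial (j := j) (u := fun x => ev p x * (ev r x)^*%C)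
    (C := C1 * C2 + (D1 * C2 + C1 * D2)) e0).
- by move=> x; apply: cderM; [exact: cder_ev|apply: cderJ; exact: cder_ev].
- have cJ q : ccont (fun x => (ev q x)^*%C).
    have [c1 c2] := ccont_ev q; split; first by under eq_fun do rewrite ReJ.
    by under eq_fun do rewrite ImJ; move=> x; exact: (continuousN (c2 x)).
  by apply: ccontD; apply: ccontM => //; exact: ccont_ev.
- by apply: cmeasD; apply: cmeasM; try apply: cmeasJ; exact: cmeas_ev.
- move=> x; rewrite Normc.normcM normcJ'.
  apply: (@le_trans _ _ (C1 * C2 * expR (- e * nsq x))); last first.
    by rewrite ler_wpM2r ?expR_ge0// lerDl addr_ge0// mulr_ge0.
  by apply: (W _ _ _ _ _ _ _ _ _ _ (H1 x) (G _ x ee1)); rewrite ?normc_ge0//; apply: G1 (H2 x).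
- move=> x; apply: (le_trans (le_normcD _ _)); rewrite (Normc.normcM (ev (dpol j p) x)) (Normc.normcM (ev p x)) !normcJ'.
  apply: (@le_trans _ _ (D1 * C2 * expR (- e * nsq x) + C1 * D2 * expR (- e * nsq x))).
    apply: lerD.
      by apply: (W _ _ _ _ _ _ _ _ _ _ (K1 x) (G _ x ef1)); rewrite ?normc_ge0//; apply: G1 (H2 x).
    by apply: (W _ _ _ _ _ _ _ _ _ _ (H1 x) (G _ x ee1)); rewrite ?normc_ge0//; apply: G1 (K2 x).
  by rewrite -mulrDl ler_wpM2r ?expR_ge0// lerDr mulr_ge0.
Qed.

Lemma ippZr c p r : ipp p (c *: r) = c^*%C * ipp p r.
Proof. exact: (ipZr ipp_linear ippJ). Qed.

Lemma ippZl c p r : ipp (c *: p) r = c * ipp p r.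
Proof. exact: (ipZl ipp_linear). Qed.

Lemma Lp_sym a p r : ipp (Lp a p) r = ipp p (Lp a r).
Proof.
rewrite /Lp; case: fintype.split => j.
  by congr cint; apply/funext => x; rewrite !evX (conj_mul (x ord0 j)%:C%C) conjc_real [RHS]mulrCA -[LHS]mulrA.
rewrite ippZl ippZr ipp_dpol mulrN -mulNr; congr (_ * _).
by apply/eqP; rewrite eq_complex /=; apply/andP; split; apply/eqP; ring.
Qed.

Lemma ipp_pos m (A : 'M[R[i]]_m) (c : R) :
  (forall v : 'I_m -> R[i], c * \sum_a sqc (v a) <=
     complex.Re (\sum_a \sum_b A a b * v b * (v a)^*%C)) ->
  forall f : 'I_m -> Pol, c * \sum_a nm ipp (f a) ^+ 2 <=
     complex.Re (\sum_a \sum_b A a b * ipp (f b) (f a)).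
Proof.
move=> H f.
have E : \sum_a \sum_b A a b * ipp (f b) (f a) =
    cint lam (fun x => \sum_a \sum_b A a b * (ev (f b) x * (ev (f a) x)^*%C)).
  rewrite cint_sum => [|a]; last by apply: cintg_sum => b; apply: cintgZ; exact: ipp_cintg.
  apply: eq_bigr => a _; rewrite cint_sum => [|b]; last by apply: cintgZ; exact: ipp_cintg.
  by apply: eq_bigr => b _; rewrite cintZ//; exact: ipp_cintg.
have I : cintg lam (fun x => \sum_a \sum_b A a b * (ev (f b) x * (ev (f a) x)^*%C)).
  by apply: cintg_sum => a; apply: cintg_sum => b; apply: cintgZ; exact: ipp_cintg.
have E2 : \sum_a nm ipp (f a) ^+ 2 = complex.Re (\sum_a ipp (f a) (f a)).
  by rewrite Re_sum; apply: eq_bigr => a _; rewrite (nm_sqr ipp_ge0).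
have I2 : cintg lam (fun x => \sum_a ev (f a) x * (ev (f a) x)^*%C).
  by apply: cintg_sum => a; exact: ipp_cintg.
rewrite E2 E -cint_sum => [|a]; last exact: ipp_cintg.
rewrite /cint /= -RintZ; last exact: I2.1.
apply: Rint_le; [by apply: intgZ; exact: I2.1|exact: I.1|] => x.
have := H (fun a => ev (f a) x).
rewrite (eq_bigr (fun a => \sum_b A a b * (ev (f b) x * (ev (f a) x)^*%C))) => [|a _]; last first.
  by apply: eq_bigr => b _; rewrite mulrA.
congr (_ * _ <= _); rewrite Re_sum; apply: eq_bigr => a _.
by case: (ev (f a) x) => s t; rewrite /sqc /=; ring.
Qed.

(** On polynomial factors the annihilator (M x)_j + h d_j becomes h d_j, the derivative of the
    Gaussian cancelling (M x)_j. So the vacuum is the constant 1, and it is unique up to scalars. *)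
Lemma op_ann j p : op Lp (row j (annmx M)) p = h%:C%C *: mderiv j p.
Proof.
rewrite /op big_split_ord /=.
rewrite (eq_bigr (fun k => M j k *: (X k * p))) => [|k _]; last first.
  by rewrite mxE /annmx row_mxEl /Lp (unsplitK (inl _)).
rewrite [Y in _ + Y](_ : _ = h%:C%C *: dpol j p); last first.
  rewrite (bigD1 j)//= big1 => [|k kj].
    rewrite [row j _ _ _]mxE /annmx row_mxEr /Lp (unsplitK (inr _)) !mxE eqxx mulr1n addr0 scalerA.
    by rewrite mulrA mulNr -expr2 sqr_i opprK mul1r.
  by rewrite [row j _ _ _]mxE /annmx row_mxEr !mxE eq_sym (negbTE kj) mulr0n oppr0 scale0r.
rewrite /dpol mderiv_quadp scalerDr addrC -addrA -[RHS]addr0; congr (_ + _).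
rewrite -scalerAl scalerA -rmorphM /= mulrN divff ?gt_eqF// rmorphN1 scaleN1r.
rewrite mulr_suml addrC; apply/eqP; rewrite subr_eq0; apply/eqP.
by apply: eq_bigr => k _; rewrite scalerAl.
Qed.

Lemma ann_vac j : op Lp (row j (annmx M)) (mpolyC n 1) = 0.
Proof. by rewrite op_ann mderivC scaler0. Qed.

Lemma ann_vac_uniq p : (forall j, op Lp (row j (annmx M)) p = 0) ->
  exists c, p = c *: mpolyC n 1.
Proof.
move=> H; exists (mcoeff mnm0 p); apply/mpolyP => m.
rewrite mcoeffZ mcoeffC mul1r; have [->|m0] := eqVneq m mnm0; first by rewrite mulr1.
rewrite mulr0.
have [i mi] : exists i, m i != 0%N.
  apply/existsP; rewrite -negb_forall; apply: contra m0 => /forallP m0.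
  by apply/eqP/mnmP => i; rewrite mnm0E (eqP (m0 i)).
have : h%:C%C *: mderiv i p = 0 by rewrite -op_ann H.
move/(congr1 (fun r => mcoeff (mnm_sub m (mnm1 i)) r)).
rewrite mcoeffZ mcoeff_deriv mcoeff0 submK; last first.
  by apply/mnm_lepP => k; rewrite mnm1E; case: eqP => // <-; rewrite lt0n.
move/eqP; rewrite mulf_eq0 -mulr_natr mulf_eq0 pnatr_eq0 orbF => /orP[|/eqP->//].
by rewrite eq_complex /= gt_eqF.
Qed.

Lemma pol_gen : (M + map_mx (@conjc R) M) \in unitmx -> forall p, exists N,
  wspan (fun j => op Lp (row j (cremx M))) (mpolyC n 1) (leq^~ N) p.
Proof.
move=> Gu; elim/mpoly_rect => [c|p r [N1 H1] [N2 H2]|i p [N H]].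
- exists 0%N; rewrite -[mpolyC n c]mulr1 mul_mpolyC; apply: wspanZ.
  by rewrite -mpolyC1; exact: (@wspan_word _ _ _ _ _ _ [::]).
- exists (maxn N1 N2); apply: wspanD.
    by apply: wspanW H1 => d dN; exact: leq_trans (leq_maxl _ _).
  by apply: wspanW H2 => d dN; exact: leq_trans (leq_maxr _ _).
- exists N.+1; have -> : X i * p = op Lp (delta_mx ord0 (lshift n i)) p.
    by rewrite op_delta /Lp (unsplitK (inl _)).
  exact: (S_op Gu Lp_linear Lp_ccr ann_vac).
Qed.

End polynomial_representation.

Section positive_norm.
Variables (R : realType).
Local Notation lam n := (lebesgue_Rn R n).

Lemma lebesgue_Rn_setT n : lam n setT != 0%E.
Proof.
elim: n => [|n IH]; first by rewrite /= diracT.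
rewrite (_ : lam n.+1 setT = (@lebesgue_measure R \x lam n)%E (setT `*` setT)); last first.
  by rewrite setXTT.
have -> : (@lebesgue_measure R \x lam n)%E (setT `*` setT) =
    (@lebesgue_measure R setT * lam n setT)%E by apply: product_measure1E.
by rewrite -set_itvNyy lebesgue_measure_itv /= mule_eq0 negb_or IH andbT.
Qed.

(** With zero norm the integrand would vanish almost everywhere, whereas it vanishes nowhere and R^n
    is not negligible. *)
Lemma nm_gt0 n (M : 'M[R[i]]_n) h p : M^T = M ->
  (forall x : 'rV[R]_n, x != 0 -> 0 < qf (map_mx (@complex.Re R) M) x) ->
  0 < h -> (forall x, pev p x != 0) -> 0 < nm (ipp M h) p.
Proof.
move=> MT Mpos h0 pn0; rewrite lt_neqAle nm_ge0 andbT eq_sym.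
apply/eqP => /(congr1 (fun t => t ^+ 2)).
rewrite expr0n /= (nm_sqr (ipp_ge0 M h)) ippvv => H.
have [_ ei] := sqint_ev MT Mpos h0 p.
have := congr1 EFin H; rewrite -integral_Rint// => I0.
have me : measurable_fun setT (fun x => (sqc (ev M h p x))%:E).
  by apply/measurable_EFinP/cmeas_sqc; exact: cmeas_ev.
have I1 : (\int[lam n]_x `|(sqc (ev M h p x))%:E| = 0)%E.
  by rewrite -[RHS]I0; apply: eq_integral => x _; rewrite gee0_abs// lee_fin sqc_ge0.
have [A [mA A0 AT]] := (ae_eq_integral_abs (lam n) measurableT me).1 I1.
have : (lam n setT <= lam n A)%E.
  apply: le_measure; rewrite ?inE// => x _; apply: AT => /= /(_ I) [].
  rewrite -normc_sqr => /eqP; rewrite sqrf_eq0 Normc.normcM normc_cexp mulf_eq0.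
  rewrite [expR _ == 0]gt_eqF ?expR_gt0// orbF => /eqP /Normc.eq0_normc /eqP.
  by rewrite (negbTE (pn0 x)).
by rewrite A0 measure_le0 (negbTE (lebesgue_Rn_setT n)).
Qed.

End positive_norm.

(** * Cutoffs and the transposed operator *)

Section bump_functions.
Variable R : realType.
Implicit Types (a : {poly R}) (s t y : R).

Lemma horner_expR_bounded a (e : R) : 0 < e ->
  exists2 C, 0 <= C & forall y, 0 <= y -> `|a.[y]| <= C * expR (e * y).
Proof.
elim/poly_ind: a e => [|a c IH] e e0.
  by exists 0 => // y y0; rewrite horner0 normr0 mul0r.
have e2 : 0 < e / 2 by rewrite divr_gt0.
have [C C0 H] := IH _ e2; exists (C * (e / 2)^-1 + `|c|).
  by rewrite addr_ge0// mulr_ge0// invr_ge0 ltW.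
move=> y y0; rewrite hornerMXaddC; apply: (le_trans (ler_normD _ _)).
rewrite mulrDl lerD//; last first.
  by rewrite ler_peMr// (le_trans _ (expR_ge1Dx _))// lerDl mulr_ge0// ltW.
have -> : e * y = e / 2 * y + e / 2 * y by field.
rewrite expRD mulrACA normrM; apply: ler_pM => //; first exact: H.
rewrite ger0_norm// ler_pdivlMl//.
by apply: le_trans (expR_ge1Dx _); rewrite lerDr.
Qed.

(* 0^-1 = 0, so the first branch would give [a.[0]] at [s = 0]. *)
Definition bump a s : R := if 0 < s then a.[s^-1] * expR (- s^-1) else 0.

Lemma bump_bounded a : exists2 C, 0 <= C & forall s, `|bump a s| <= C.
Proof.
have [C C0 H] := horner_expR_bounded a ltr01; exists C => // s.
rewrite /bump; case: ifP => s0; last by rewrite normr0.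
rewrite normrM (ger0_norm (expR_ge0 _)) expRN ler_pdivrMr ?expR_gt0//.
by rewrite -[X in expR X]mul1r H// invr_ge0 ltW.
Qed.

(** The polynomial for which (a(1/s) exp (- 1/s))' has again this form; the family being stable
    under differentiation, all its members are smooth. *)
Definition dbump a : {poly R} := 'X^2 * (a - a^`()).

Lemma is_derive_quad (f : R -> R) (C : R) : f 0 = 0 ->
  (forall t, `|f t| <= C * t ^+ 2) -> is_derive (0 : R) 1 f 0.
Proof.
move=> f0 H.
have L : (fun t : R => t^-1 *: ((f \o shift 0) (t *: (1 : R)) - f 0)) @ (0 : R)^' --> (0 : R).
  apply/norm_cvg0P; apply: (@squeeze_cvgr _ _ _ _ (cst 0) (fun t : R => `|C| * `|t|)).
  - near=> t; rewrite normr_ge0 /= f0 subr0 addr0 [t *: 1]mulr1 /GRing.scale /= normrM normfV.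
    have t0 : t != 0 by near: t; exact: nbhs_dnbhs_neq.
    rewrite ler_pdivrMl ?normr_gt0//; apply: (le_trans (H t)).
    apply: (@le_trans _ _ (`|C| * t ^+ 2)); first by rewrite ler_wpM2r ?sqr_ge0// ler_norm.
    by rewrite -real_normK ?num_real// expr2 mulrCA mulrA.
  - exact: cvg_cst.
  - rewrite -[X in _ --> X](mulr0 `|C|); apply: cvgMl_tmp.
    rewrite -[X in _ --> X](normr0 R); apply: cvg_norm.
    exact: (cvg_trans (@nbhs_dnbhs _ 0)).
by split; [apply/cvg_ex; exists 0|exact: cvg_lim L].
Unshelve. all: by end_near. Qed.

Lemma is_derive_bump a s : is_derive s 1 (bump a) (bump (dbump a) s).
Proof.
have [s0|s0|->] := ltgtP s 0.
- apply: (@near_eq_is_derive _ _ _ (fun=> 0)); last first.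
    by rewrite /bump ltNge (ltW s0) /=; exact: is_derive_cst.
  near=> t; rewrite /bump ltNge (_ : t <= 0)//.
  by apply: ltW; near: t; exact: lt_nbhsl.
- pose f t : R := a.[t^-1] * expR (- t^-1).
  apply: (@near_eq_is_derive _ _ _ f).
    near=> t; rewrite /bump (_ : 0 < t)//.
    by near: t; exact: lt_nbhsr.
  have dV : is_derive s 1 (fun t : R => t^-1) (- s ^- 2).
    have sn : s != 0 by rewrite gt_eqF.
    by apply: (is_derive_eq (is_deriveV (f := id) sn (is_derive_id s 1))); rewrite [_ *: _]mulr1.
  have d1 := @is_derive1_comp _ (horner a) (fun t : R => t^-1) s _ _ (is_derive_poly a s^-1) dV.
  have d2 := @is_derive1_comp _ (@expR R) (fun t : R => - t^-1) s _ _ (is_derive_expR (- s^-1)) (is_deriveN dV).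
  apply: (is_derive_eq (is_deriveM d1 d2)).
  rewrite /bump s0 /dbump /GRing.scale /= hornerM hornerXn hornerD hornerN.
  by rewrite exprVn; ring.
- have -> : bump (dbump a) 0 = 0 by rewrite /bump ltxx.
  (* Boundedness for X^2 a means |bump a t| <= C t^2, whence a zero derivative at 0. *)
  have [C C0 H] := bump_bounded ('X^2 * a).
  apply: (@is_derive_quad _ C) => [|t]; first by rewrite /bump ltxx.
  have := H t; rewrite /bump; case: ifP => t0; last by rewrite normr0 mulr_ge0 ?sqr_ge0.
  rewrite hornerM hornerXn -mulrA normrM exprVn (ger0_norm (_ : 0 <= (t ^+ 2)^-1)); last first.
    by rewrite invr_ge0 sqr_ge0.
  by rewrite ler_pdivrMl ?exprn_gt0// [t ^+ 2 * C]mulrC.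
Unshelve. all: by end_near. Qed.

Lemma continuous_bump a : continuous (bump a).
Proof.
move=> s; apply: differentiable_continuous; apply/derivable1_diffP.
by have := is_derive_bump a s => -[].
Qed.

End bump_functions.

Section complex_cvg.
Variable R : realType.
Implicit Types (z w : nat -> R[i]) (l m c : R[i]).

Definition ccvg z l :=
  (complex.Re (z k) @[k --> \oo] --> complex.Re l) /\
  (complex.Im (z k) @[k --> \oo] --> complex.Im l).

Lemma ccvg_cst c : ccvg (fun=> c) c.
Proof. by split; exact: cvg_cst. Qed.

Lemma ccvgD z w l m : ccvg z l -> ccvg w m -> ccvg (fun k => z k + w k) (l + m).
Proof.
move=> [z1 z2] [w1 w2]; split.
  by rewrite ReD; under eq_fun do rewrite ReD; exact: cvgD.
by rewrite ImD; under eq_fun do rewrite ImD; exact: cvgD.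
Qed.

Lemma ccvgM z w l m : ccvg z l -> ccvg w m -> ccvg (fun k => z k * w k) (l * m).
Proof.
move=> [z1 z2] [w1 w2]; split.
  by rewrite ReM; under eq_fun do rewrite ReM; apply: cvgB; exact: cvgM.
by rewrite ImM; under eq_fun do rewrite ImM; apply: cvgD; exact: cvgM.
Qed.

Lemma ccvgZ c z l : ccvg z l -> ccvg (fun k => c * z k) (c * l).
Proof. exact: ccvgM (ccvg_cst c). Qed.

Lemma ccvgN z l : ccvg z l -> ccvg (fun k => - z k) (- l).
Proof.
move=> [z1 z2]; split; first by rewrite ReN; under eq_fun do rewrite ReN; exact: cvgN.
by rewrite ImN; under eq_fun do rewrite ImN; exact: cvgN.
Qed.

Lemma ccvg_sum (J : Type) (r : seq J) (z : J -> nat -> R[i]) (l : J -> R[i]) :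
  (forall j, ccvg (z j) (l j)) ->
  ccvg (fun k => \sum_(j <- r) z j k) (\sum_(j <- r) l j).
Proof.
move=> H; elim: r => [|j r IH].
  by rewrite big_nil; under eq_fun do rewrite big_nil; exact: ccvg_cst.
by rewrite big_cons; under eq_fun do rewrite big_cons; exact: ccvgD.
Qed.

Lemma ccvg_unique z l m : ccvg z l -> ccvg z m -> l = m.
Proof.
move=> [z1 z2] [w1 w2]; apply/eqP; rewrite eq_complex.
apply/andP; split; apply/eqP.
  exact: (cvg_unique (@norm_hausdorff _ _) z1 w1).
exact: (cvg_unique (@norm_hausdorff _ _) z2 w2).
Qed.

Lemma ccvgR (f : nat -> R) (a : R) : f @ \oo --> a -> ccvg (fun k => (f k)%:C%C) a%:C%C.
Proof. by move=> fa; split => //=; exact: cvg_cst. Qed.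

End complex_cvg.

(** The weights of the Weyl expression with h / i = - t, t = i h: signs cancel in pairs, as do the
    factors 2 and 1/2 of the mixed term. *)
Lemma weyl_weights (K : fieldType) (a b c t x1 x2 x3 x4 : K) : 2%:R != 0 :> K ->
  a * x1 + b * (- t * - (- t * - x2)) + c *+ 2 * ((- t * - x3 + - t * - x4) / 2) =
  a * x1 + b * (t ^+ 2 * x2) + (c * (t * x3) + c * (t * x4)).
Proof. by move=> two0; field. Qed.

Section cutoff.
Variables (R : realType) (n : nat) (M : 'M[R[i]]_n) (h : R).
Local Notation Pol := (mpoly.mpoly n R[i]).
Local Notation X i := (mpolyX R[i] (mnm1 i)).
Local Notation ii := ('i%C : R[i]).
Local Notation lam := (lebesgue_Rn R n).
Local Notation ev := (ev M h).
Local Notation dpol := (dpol M h).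
Hypothesis MT : M^T = M.
Hypothesis Mpos : forall x : 'rV[R]_n, x != 0 -> 0 < qf (map_mx (@complex.Re R) M) x.
Hypothesis h0 : 0 < h.
Local Notation item := (nat * {poly R} * Pol)%type.
Implicit Types (p r : Pol) (x : 'rV[R]_n) (t : item) (s : seq item) (j : 'I_n) (k : nat).

Lemma cont_nsq : continuous (@nsq R n).
Proof.
have -> : @nsq R n = fun x => complex.Re (\sum_i (x ord0 i)%:C%C * (x ord0 i)%:C%C).
  by apply/funext => x; rewrite Re_sum; apply: eq_bigr => i _; rewrite ReM /= mul0r subr0 expr2.
have [] // := @ccont_sum R n _ (index_enum 'I_n) (fun i (x : 'rV[R]_n) => (x ord0 i)%:C%C * (x ord0 i)%:C%C).
by move=> i; apply: ccontM; exact: ccont_coord.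
Qed.

Lemma is_derive_nsq j x : is_derive x (ebase R j) (@nsq R n) (2 * x ord0 j).
Proof.
have -> : @nsq R n = \sum_(i < n) (fun x : 'rV[R]_n => x ord0 i ^+ 2).
  by apply/funext => y; rewrite fct_sumE.
have -> : 2 * x ord0 j = \sum_(i < n) (2 * x ord0 i) * (j == i)%:R.
  rewrite (bigD1 j)//= eqxx mulr1 big1 ?addr0// => i.
  by rewrite eq_sym => /negbTE->; rewrite mulr0.
apply: is_derive_sum => i; have d := is_derive_coord x j i.
by apply: (is_derive_eq (is_deriveM d d)); rewrite /GRing.scale /=; ring.
Qed.

Definition epsk k : R := (k.+1%:R)^-1.

(** An item (m, a, p) encodes eps^m times a cutoff of shape a times [ev p], with eps = 1 / (k + 1).
    The span of such terms is stable under x_j and d_j, and a derivative falling on the cutoff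
    raises m by one. *)
Definition cut t k x : R[i] :=
  (epsk k ^+ t.1.1 * bump t.1.2 (1 - epsk k * nsq x))%:C%C * ev t.2 x.

Definition cuts s k x : R[i] := \sum_(t <- s) cut t k x.

Definition cutX j s : seq item := [seq (t.1, X j * t.2) | t <- s].

Definition cutD j s : seq item :=
  flatten [seq [:: (t.1, dpol j t.2);
    (t.1.1.+1, dbump t.1.2, (- 2 : R)%:C%C *: (X j * t.2))] | t <- s].

(** As eps tends to 0 the items with m > 0 disappear and the cutoff tends to its value at argument
    1. *)
Definition cut_lim s : Pol :=
  \sum_(t <- s) ((t.1.1 == 0%N)%:R * bump t.1.2 1)%:C%C *: t.2.

Lemma cutsX j s k x : (x ord0 j)%:C%C * cuts s k x = cuts (cutX j s) k x.
Proof.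
rewrite /cuts /cutX big_map mulr_sumr; apply: eq_bigr => t _.
by rewrite /cut evX mulrCA.
Qed.

Lemma cut_limX j s : cut_lim (cutX j s) = X j * cut_lim s.
Proof.
rewrite /cut_lim /cutX big_map mulr_sumr; apply: eq_bigr => t _.
by rewrite scalerAr.
Qed.

Lemma dpol0 j : dpol j 0 = 0.
Proof. by rewrite /dpol mderiv0 mulr0 addr0. Qed.

Lemma cut_limD j s : cut_lim (cutD j s) = dpol j (cut_lim s).
Proof.
rewrite /cut_lim /cutD big_flatten big_map /=.
elim: s => [|t s IH]; first by rewrite !big_nil dpol0.
rewrite [in RHS]big_cons dpol_linear [LHS]big_cons IH; congr (_ + _).
by rewrite 2!big_cons big_nil /= mul0r scale0r !addr0.
Qed.

Lemma cder_cut j t k x : cder j (cut t k) x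
  (cut (t.1, dpol j t.2) k x + cut (t.1.1.+1, dbump t.1.2, (- 2 : R)%:C%C *: (X j * t.2)) k x).
Proof.
have d1 : is_derive x (ebase R j) (fun y => 1 - epsk k * nsq y) (- (epsk k * (2 * x ord0 j))).
  have d := is_derive_nsq j x; apply: is_derive_eq.
  by rewrite /GRing.scale /=; ring.
have d2 := is_derive_compR d1 (is_derive_bump t.1.2 _).
have d3 : cder j (fun y => (epsk k ^+ t.1.1 * bump t.1.2 (1 - epsk k * nsq y))%:C%C) x
    (epsk k ^+ t.1.1 * (bump (dbump t.1.2) (1 - epsk k * nsq x) * - (epsk k * (2 * x ord0 j))))%:C%C.
  split => /=; last exact: is_derive_cst.
  by apply: is_derive_eq; rewrite /GRing.scale /=; ring.
apply: (cder_eq (cderM d3 (cder_ev M h j t.2 x))).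
rewrite /cut /= addrC; congr (_ + _); rewrite evZ evX.
rewrite [RHS]mulrA [RHS]mulrA -[in RHS]rmorphM -[in RHS]rmorphM /=.
by congr (_%:C%C * _); rewrite exprS; ring.
Qed.

Lemma cder_cuts j s k x : cder j (cuts s k) x (cuts (cutD j s) k x).
Proof.
have -> : cuts (cutD j s) k x = \sum_(t <- s)
    (cut (t.1, dpol j t.2) k x + cut (t.1.1.+1, dbump t.1.2, (- 2 : R)%:C%C *: (X j * t.2)) k x).
  rewrite /cuts /cutD big_flatten big_map; apply: eq_bigr => t _.
  by rewrite !big_cons big_nil /= addr0.
by apply: cder_sum => t; exact: cder_cut.
Qed.

Lemma cutsD j s k : partialC j (cuts s k) = cuts (cutD j s) k.
Proof. by apply/funext => x; apply: cder_partial; exact: cder_cuts. Qed.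

Lemma ccont_cuts s k : ccont (cuts s k).
Proof.
apply: ccont_sum => t; apply: ccontM; last exact: ccont_ev.
split => /= x; last exact: cst_continuous.
have e1 (c : R) : continuous (fun _ : 'rV[R]_n => c) by exact: cst_continuous.
have b1 := continuousB (e1 1 x) (continuousM (e1 (epsk k) x) (@cont_nsq x)).
exact: (continuousM (e1 _ x) (continuous_comp b1 (@continuous_bump R t.1.2 _))).
Qed.

Lemma cmeas_cuts s k : cmeas (cuts s k).
Proof.
apply: cmeas_sum => t; apply: cmeasM; last exact: cmeas_ev.
apply: cmeasR; apply: measurable_funM; first exact: measurable_cst.
apply: (measurableT_comp (f := bump t.1.2)).
  by apply: continuous_measurable_fun; exact: continuous_bump.
apply: measurable_funB; first exact: measurable_cst.
by apply: measurable_funM; [exact: measurable_cst|exact: measurable_nsq].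
Qed.

Lemma Ck_cuts m s k : Ck m (fun x => complex.Re (cuts s k x)) /\
  Ck m (fun x => complex.Im (cuts s k x)).
Proof.
elim: m s => [|m IH] s; first exact: ccont_cuts.
have [c1 c2] := ccont_cuts s k; split; split => // j; split.
- by move=> x; have [d1 _] := cder_cuts j s k x; exact: ex_derive.
- rewrite (_ : (fun x => _) = fun x => complex.Re (cuts (cutD j s) k x)); first exact: (IH _).1.
  by apply/funext => x; have [d1 _] := cder_cuts j s k x; rewrite derive_val.
- by move=> x; have [_ d1] := cder_cuts j s k x; exact: ex_derive.
- rewrite (_ : (fun x => _) = fun x => complex.Im (cuts (cutD j s) k x)); first exact: (IH _).2.
  by apply/funext => x; have [_ d1] := cder_cuts j s k x; rewrite derive_val.
Qed.

(** The cutoff vanishes unless |x|^2 < k + 1, and then |x_i| <= k + 1, so the support lies in a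
    compact cube. *)
Lemma test_cuts s k : test_function (cuts s k).
Proof.
split; [by move=> m; exact: (Ck_cuts m s k).1|by move=> m; exact: (Ck_cuts m s k).2|].
pose K := [set x : 'rV[R]_n | forall i, `[- (k.+1%:R : R), k.+1%:R]%classic (x ord0 i)].
have cK : compact K by apply: (@rV_compact R n (fun=> `[- (k.+1%:R : R), k.+1%:R]%classic)) => i; exact: segment_compact.
have clK : closed K by apply: compact_closed => //; exact: norm_hausdorff.
apply: (subclosed_compact _ cK); first exact: closed_closure.
rewrite (closure_id K).1//; apply: closure_subset => x /= xn0 i.
have H : 0 < 1 - epsk k * nsq x.
  apply: contraNT xn0 => H; apply/eqP; rewrite /cuts big1// => t _.
  by rewrite /cut /bump (negbTE H) mulr0 mul0r.
rewrite /= in_itv /= -ler_norml.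
have k0 : 0 < k.+1%:R :> R by rewrite ltr0n.
have H1 : nsq x <= k.+1%:R.
  by move: H; rewrite subr_gt0 /epsk ltr_pdivrMl// mulr1 => /ltW.
have H2 : x ord0 i ^+ 2 <= nsq x.
  by rewrite /nsq (bigD1 i)//= lerDl sumr_ge0// => l _; exact: sqr_ge0.
rewrite -(@ler_pXn2r _ 2)// ?nnegrE// real_normK ?num_real//.
apply: (le_trans H2); apply: (le_trans H1).
by rewrite expr2 ler_peMr// ?ler1n// ltW.
Qed.

Lemma cuts_bound s : exists C e, [/\ 0 <= C, 0 < e &
  forall k x, Normc.normc (cuts s k x) <= C * expR (- e * nsq x)].
Proof.
elim: s => [|t s [C1 [e1 [C10 e10 H1]]]].
  by exists 0, 1; split=> // k x; rewrite /cuts big_nil Normc.normc0 mul0r.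
have [C2 [e2 [C20 e20 H2]]] := ev_decay MT Mpos h0 t.2.
have [B B0 HB] := bump_bounded t.1.2.
pose e := Num.min e1 e2; have e0 : 0 < e by rewrite lt_min e10.
have G f x : e <= f -> expR (- f * nsq x) <= expR (- e * nsq x).
  by move=> ef; rewrite ler_expR ler_wpM2r ?nsq_ge0// lerN2.
exists (B * C2 + C1), e; split => //; first by rewrite addr_ge0// mulr_ge0.
move=> k x; rewrite /cuts big_cons (le_trans (le_normcD _ _))// mulrDl lerD//; last first.
  by apply: (le_trans (H1 k x)); apply: ler_wpM2l => //; apply: G; rewrite ge_min lexx.
rewrite Normc.normcM -mulrA; apply: ler_pM; rewrite ?normc_ge0//; last first.
  by apply: (le_trans (H2 x)); apply: ler_wpM2l => //; apply: G; rewrite ge_min lexx orbT.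
rewrite /= expr0n /= addr0 sqrtr_sqr normrM; apply: le_trans (HB (1 - epsk k * nsq x)).
rewrite ler_piMl// normrX exprn_ile1// ger0_norm ?invr_ge0//.
by rewrite invf_le1 ?ltr0n// ler1n.
Qed.

Lemma cuts_cvg s x : ccvg (cuts s ^~ x) (ev (cut_lim s) x).
Proof.
rewrite /cut_lim ev_sum; apply: ccvg_sum => t; rewrite evZ.
apply: ccvgM; last exact: ccvg_cst.
apply: ccvgR; have E : epsk k @[k --> \oo] --> (0 : R) by exact: cvg_harmonic.
apply: cvgM.
  elim: t.1.1 => [|m IH]; first by apply: cvg_cst.
  rewrite (_ : (_ == _)%:R = 0 * (m == 0%N)%:R); last by rewrite mul0r.
  by under eq_fun do rewrite exprS; exact: (cvgM E IH).
apply: continuous_cvg; first exact: continuous_bump.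
rewrite -[Y in _ --> Y]subr0; apply: cvgB; first exact: cvg_cst.
rewrite -[Y in _ --> Y](mul0r (nsq x)); apply: cvgMr_tmp; exact: E.
Qed.

Definition pair (u : 'rV[R]_n -> R[i]) r : R[i] := cint lam (fun x => u x * ev r x).

Lemma pair_linear u c p r : sqint lam u -> pair u (c *: p + r) = c * pair u p + pair u r.
Proof.
move=> su; have I q : cintg lam (fun x => u x * ev q x).
  by apply: sqint_prod => //; exact: sqint_ev.
rewrite /pair -cintZ// -cintD//; last exact: cintgZ.
by congr cint; apply/funext => x; rewrite evZD mulrDr mulrCA.
Qed.

Lemma pair_cuts u s : sqint lam u ->
  ccvg (fun k => distr_of u (cuts s k)) (pair u (cut_lim s)).
Proof.
move=> [mu' iu]; have [C [e [C0 e0 H]]] := cuts_bound s.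
have e2 : 0 < 2 * e by rewrite mulr_gt0.
pose g x := sqc (u x) + C ^+ 2 * expR (- (2 * e) * nsq x).
have ig : intg lam g by apply: intgD => //; apply: intgZ; exact: gauss_intg.
have L x : ccvg (fun k => u x * cuts s k x) (u x * ev (cut_lim s) x).
  by apply: ccvgZ; exact: cuts_cvg.
have [||||_ L1 L2] := @cint_dct _ _ R lam (fun k x => u x * cuts s k x)
  (fun x => u x * ev (cut_lim s) x) g _ _ _ ig _ => //.
- by move=> k; apply: cmeasM => //; exact: cmeas_cuts.
- by move=> x; have [] := L x.
- by move=> x; have [] := L x.
- move=> k x; rewrite Normc.normcM /g -normc_sqr.
  rewrite (_ : - (2 * e) * nsq x = - e * nsq x + - e * nsq x); last by ring.
  rewrite expRD -expr2 -exprMn.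
  have a0 := normc_ge0 (u x); have b0 := normc_ge0 (cuts s k x).
  have := H k x; set c := C * _ => bc.
  by have := sqr_ge0 (Normc.normc (u x) - c); nra.
Qed.

(** Elements of Pol are not test functions: the identity is used on cutoffs, whose x_j- and
    d_j-images are cutoffs again, and each pairing converges by a Gaussian majorant independent of
    k. The limit is then regrouped into T. *)
Lemma weyl_pairing q u f p : (polar_mx q)^T = polar_mx q ->
  sqint lam u -> sqint lam f ->
  (forall phi, test_function phi -> weyl q h (distr_of u) phi = distr_of f phi) ->
  pair f p = pair u (Tq (Lp M h) (polar_mx q) p).
Proof.
move=> Qs su sf H; set Q := polar_mx q in Qs *.
pose w := h%:C%C / ii; pose D k s := distr_of u (cuts s k).
(* The constant e normalizes the cutoff: its value at argument 1 is e exp (-1) = 1. *)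
pose s0 : seq item := [:: (0%N, (expR 1)%:P, p)].
have lim0 : cut_lim s0 = p.
  rewrite /cut_lim big_seq1 /= mul1r /bump ltr01 hornerC invr1 -expRD subrr expR0.
  by rewrite scale1r.
have E k : \sum_j \sum_l
    (ulsubmx Q j l * D k (cutX l (cutX j s0))
     + drsubmx Q j l * (w * - (w * - D k (cutD l (cutD j s0))))
     + (ursubmx Q j l *+ 2) * ((w * - D k (cutD l (cutX j s0))
        + w * - D k (cutX j (cutD l s0))) / 2)) = distr_of f (cuts s0 k).
  rewrite -H; last exact: test_cuts.
  rewrite /weyl; apply: eq_bigr => j _; apply: eq_bigr => l _.
  have fX i s : (fun x => (x ord0 i)%:C%C * cuts s k x) = cuts (cutX i s) k.
    by apply/funext => x; rewrite cutsX.
  have fXX i i' s : (fun x => (x ord0 i)%:C%C * ((x ord0 i')%:C%C * cuts s k x)) =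
      cuts (cutX i (cutX i' s)) k.
    by apply/funext => x; rewrite !cutsX.
  by rewrite /mulx /hD -/w /D fXX !(cutsD, fX).
pose U := pair u.
have L : ccvg (fun k => distr_of f (cuts s0 k)) (\sum_j \sum_l
    (ulsubmx Q j l * U (X l * (X j * p))
     + drsubmx Q j l * (w * - (w * - U (dpol l (dpol j p))))
     + (ursubmx Q j l *+ 2) * ((w * - U (dpol l (X j * p))
        + w * - U (X j * dpol l p)) / 2))).
  have P s : ccvg (fun k => D k s) (U (cut_lim s)) by exact: pair_cuts.
  under eq_fun do rewrite -E.
  apply: ccvg_sum => j; apply: ccvg_sum => l.
  have P1 := P (cutX l (cutX j s0)); have P2 := P (cutD l (cutD j s0)).
  have P3 := P (cutD l (cutX j s0)); have P4 := P (cutX j (cutD l s0)).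
  rewrite !cut_limX lim0 in P1; rewrite !cut_limD lim0 in P2.
  rewrite cut_limD cut_limX lim0 in P3; rewrite cut_limX cut_limD lim0 in P4.
  apply: ccvgD; first apply: ccvgD.
  - exact: (ccvgZ _ P1).
  - by apply: ccvgZ; apply: ccvgZ; apply: ccvgN; apply: ccvgZ; exact: (ccvgN P2).
  - apply: ccvgZ; apply: ccvgM; last exact: ccvg_cst.
    by apply: ccvgD; apply: ccvgZ; [exact: (ccvgN P3)|exact: (ccvgN P4)].
have := pair_cuts s0 sf; rewrite lim0 => L'.
rewrite (ccvg_unique L' L) -[pair u _]/(U _).
have UL c a b : U (c *: a + b) = c * U a + U b by exact: pair_linear.
have U0 : U 0 = 0.
  by have := UL 1 0 0; rewrite scale1r mul1r addr0 => /eqP; rewrite -subr_eq0 opprD addrA subrr sub0r oppr_eq0 => /eqP.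
have UD a b : U (a + b) = U a + U b by have := UL 1 a b; rewrite scale1r mul1r.
have UZ c a : U (c *: a) = c * U a by have := UL c a 0; rewrite U0 !addr0.
have Usum (G : 'I_(n + n) -> Pol) : U (\sum_a G a) = \sum_a U (G a).
  exact: (big_morph U UD U0).
have -> : U (Tq (Lp M h) Q p) =
    \sum_a \sum_b Q a b * U (Lp M h a (Lp M h b p)).
  by rewrite /Tq Usum; apply: eq_bigr => a _; rewrite Usum; apply: eq_bigr => b _; rewrite UZ.
have wE : w = - (ii * h%:C%C).
  have i0 : ii != 0 by rewrite eq_complex /= oner_eq0 andbF.
  by apply: (canLR (mulfK i0)); rewrite mulNr mulrAC -expr2 sqr_i mulN1r opprK.
rewrite big_split_ord /=.
have Qt a b : Q a b = Q b a by rewrite -{1}Qs mxE.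
have LX i r : Lp M h (lshift n i) r = X i * r by rewrite /Lp (unsplitK (inl _)).
have LD i r : Lp M h (rshift n i) r = (ii * h%:C%C) *: dpol i r.
  by rewrite /Lp (unsplitK (inr _)).
have dpolZ i c r : dpol i (c *: r) = c *: dpol i r.
  by have := dpol_linear M h i c r 0; rewrite dpol0 !addr0.
transitivity (\sum_j \sum_l (ulsubmx Q j l * U (X l * (X j * p)))
   + \sum_j \sum_l (drsubmx Q j l * ((ii * h%:C%C) ^+ 2 * U (dpol l (dpol j p))))
   + (\sum_j \sum_l (ursubmx Q j l * (ii * h%:C%C * U (dpol l (X j * p))))
   + \sum_j \sum_l (ursubmx Q j l * (ii * h%:C%C * U (X j * dpol l p))))).
  rewrite -!big_split /=; apply: eq_bigr => j _.
  rewrite -!big_split /=; apply: eq_bigr => l _; rewrite wE.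
  by apply: weyl_weights; rewrite pnatr_eq0.
(* The mixed Weyl coefficient is shared by the upper right and lower left blocks of Q, equal by
   symmetry: one multiplies x D, the other D x. *)
have shuffle (a b c e : R[i]) : a + b + (c + e) = (a + e) + (c + b)
  by rewrite [c + e]addrC addrACA [b + c]addrC.
rewrite shuffle; congr (_ + _); rewrite -?[in RHS]big_split /=.
  rewrite -big_split /=; apply: eq_bigr => j _; rewrite [RHS]big_split_ord /=.
  apply: (f_equal2 +%R); apply: eq_bigr => l _; rewrite !mxE.
    by rewrite !LX mulrCA.
  by rewrite LX LD -scalerAr UZ.
rewrite [Y in Y + _ = _]exchange_big /= -big_split /=; apply: eq_bigr => j _; rewrite [RHS]big_split_ord /=.
apply: (f_equal2 +%R); apply: eq_bigr => l _.
  by rewrite [ursubmx _ _ _]mxE [usubmx _ _ _]mxE LX LD UZ Qt.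
rewrite [drsubmx _ _ _]mxE [dsubmx _ _ _]mxE.
by rewrite !LD dpolZ !UZ dpolC expr2 -[_ * _ * U _]mulrA.
Qed.

End cutoff.

(** * Density in L^2 *)

Section density.
Variables (R : realType) (n : nat) (M : 'M[R[i]]_n) (h : R).
Local Notation Pol := (mpoly.mpoly n R[i]).
Local Notation X i := (mpolyX R[i] (mnm1 i)).
Local Notation lam := (lebesgue_Rn R n).
Local Notation ev := (ev M h).
Local Notation sqint := (sqint lam).
Hypothesis MT : M^T = M.
Hypothesis Mpos : forall x : 'rV[R]_n, x != 0 -> 0 < qf (map_mx (@complex.Re R) M) x.
Hypothesis h0 : 0 < h.
Implicit Types (p r : Pol) (x : 'rV[R]_n) (u v w : 'rV[R]_n -> R[i]).
Implicit Types (m : 'rV[R]_n -> R) (E : set 'rV[R]_n).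

Lemma quarter_le (a b e : R) : a <= e / 4 -> b <= e / 4 -> 2 * a + 2 * b <= e.
Proof. lra. Qed.

Definition sqmass u : R := Rintegral lam setT (fun x => sqc (u x)).

Lemma sqmassD u v : sqint u -> sqint v ->
  sqmass (fun x => u x + v x) <= 2 * sqmass u + 2 * sqmass v.
Proof.
move=> su sv; have [_ iuv] := sqintD su sv.
have [_ iu] := su; have [_ iv] := sv.
rewrite /sqmass -!RintZ// -RintD; [|exact: intgZ..].
apply: Rint_le => //; first by apply: intgD; exact: intgZ.
by move=> x; exact: sqcD_le.
Qed.

Lemma sqintB u v : sqint u -> sqint v -> sqint (fun x => u x - v x).
Proof.
move=> su sv; have := sqintD su (sqintZ (-1) sv).
by congr sqint; apply/funext => x; rewrite mulN1r.
Qed.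

Definition approx v := sqint v /\
  forall e, 0 < e -> exists p, sqmass (fun x => v x - ev p x) <= e.

Lemma approx_ev p : approx (ev p).
Proof.
split=> [|e e0]; first exact: sqint_ev.
exists p; rewrite /sqmass (_ : (fun x => _) = fun=> 0) ?Rint0 ?ltW//.
by apply/funext => x; rewrite subrr /sqc /= expr0n addr0.
Qed.

Lemma approx_closed v : sqint v ->
  (forall e, 0 < e -> exists2 w, approx w & sqmass (fun x => v x - w x) <= e) -> approx v.
Proof.
move=> sv H; split=> // e e0; have e4 : 0 < e / 4 by rewrite divr_gt0.
have [w [sw wp] vw] := H _ e4; have [p wpe] := wp _ e4; exists p.
have := sqmassD (sqintB sv sw) (sqintB sw (sqint_ev MT Mpos h0 p)).
rewrite (_ : (fun x => _ + _) = fun x => v x - ev p x); last first.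
  by apply/funext => x; rewrite addrA subrK.
by move/le_trans; apply; exact: quarter_le vw wpe.
Qed.

Lemma approxD v w : approx v -> approx w -> approx (fun x => v x + w x).
Proof.
move=> [sv vp] [sw wp]; split=> [|e e0]; first exact: sqintD.
have e4 : 0 < e / 4 by rewrite divr_gt0.
have [p vpe] := vp _ e4; have [r wre] := wp _ e4; exists (p + r).
have := sqmassD (sqintB sv (sqint_ev MT Mpos h0 p)) (sqintB sw (sqint_ev MT Mpos h0 r)).
rewrite (_ : (fun x => _ + _) = fun x => v x + w x - ev (p + r) x); last first.
  by apply/funext => x; rewrite evD opprD addrACA.
by move/le_trans; apply; exact: quarter_le vpe wre.
Qed.

Lemma sqmassZ c v : sqint v -> sqmass (fun x => c * v x) = sqc c * sqmass v.
Proof.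
move=> [_ iv]; rewrite /sqmass -RintZ//; congr Rintegral.
by apply/funext => x; rewrite sqcM.
Qed.

Lemma approxZ c v : approx v -> approx (fun x => c * v x).
Proof.
move=> [sv vp]; split=> [|e e0]; first exact: sqintZ.
have c0 : 0 < sqc c + 1 by rewrite ltr_wpDl// sqc_ge0.
have [p H] := vp (e / (sqc c + 1)) (divr_gt0 e0 c0); exists (c *: p).
rewrite (_ : (fun x => _) = fun x => c * (v x - ev p x)); last first.
  by apply/funext => x; rewrite evZ mulrBr.
rewrite sqmassZ; last by apply: sqintB => //; exact: sqint_ev.
apply: (le_trans (ler_wpM2l (sqc_ge0 _) H)); rewrite mulrCA ler_piMr ?(ltW e0)//.
by rewrite ler_pdivrMr// mul1r lerDl.
Qed.

Lemma cvg_sqc (z : nat -> R[i]) l : ccvg z l -> sqc (z k) @[k --> \oo] --> sqc l.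
Proof. by move=> [z1 z2]; rewrite /sqc; apply: cvgD; rewrite !expr2; exact: cvgM. Qed.

Lemma sqmass_cvg (v_ : nat -> 'rV[R]_n -> R[i]) v (g : 'rV[R]_n -> R) :
  (forall k, cmeas (v_ k)) -> (forall x, ccvg (v_ ^~ x) (v x)) ->
  intg lam g -> (forall k x, sqc (v_ k x) <= g x) ->
  sqint v /\ (sqmass (fun x => v x - v_ k x) @[k --> \oo] --> 0).
Proof.
move=> mv cv ig vg.
have mvl : cmeas v.
  by apply: (cmeas_cvg mv) => x; have [] := cv x.
have vb x : sqc (v x) <= g x.
  have H := cvg_sqc (cv x); rewrite -(cvg_lim _ H)//.
  apply: limr_le; first by apply/cvg_ex; exists (sqc (v x)).
  by apply: nearW => k; exact: vg.
have sv : sqint v.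
  split=> //; apply: (intg_le _ ig); first exact: cmeas_sqc.
  by move=> x; rewrite ger0_norm ?sqc_ge0.
split=> //.
have [|||_ H] := @Rint_dct _ _ R lam (fun k x => sqc (v x - v_ k x)) (fun=> 0)
  (fun x => 4 * g x) _ _ (intgZ 4 ig) _.
- move=> k; apply: cmeas_sqc; apply: cmeasD => //.
  by have := cmeasZ (-1) (mv k); congr cmeas; apply/funext => x; rewrite mulN1r.
- move=> x; have := cvg_sqc (ccvgD (ccvg_cst (v x)) (ccvgN (cv x))).
  by rewrite subrr /sqc /= expr0n addr0.
- move=> k x; rewrite ger0_norm ?sqc_ge0//; apply: (le_trans (sqcD_le _ _)).
  have -> : sqc (- v_ k x) = sqc (v_ k x) by rewrite /sqc ReN ImN !sqrrN.
  apply: (le_trans (lerD (ler_wpM2l (ler0n _ 2) (vb x)) (ler_wpM2l (ler0n _ 2) (vg k x)))).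
  by rewrite -mulrDl -natrD.
- by move: H; rewrite Rint0.
Qed.

Lemma approx_cvg (v_ : nat -> 'rV[R]_n -> R[i]) v (g : 'rV[R]_n -> R) :
  (forall k, approx (v_ k)) -> (forall x, ccvg (v_ ^~ x) (v x)) ->
  intg lam g -> (forall k x, sqc (v_ k x) <= g x) -> approx v.
Proof.
move=> av cv ig vg.
have [|sv L] := sqmass_cvg _ cv ig vg; first by move=> k; have [[]] := av k.
apply: approx_closed => // e e0.
have /cvgr0Pnorm_lt/(_ _ e0) [k _ /(_ k (leqnn k))] := L.
by move=> H; exists (v_ k) => //; apply: (le_trans (ler_norm _)); exact: ltW.
Qed.

(** Bounded multipliers preserving the closure of Pol. They form an algebra stable under bounded
    pointwise limits; sines belong to it, then indicators of half-spaces, of all measurable sets,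
    and finally all bounded measurable functions. *)
Definition mult m := [/\ measurable_fun setT m, exists B, forall x, `|m x| <= B &
  forall v, approx v -> approx (fun x => (m x)%:C%C * v x)].

Lemma sqcR (a : R) (z : R[i]) : sqc (a%:C%C * z) = a ^+ 2 * sqc z.
Proof. by rewrite sqcM; congr (_ * _); rewrite /sqc /= expr0n addr0. Qed.

Lemma sqint_mul m B v : measurable_fun setT m -> (forall x, `|m x| <= B) ->
  sqint v -> sqint (fun x => (m x)%:C%C * v x).
Proof.
move=> mm mB [mv iv]; split; first by apply: cmeasM => //; exact: cmeasR.
apply: (intg_le _ (intgZ (B ^+ 2) iv)).
  by apply: cmeas_sqc; apply: cmeasM => //; exact: cmeasR.
move=> x; rewrite ger0_norm ?sqc_ge0// sqcR ler_wpM2r ?sqc_ge0//.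
rewrite -real_normK ?num_real// ler_pXn2r// ?nnegrE//.
exact: le_trans (mB x).
Qed.

Lemma sqmass_mul m B v : measurable_fun setT m -> (forall x, `|m x| <= B) ->
  sqint v -> sqmass (fun x => (m x)%:C%C * v x) <= B ^+ 2 * sqmass v.
Proof.
move=> mm mB sv; have [_ i1] := sqint_mul mm mB sv; have [_ iv] := sv.
rewrite /sqmass -RintZ//; apply: Rint_le => //; first exact: intgZ.
move=> x; rewrite sqcR ler_wpM2r ?sqc_ge0//.
by rewrite -real_normK ?num_real// ler_pXn2r// ?nnegrE// (le_trans _ (mB x)).
Qed.

Lemma mult_ev m B : measurable_fun setT m -> (forall x, `|m x| <= B) ->
  (forall p, approx (fun x => (m x)%:C%C * ev p x)) -> mult m.
Proof.
move=> mm mB mp; split=> //; first by exists B.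
move=> v [sv vp]; apply: approx_closed; first exact: sqint_mul mB sv.
move=> e e0; have B0 : 0 < B ^+ 2 + 1 by rewrite ltr_wpDl// sqr_ge0.
have [p H] := vp (e / (B ^+ 2 + 1)) (divr_gt0 e0 B0).
exists (fun x => (m x)%:C%C * ev p x) => //.
rewrite (_ : (fun x => _) = fun x => (m x)%:C%C * (v x - ev p x)); last first.
  by apply/funext => x; rewrite mulrBr.
apply: (le_trans (sqmass_mul mm mB (sqintB sv (sqint_ev MT Mpos h0 p)))).
apply: (le_trans (ler_wpM2l (sqr_ge0 _) H)); rewrite mulrCA ler_piMr ?(ltW e0)//.
by rewrite ler_pdivrMr// mul1r lerDl.
Qed.

Lemma mult_cst c : mult (fun=> c).
Proof.
split; [exact: measurable_cst|by exists (`|c|)|] => v; exact: approxZ.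
Qed.

Lemma multD m1 m2 : mult m1 -> mult m2 -> mult (fun x => m1 x + m2 x).
Proof.
move=> [mm1 [B1 b1] a1] [mm2 [B2 b2] a2]; split; first exact: measurable_funD.
  by exists (B1 + B2) => x; apply: (le_trans (ler_normD _ _)); exact: lerD.
move=> v av; have := approxD (a1 _ av) (a2 _ av); congr approx.
by apply/funext => x; rewrite rmorphD mulrDl.
Qed.

Lemma multM m1 m2 : mult m1 -> mult m2 -> mult (fun x => m1 x * m2 x).
Proof.
move=> [mm1 [B1 b1] a1] [mm2 [B2 b2] a2]; split; first exact: measurable_funM.
  by exists (B1 * B2) => x; rewrite normrM ler_pM.
move=> v av; have := a1 _ (a2 _ av); congr approx.
by apply/funext => x; rewrite rmorphM mulrA.
Qed.

Lemma mult_cvg (m_ : nat -> 'rV[R]_n -> R) m B : (forall k, mult (m_ k)) ->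
  (forall x, m_ ^~ x @ \oo --> m x) -> (forall k x, `|m_ k x| <= B) -> mult m.
Proof.
move=> am cm bm.
have mm : measurable_fun setT m.
  have mk k : measurable_fun setT (m_ k) by have [] := am k.
  by apply: (measurable_fun_cvg mk) => x _; exact: cm.
have mB x : `|m x| <= B.
  have H : `|m_ k x| @[k --> \oo] --> `|m x| by apply: cvg_norm; exact: cm.
  rewrite -(cvg_lim _ H)//; apply: limr_le; first by apply/cvg_ex; exists `|m x|.
  by apply: nearW => k.
apply: (mult_ev mm mB) => p; have [mp ip] := sqint_ev MT Mpos h0 p.
apply: (@approx_cvg (fun k x => (m_ k x)%:C%C * ev p x) _ (fun x => B ^+ 2 * sqc (ev p x))).
- by move=> k; have [_ _] := am k; apply; exact: approx_ev.
- by move=> x; apply: ccvgM; [exact: ccvgR|exact: ccvg_cst].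
- exact: intgZ.
- move=> k x; rewrite sqcR ler_wpM2r ?sqc_ge0//.
  by rewrite -real_normK ?num_real// ler_pXn2r// ?nnegrE// (le_trans _ (bm k x)).
Qed.

(** On [0, 1] its iterates tend to 0 below 1/2 and to 1 above, which produces indicator functions
    from polynomials in a multiplier. *)
Definition smooth_step (y : R) : R := 3 * y ^+ 2 - 2 * y ^+ 3.

Lemma smooth_step01 y : 0 <= y <= 1 -> 0 <= smooth_step y <= 1.
Proof.
move=> /andP[y0 y1]; have y2 := sqr_ge0 y; have z2 := sqr_ge0 (1 - y).
by rewrite /smooth_step !exprS expr0; apply/andP; split; nra.
Qed.

Lemma iter_smooth_step01 k y : 0 <= y <= 1 -> 0 <= iter k smooth_step y <= 1.
Proof. by elim: k => //= k IH /IH; exact: smooth_step01. Qed.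

Lemma iter_smooth_step_low (y : R) : 0 <= y < 2^-1 ->
  iter k smooth_step y @[k --> \oo] --> (0 : R).
Proof.
(* This ratio of a step to its argument is less than 1 for y < 1/2, and does not increase along the
   decreasing orbit. *)
move=> /andP[y0 y2]; pose rho := y * (3 - 2 * y).
have r0 : 0 <= rho by rewrite /rho; nra.
have r1 : rho < 1 by rewrite /rho; nra.
have H k : 0 <= iter k smooth_step y <= rho ^+ k * y.
  elim: k => [|k /andP[IH0 IH]] /=; first by rewrite y0 expr0 mul1r lexx.
  set z := iter _ _ _ in IH0 IH *.
  have rk : rho ^+ k <= 1 by rewrite exprn_ile1// ltW.
  have zy : z <= y by apply: (le_trans IH); rewrite ler_piMl.
  have z01 : 0 <= z <= 1 by rewrite IH0 (le_trans zy)//; lra.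
  have /andP[-> _] /= := smooth_step01 z01.
  have -> : smooth_step z = z * (3 - 2 * z) * z by rewrite /smooth_step; ring.
  rewrite exprS -[leRHS]mulrA; apply: ler_pM => //; first by rewrite mulr_ge0//; lra.
  by rewrite /rho; nra.
have S : \forall k \near \oo, (fun=> 0 : R) k <= iter k smooth_step y <= (fun k => rho ^+ k * y) k.
  by apply: nearW => k; exact: H.
apply: (squeeze_cvgr S); first exact: cvg_cst.
rewrite -[Y in _ --> Y](mul0r y); apply: cvgMr_tmp; apply: cvg_expr.
by rewrite ger0_norm.
Qed.

Lemma iter_smooth_step_high (y : R) : 2^-1 < y <= 1 ->
  iter k smooth_step y @[k --> \oo] --> (1 : R).
Proof.
move=> /andP[y2 y1]; have H : 0 <= 1 - y < 2^-1 by apply/andP; split; lra.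
have E k : iter k smooth_step y = 1 - iter k smooth_step (1 - y).
  elim: k => [|k IH] /=; first by rewrite subKr.
  by rewrite IH /smooth_step; move: (iter _ _ _) => z; ring.
under eq_fun do rewrite E.
have := cvgB (cvg_cst (1 : R)) (iter_smooth_step_low H); rewrite subr0; exact.
Qed.

Lemma iter_smooth_step_half k : iter k smooth_step 2^-1 = 2^-1.
Proof. by elim: k => //= k ->; rewrite /smooth_step !exprS expr0; field. Qed.

(** The steps are iterated from (1 + m) / 2. Where m = 0 the orbit stays at 1/2, so the limit takes
    the values 0, 1/2, 1; its powers then send 1/2 to 0. *)
Lemma mult_pos m : mult m -> (forall x, `|m x| <= 1) ->
  mult (fun x => if 0 < m x then 1 else 0).
Proof.
move=> am m1.
have mstep f : mult f -> mult (fun x => smooth_step (f x)).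
  move=> mf; have mf2 := multM mf mf; have mf3 := multM mf mf2.
  have := multD (multM (mult_cst 3) mf2) (multM (mult_cst (-2)) mf3).
  by congr mult; apply/funext => x; rewrite /smooth_step; ring.
have m01 x : 0 <= 2^-1 * (1 + m x) <= 1.
  by have := m1 x; rewrite ler_norml => /andP[? ?]; apply/andP; split; lra.
pose f k x := iter k smooth_step (2^-1 * (1 + m x)).
have af k : mult (f k).
  elim: k => [|k IH]; last exact: mstep IH.
  exact: multM (mult_cst _) (multD (mult_cst 1) am).
pose g x : R := if 0 < m x then 1 else if m x == 0 then 2^-1 else 0.
have ag : mult g.
  apply: (mult_cvg (B := 1) af) => [x|k x]; last first.
    by have /andP[f0 f1] := iter_smooth_step01 k (m01 x); rewrite ger0_norm.
  rewrite /g /f; have := m01 x; have [m0|m0|m0] := ltgtP 0 (m x) => /andP[c1 c2].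
  - by apply: iter_smooth_step_high; apply/andP; split; lra.
  - by apply: iter_smooth_step_low; apply/andP; split; lra.
  - by rewrite -m0 addr0 mulr1; under eq_fun do rewrite iter_smooth_step_half; exact: cvg_cst.
have ax k : mult (fun x => g x ^+ k).
  elim: k => [|k IH]; first exact: (mult_cst 1).
  by under eq_fun do rewrite exprS; exact: multM.
apply: (mult_cvg (B := 1) ax) => [x|k x].
- rewrite /g; case: ifP => _; first by under eq_fun do rewrite expr1n; exact: cvg_cst.
  case: ifP => _; apply: cvg_expr; last by rewrite normr0.
  by rewrite ger0_norm// invf_lt1// ltr1n.
- have : 0 <= g x <= 1.
    rewrite /g; case: ifP => _; first by rewrite ler01 lexx.
    by case: ifP => _; rewrite ?lexx ?ler01// invr_ge0 ler0n invf_le1// ler1n.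
  by move=> /andP[g0 g1]; rewrite ger0_norm ?exprn_ge0// exprn_ile1.
Qed.

Lemma sin_partial_bound (y : R) k : `|series (sin_coeff y) k| <= expR `|y|.
Proof.
apply: (@le_trans _ _ (series (exp_coeff `|y|) k)).
  apply: (le_trans (ler_norm_sum _ _ _)); apply: ler_sum => i _.
  rewrite /sin_coeff /exp_coeff /= !normrM normfV !normr_nat normrX.
  rewrite ler_wpM2r// [`|y ^+ i|]normrX ler_piMl ?exprn_ge0//.
  by rewrite normrN1 expr1n mulr1; case: (odd i).
rewrite /expR.
apply: nondecreasing_cvgn_le; last exact: is_cvg_series_exp_coeff.
apply: nondecreasing_series => i _ _.
by rewrite /exp_coeff /= divr_ge0// exprn_ge0.
Qed.

Lemma pev_exp p x k : pev (p ^+ k) x = pev p x ^+ k.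
Proof. by elim: k => [|k IH]; rewrite ?expr0 -?mpolyC1 ?pevC// !exprS pevM IH. Qed.

(** The Taylor sums of the sine are polynomials, so their products with elements of Pol stay in Pol;
    they are dominated by exp |t (x_j - a)|, which part of the Gaussian absorbs. *)
Lemma mult_sin (t a : R) j : mult (fun x => sin (t * (x ord0 j - a))).
Proof.
have mlin : measurable_fun setT (fun x : 'rV[R]_n => t * (x ord0 j - a)).
  apply: measurable_funM; first exact: measurable_cst.
  by apply: measurable_funB; [exact: measurable_row_coord|exact: measurable_cst].
have msin : measurable_fun setT (@sin R).
  by apply: continuous_measurable_fun; exact: continuous_sin.
apply: (@mult_ev _ 1) => [|x|p]; first exact: (measurableT_comp msin mlin).
  by rewrite ler_norml sin_le1 sin_geN1.
pose lin : Pol := t%:C%C *: (X j - mpolyC n a%:C%C).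
have elin x : pev lin x = (t * (x ord0 j - a))%:C%C.
  rewrite /lin pevZ pevD pevX -[- mpolyC n _]/(- (mpolyC n _)) -mpolyCN pevC.
  by rewrite rmorphM rmorphB.
pose S k : Pol := \sum_(0 <= i < k) (sin_coeff 1 i)%:C%C *: lin ^+ i.
have eS k x : ev (S k * p) x = (series (sin_coeff (t * (x ord0 j - a))) k)%:C%C * ev p x.
  rewrite /ev pevM -mulrA; congr (_ * _).
  rewrite /S pev_sum /series /= rmorph_sum; apply: eq_bigr => i _.
  by rewrite pevZ pev_exp elin -rmorphXn -rmorphM /= !sin_coeffE /= expr1n mulr1.
have [C [e [C0 e0 H]]] := ev_decay MT Mpos h0 p.
(* From |t| |x_j| <= e x_j^2 / 2 + t^2 / (2e), by completing the square: half of the rate e is spent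
   on the sine. *)
have [c0 c0E] : exists c0, c0 = `|t| * `|a| + t ^+ 2 / (2 * e) by exists (`|t| * `|a| + t ^+ 2 / (2 * e)).
apply: (@approx_cvg (fun k => ev (S k * p)) _ (fun x => (C * expR c0) ^+ 2 * expR (- e * nsq x))).
- by move=> k; exact: approx_ev.
- move=> x; under eq_fun do rewrite eS.
  apply: ccvgM; last exact: ccvg_cst.
  by apply: ccvgR; rewrite sin.unlock; exact: is_cvg_series_sin_coeff.
- by apply: intgZ; exact: gauss_intg.
- move=> k x; rewrite eS sqcR -normc_sqr -exprMn.
  rewrite (_ : - e * nsq x = - (e / 2) * nsq x + - (e / 2) * nsq x); last by field.
  rewrite expRD -expr2 -exprMn -real_normK ?num_real//.
  rewrite ler_pXn2r ?nnegrE ?mulr_ge0 ?expR_ge0//.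
  rewrite normrM [`|Normc.normc _|]ger0_norm ?normc_ge0//.
  apply: (le_trans (ler_pM (normr_ge0 _) (normc_ge0 _) (sin_partial_bound _ _) (H x))).
  rewrite mulrCA -mulrA; apply: ler_wpM2l => //; rewrite -!expRD ler_expR.
  have xs : x ord0 j ^+ 2 <= nsq x.
    by rewrite /nsq (bigD1 j)//= lerDl sumr_ge0// => l _; exact: sqr_ge0.
  have : `|t * (x ord0 j - a)| <= `|t| * `|x ord0 j| + `|t| * `|a|.
    by rewrite normrM -mulrDr ler_wpM2l// ler_normB.
  have : `|t| * `|x ord0 j| <= e / 2 * nsq x + t ^+ 2 / (2 * e).
    apply: (@le_trans _ _ (e / 2 * x ord0 j ^+ 2 + t ^+ 2 / (2 * e))); last first.
      by rewrite lerD2r ler_wpM2l// divr_ge0// ltW.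
    rewrite -[x ord0 j ^+ 2]real_normK ?num_real// -[t ^+ 2]real_normK ?num_real//.
    rewrite -subr_ge0 (_ : _ - _ = (e * `|x ord0 j| - `|t|) ^+ 2 / (2 * e)).
      by rewrite divr_ge0 ?sqr_ge0// mulr_ge0// ltW.
    by field; rewrite gt_eqF.
  rewrite c0E; move: (`|t * _|) (`|t| * `|x ord0 j|) (`|t| * `|a|) (t ^+ 2 / _) (nsq x).
  by move=> b1 b2 b3 b4 b5 K1 K2; lra.
Qed.

(** The sine of (x_j - a) / (k + 1) has the sign of x_j - a once (k + 1) pi > |x_j - a|. *)
Lemma mult_ray (a : R) j : mult (fun x => if a < x ord0 j then 1 else 0).
Proof.
pose f k x := if 0 < sin ((k.+1%:R)^-1 * (x ord0 j - a)) then 1 else 0 : R.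
have af k : mult (f k).
  apply: mult_pos; first exact: mult_sin.
  by move=> x; rewrite ler_norml sin_le1 sin_geN1.
apply: (mult_cvg (B := 1) af) => [x|k x]; last first.
  by rewrite /f; case: ifP; rewrite ?normr1 ?normr0.
apply: cvg_near_cst; near=> k.
set y := x ord0 j - a.
have k0 : 0 < k.+1%:R :> R by rewrite ltr0n.
have yk : `|(k.+1%:R)^-1 * y| < pi.
  rewrite normrM ger0_norm ?invr_ge0// ltr_pdivrMl// -ltr_pdivrMr ?pi_gt0//.
  apply: (lt_le_trans (truncnS_gt _)); rewrite ler_nat ltnS.
  by near: k; exact: nbhs_infty_ge.
rewrite /f -[a < _]subr_gt0 -/y.
have [y0|y0] := ltP 0 y.
  rewrite sin_gt0_pi//; move: yk; rewrite ger0_norm ?mulr_ge0 ?invr_ge0 ?(ltW y0)// => ->.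
  by rewrite mulr_gt0 ?invr_gt0.
rewrite ltNge -oppr_ge0 -sinN sin_ge0_pi//.
have yn : (k.+1%:R)^-1 * y <= 0 by rewrite mulr_ge0_le0 ?invr_ge0.
by move: yk; rewrite ler0_norm// => /ltW ->; rewrite oppr_ge0 yn.
Unshelve. all: by end_near. Qed.

Definition msets : set (set 'rV[R]_n) := [set E | mult (fun x => \1_E x)].

Lemma msets_sigma_algebra : sigma_algebra setT msets.
Proof.
split.
- have := mult_cst 0; congr mult; apply/funext => x.
  by rewrite indicE in_set0.
- move=> A mA; have := multD (mult_cst 1) (multM (mult_cst (-1)) mA).
  congr mult; apply/funext => x; rewrite setTD !indicE in_setC.
  by case: (x \in A); rewrite /= ?mulr1 ?mulr0 ?addr0 ?addrN.
- move=> F mF.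
  pose f k x : R := \prod_(i < k) (1 - \1_(F i) x).
  have af k : mult (f k).
    elim: k => [|k IH].
      by have := mult_cst 1; congr mult; apply/funext => x; rewrite /f big_ord0.
    have := multM IH (multD (mult_cst 1) (multM (mult_cst (-1)) (mF k))).
    by congr mult; apply/funext => x; rewrite /f big_ord_recr /= mulN1r.
  have ag k : mult (fun x => 1 + -1 * f k x).
    exact: multD (mult_cst 1) (multM (mult_cst (-1)) (af k)).
  apply: (mult_cvg (B := 1) ag) => [x|k x].
    rewrite indicE; case: (boolP (x \in _)) => [|xF].
      rewrite inE => -[i _ Fi]; apply: cvg_near_cst; near=> k.
      have ik : (i < k)%N by near: k; exact: nbhs_infty_gt.
      rewrite /f (bigD1 (Ordinal ik))//= indicE mem_set// subrr mul0r mulr0 addr0.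
      by [].
    apply: cvg_near_cst; near=> k; rewrite /f big1 ?mulr1 ?subrr// => i _.
    rewrite indicE memNset ?subr0// => Fi; move: xF; rewrite notin_setE; apply.
    by exists (i : nat).
  have : 0 <= f k x <= 1.
    apply: (big_ind (fun t : R => 0 <= t <= 1)) => [|y z /andP[y0 y1] /andP[z0 z1]|i _].
    - by rewrite ler01 lexx.
    - by rewrite mulr_ge0//= mulr_ile1.
    - by rewrite indicE; case: (_ \in _); rewrite ?subrr ?subr0 ?lexx ?ler01.
  by move=> /andP[f0 f1]; rewrite mulN1r ger0_norm ?subr_ge0// lerBlDr lerDl.
Unshelve. all: by end_near. Qed.

Lemma mult_indic E : measurable E -> mult (fun x => \1_E x).
Proof.
have [s0 sC sU] := msets_sigma_algebra.
suff H j (B : set R) : measurable B -> msets ((fun x : 'rV[R]_n => x ord0 j) @^-1` B).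
  suff : @measurable _ 'rV[R]_n `<=` msets by apply.
  apply: smallest_sub; first exact: msets_sigma_algebra.
  by move=> A; rewrite -bigcup_seq => -[j _ [B mB <-]]; rewrite setTI; exact: H.
suff : measurable `<=` [set B : set R | msets ((fun x : 'rV[R]_n => x ord0 j) @^-1` B)] by apply.
rewrite [measurable]RGenOInfty.measurableE; apply: smallest_sub.
  split => /=.
  - by rewrite preimage_set0.
  - by move=> A /sC; rewrite !setTD preimage_setC.
  - by move=> A /sU; rewrite preimage_bigcup.
move=> _ [a ->] /=; have := mult_ray a j; rewrite /msets /=; congr mult.
apply/funext => x; rewrite indicE; case: ifPn => ax.
  by rewrite mem_set//= in_itv /= andbT.
by rewrite memNset//= in_itv /= andbT; exact/negP.
Qed.

(** Binary expansion: removing the leading digit, 2 f - 1_E with E = {f >= 1/2} again takes values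
    in [0, 1], so after k digits the error is at most 2^-k. *)
Lemma mult01 m : measurable_fun setT m -> (forall x, 0 <= m x <= 1) -> mult m.
Proof.
move=> mm m01.
have H k : forall f : 'rV[R]_n -> R, measurable_fun setT f -> (forall x, 0 <= f x <= 1) ->
    exists g : 'rV[R]_n -> R, [/\ measurable_fun setT g, forall x, 0 <= g x <= 1 &
      mult (fun x => f x - 2^-1 ^+ k * g x)].
  elim: k => [|k IH] f mf f01.
    exists f; split => //; have := mult_cst 0; congr mult; apply/funext => x.
    by rewrite expr0 mul1r subrr.
  pose E := [set x | 2^-1 <= f x]; have mE : measurable E.
    rewrite (_ : E = setT `&` f @^-1` `[2^-1, +oo[%classic); last first.
      by rewrite setTI; apply/seteqP; split=> x /=; rewrite in_itv /= andbT.
    exact: mf.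
  pose f1 x := 2 * f x - \1_E x.
  have [||g [mg g01 ag]] := IH f1.
  - by apply: measurable_funB; [exact: measurable_funM|exact: measurable_indic].
  - move=> x; have := f01 x; rewrite /f1 indicE => /andP[c0 c1].
    by case: (boolP (x \in E)); rewrite ?inE ?notin_setE /E /= => Ex;
      apply/andP; split; move: Ex; try move/negP; rewrite -?ltNge => Ex; lra.
  exists g; split => //.
  have := multM (mult_cst 2^-1) (multD (mult_indic mE) ag).
  by congr mult; apply/funext => x; rewrite /f1 exprS; field.
have /choice[g gP] : forall k, exists g : 'rV[R]_n -> R, [/\ measurable_fun setT g,
    forall x, 0 <= g x <= 1 & mult (fun x => m x - 2^-1 ^+ k * g x)] by move=> k; exact: H.
have half k : 0 <= (2^-1 : R) ^+ k <= 1.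
  by rewrite exprn_ge0 ?invr_ge0//= exprn_ile1 ?invr_ge0// invf_le1// ler1n.
apply: (mult_cvg (m_ := fun k x => m x - 2^-1 ^+ k * g k x) (B := 1)).
- by move=> k; have [] := gP k.
- move=> x; rewrite -[Y in _ --> Y]subr0; apply: cvgB; first exact: cvg_cst.
  have S : \forall k \near \oo, (fun=> 0 : R) k <= 2^-1 ^+ k * g k x <= (fun k => 2^-1 ^+ k) k.
    apply: nearW => k; have [_ /(_ x)/andP[g0 g1] _] := gP k; have /andP[h1 h2] := half k.
    by rewrite mulr_ge0//= ler_piMr.
  apply: (squeeze_cvgr S); first exact: cvg_cst.
  by apply: cvg_expr; rewrite ger0_norm ?invr_ge0// invf_lt1// ltr1n.
- move=> k x; have [_ /(_ x)/andP[g0 g1] _] := gP k; have /andP[h1 h2] := half k.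
  have /andP[m0 m1] := m01 x.
  have : 0 <= 2^-1 ^+ k * g k x by rewrite mulr_ge0.
  have : 2^-1 ^+ k * g k x <= 1 by rewrite mulr_ile1.
  by move: (2^-1 ^+ k * g k x) => z z1 z0; rewrite ler_norml; apply/andP; split; lra.
Qed.

Lemma mult_bounded m B : measurable_fun setT m -> (forall x, `|m x| <= B) -> mult m.
Proof.
move=> mm mB; pose c := `|B| + 1.
have c0 : 0 < c by rewrite ltr_wpDl.
have Bc x : `|m x| <= c by apply: (le_trans (mB x)); rewrite /c (le_trans (ler_norm _))// lerDl.
have H : mult (fun x => (2 * c)^-1 * (m x + c)).
  apply: mult01 => [|x].
    by apply: measurable_funM => //; exact: measurable_funD.
  have := Bc x; rewrite ler_norml => /andP[b1 b2].
  rewrite mulr_ge0 ?invr_ge0 ?mulr_ge0 ?(ltW c0)//=; last by lra.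
  by rewrite ler_pdivrMl ?mulr_gt0// mulr1; lra.
have := multD (multM (mult_cst (2 * c)) H) (mult_cst (- c)).
congr mult; apply/funext => x; rewrite mulVKf ?addrK//.
by rewrite gt_eqF// mulr_gt0.
Qed.

Lemma cexpN (z : R[i]) : cexp z * cexp (- z) = 1.
Proof.
apply/eqP; rewrite eq_complex ReM ImM /= ReN ImN cosN sinN.
have E : expR (complex.Re z) * expR (- complex.Re z) = 1 by rewrite -expRD subrr expR0.
move: (complex.Re z) (complex.Im z) E => a b E.
apply/andP; split; apply/eqP; last by ring.
transitivity (expR a * expR (- a) * (cos b ^+ 2 + sin b ^+ 2)); first by ring.
by rewrite cos2Dsin2 mulr1.
Qed.

Definition clamp (c t : R) : R := Num.max (- c) (Num.min c t).

Lemma clamp_le c t : 0 <= c -> `|clamp c t| <= c /\ `|clamp c t| <= `|t|.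
Proof.
move=> c0; rewrite /clamp /Num.max /Num.min.
case: (ltP c t) => ct; case: ltP => ct2.
- by rewrite !ger0_norm//; [split=> //; exact: ltW|lra].
- by rewrite normrN !ger0_norm//; [split=> //; exact: ltW|lra].
- by split => //; rewrite ler_norml (ltW ct2).
- by rewrite normrN (ger0_norm c0) ler0_norm; [split => //|]; lra.
Qed.

Lemma clamp_cvg t : clamp k%:R t @[k --> \oo] --> t.
Proof.
apply: cvg_near_cst; near=> k.
have : `|t| < k%:R.
  apply: (lt_le_trans (truncnS_gt _)); rewrite ler_nat; near: k; exact: nbhs_infty_ge.
rewrite ltr_norml /clamp /Num.max /Num.min => /andP[t1 t2].
by rewrite [_ < t]ltNge (ltW t2) /= t1.
Unshelve. all: by end_near. Qed.

(** The Gaussian v0 never vanishes, so v = q v0 with q measurable. Truncating the real and imaginary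
    parts of q gives bounded multipliers, and the truncated products are dominated by |v|. *)
Lemma approx_all v : sqint v -> approx v.
Proof.
move=> sv; have [mv iv] := sv.
pose q x := v x * cexp (- pev (quadp M h) x).
have mq : cmeas q.
  apply: cmeasM => //; apply: cmeas_cexp.
  by have := cmeasZ (-1) (cmeas_pev (quadp M h)); congr cmeas; apply/funext => x; rewrite mulN1r.
pose v0 := ev (mpolyC n 1).
have qv0 x : v x = q x * v0 x.
  by rewrite /q /v0 /ev pevC mul1r /gss -mulrA [cexp (- _) * _]mulrC cexpN mulr1.
pose rk k x := clamp k%:R (complex.Re (q x)); pose ik k x := clamp k%:R (complex.Im (q x)).
have mclamp k (f : 'rV[R]_n -> R) : measurable_fun setT f -> measurable_fun setT (fun x => clamp k%:R (f x)).
  by move=> mf; apply: measurable_maxr => //; exact: measurable_minr.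
have ar k : mult (rk k).
  by apply: (@mult_bounded _ k%:R) => [|x]; [apply: mclamp; exact: mq.1|exact: (clamp_le _ (ler0n _ _)).1].
have ai k : mult (ik k).
  by apply: (@mult_bounded _ k%:R) => [|x]; [apply: mclamp; exact: mq.2|exact: (clamp_le _ (ler0n _ _)).1].
pose v_ k x := (rk k x)%:C%C * v0 x + 'i%C * ((ik k x)%:C%C * v0 x).
have vE k x : v_ k x = (rk k x +i* ik k x)%C * v0 x.
  rewrite /v_ mulrA -mulrDl; congr (_ * _); apply/eqP.
  by rewrite eq_complex /= !mul0r !mul1r !(subr0, addr0, add0r, oppr0) !eqxx.
apply: (@approx_cvg v_ _ (fun x => sqc (v x))).
- move=> k; apply: approxD; first by have [_ _] := ar k; apply; exact: approx_ev.
  by apply: approxZ; have [_ _] := ai k; apply; exact: approx_ev.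
- move=> x; under eq_fun do rewrite vE; rewrite qv0.
  by apply: ccvgM; [split => /=; exact: clamp_cvg|exact: ccvg_cst].
- by [].
- move=> k x; rewrite vE qv0 (sqcM (q x)) (sqcM (rk k x +i* ik k x)%C) ler_wpM2r ?sqc_ge0//.
  have c2 t : clamp k%:R t ^+ 2 <= t ^+ 2.
    rewrite -real_normK ?num_real// -[leRHS]real_normK ?num_real// ler_pXn2r ?nnegrE//.
    exact: (clamp_le _ (ler0n _ _)).2.
  exact: (lerD (c2 (complex.Re (q x))) (c2 (complex.Im (q x)))).
Qed.

End density.

(** * Test functions *)

Section continuous_measurable.
Variables (R : realType) (n : nat).

Definition round (k : nat) (t : R) : R := (Num.floor (k.+1%:R * t))%:~R / k.+1%:R.

Lemma round_err k t : `|t - round k t| <= (k.+1%:R)^-1.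
Proof.
have k0 : 0 < k.+1%:R :> R by rewrite ltr0n.
have /andP[f1 f2] := floor_itv (k.+1%:R * t).
have E : k.+1%:R * (t - round k t) = k.+1%:R * t - (Num.floor (k.+1%:R * t))%:~R.
  by rewrite /round mulrBr mulrC [X in _ - X]mulrC divfK ?gt_eqF// mulrC.
have P : 0 <= t - round k t by rewrite -(pmulr_rge0 _ k0) E subr_ge0.
rewrite ger0_norm// -(ler_pM2l k0) divff ?gt_eqF// E lerBlDl; apply: ltW.
by move: f2; rewrite intrD addrC.
Qed.

Lemma measurable_round k : measurable_fun setT (round k).
Proof.
apply: nondecreasing_measurable => // s t st.
rewrite /round ler_pM2r ?invr_gt0 ?ltr0n// ler_int; apply: le_floor.
by rewrite ler_pM2l ?ltr0n.
Qed.

Definition roundV k (x : 'rV[R]_n) : 'rV[R]_n := \row_i round k (x ord0 i).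

Lemma measurable_roundV k : measurable_fun setT (roundV k).
Proof.
apply: measurable_fun_row => i; rewrite /roundV.
under eq_fun do rewrite mxE.
exact: (measurableT_comp (measurable_round k) (measurable_row_coord i)).
Qed.

Lemma measurable_row1 (t : 'rV[R]_n) : measurable [set t].
Proof.
pose f (x : 'rV[R]_n) : R := \sum_i (x ord0 i - t ord0 i) ^+ 2.
have mf : measurable_fun setT f.
  apply: measurable_sum => i; apply: measurable_funX; apply: measurable_funB.
    exact: measurable_row_coord.
  exact: measurable_cst.
rewrite (_ : [set t] = setT `&` f @^-1` [set 0]); first by apply: mf => //; exact: measurable_set1.
rewrite setTI; apply/seteqP; split=> x /= => [->|].
  by rewrite /f big1// => i _; rewrite subrr expr0n.
move/eqP; rewrite psumr_eq0 => [/allP H|i _]; last exact: sqr_ge0.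
by apply/rowP => i; apply/eqP; rewrite -subr_eq0 -sqrf_eq0; apply: H; rewrite mem_index_enum.
Qed.

(** The sigma-algebra is generated by the coordinates, so measurability of open sets is not at hand.
    Rounding to a grid factors f through a countable set, and f is the limit of these functions as
    the grid is refined. *)
Lemma continuous_row_measurable (f : 'rV[R]_n -> R) : continuous f -> measurable_fun setT f.
Proof.
move=> cf.
have mk k : measurable_fun setT (fun x => f (roundV k x)).
  move=> _ Y mY; rewrite setTI.
  pose A := f @^-1` Y `&` range (roundV k).
  rewrite (_ : _ @^-1` _ = setT `&` roundV k @^-1` A).
    apply: measurable_roundV => //; apply: countable_measurable; first exact: measurable_row1.
    pose g (m : 'rV[int]_n) : 'rV[R]_n := \row_i ((m ord0 i)%:~R / k.+1%:R).
    apply: (@sub_countable _ _ _ (range g)).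
      apply: subset_card_le => x [_ [y _ <-]]; exists (\row_i Num.floor (k.+1%:R * y ord0 i)) => //.
      by apply/rowP => i; rewrite !mxE.
    by apply: (sub_countable (card_image_le _ _)).
  by rewrite setTI; apply/seteqP; split=> x /= => [fY|[]//]; split => //; exists x.
apply: (measurable_fun_cvg mk) => x _.
apply: (@continuous_cvg _ _ _ _ _ (roundV ^~ x)); first exact: cf.
apply/cvg_ballP => e e0; near=> k; split=> // i j; rewrite (ord1 i) mxE /ball /=.
apply: (le_lt_trans (round_err _ _)).
by near: k; apply: near_infty_natSinv_lt (PosNum e0).
Unshelve. all: by end_near. Qed.

End continuous_measurable.

Lemma weyl_weights_test (K : fieldType) (a b c w x1 x2 x3 x4 : K) :
  a * x1 + b * (w * - (w * - x2)) + c *+ 2 * ((w * - x3 + w * - x4) / 2) =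
  a * x1 + b * (w * w) * x2 + c *+ 2 / 2 * - w * (x3 + x4).
Proof. ring. Qed.

Section test_functions.
Variables (R : realType) (n : nat).
Local Notation lam := (lebesgue_Rn R n).
Implicit Types (phi psi : 'rV[R]_n -> R[i]) (K : set 'rV[R]_n).

Lemma ccont_cmeas psi : ccont psi -> cmeas psi.
Proof. by move=> [c1 c2]; split; exact: continuous_row_measurable. Qed.

Definition csupp K psi := ccont psi /\ forall x, ~ K x -> psi x = 0.

(** On the compact set |psi|^2 exp |x|^2 is bounded, so |psi|^2 is dominated by a Gaussian; the
    measure of K does not have to be estimated. *)
Lemma csupp_sqint K psi : compact K -> csupp K psi -> sqint lam psi.
Proof.
move=> cK [[c1 c2] p0]; split; first exact: ccont_cmeas.
pose G x := sqc (psi x) * expR (1 * nsq x).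
have cG : continuous G.
  move=> x; have e1 := continuous_comp (continuousM (@cst_continuous _ _ (1 : R) x) (@cont_nsq R n x)) (@continuous_expR R _).
  exact: (continuousM (continuousD (continuousM (c1 x) (c1 x)) (continuousM (c2 x) (c2 x))) e1).
have cGK : compact (G @` K).
  by apply: continuous_compact => //; exact: continuous_subspaceT.
have [C [_ HC']] := compact_bounded cGK; have HC := HC' (C + 1) (ltr_pwDr ltr01 (lexx C)).
apply: (intg_le _ (intgZ `|C + 1| (gauss_intg n ltr01))).
  by apply: cmeas_sqc; exact: ccont_cmeas.
move=> x; rewrite ger0_norm ?sqc_ge0//; have [Kx|Kx] := pselect (K x); last first.
  by rewrite (p0 _ Kx) /sqc /= expr0n addr0 mulr_ge0 ?expR_ge0.
have : `|G x| <= C + 1 by apply: HC; exists x.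
rewrite /G ger0_norm ?mulr_ge0 ?sqc_ge0 ?expR_ge0// => H.
rewrite mulNr expRN ler_pdivlMr ?expR_gt0//; apply: (le_trans H); exact: ler_norm.
Qed.

Lemma csupp_coord K j psi : csupp K psi -> csupp K (fun x => (x ord0 j)%:C%C * psi x).
Proof.
move=> [cp p0]; split; first by apply: ccontM => //; exact: ccont_coord.
by move=> x Kx; rewrite p0// mulr0.
Qed.

Lemma csuppD K psi phi : csupp K psi -> csupp K phi -> csupp K (fun x => psi x + phi x).
Proof.
move=> [cp p0] [cq q0]; split; first exact: ccontD.
by move=> x Kx; rewrite p0// q0// addr0.
Qed.

Lemma csuppZ K c psi : csupp K psi -> csupp K (fun x => c * psi x).
Proof.
move=> [cp p0]; split; first by apply: ccontM => //; exact: ccont_cst.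
by move=> x Kx; rewrite p0// mulr0.
Qed.

Lemma partialC_supp K j psi : closed K -> (forall x, ~ K x -> psi x = 0) ->
  forall x, ~ K x -> partialC j psi x = 0.
Proof.
move=> cK p0 x Kx; have oK : nbhs x (~` K) by apply: open_nbhs_nbhs; split => //; exact: closed_openC.
have near0 : \forall y \near x, psi y = 0 by apply: filterS oK => y /p0.
apply/eqP; rewrite /partialC eq_complex /=; apply/andP; split; apply/eqP.
  transitivity ('D_(ebase R j) (fun=> 0 : R) x); last exact: derive_cst.
  by apply: near_eq_derive; apply: filterS near0 => y ->.
transitivity ('D_(ebase R j) (fun=> 0 : R) x); last exact: derive_cst.
by apply: near_eq_derive; apply: filterS near0 => y ->.
Qed.

(** For fixed phi the weak action on u is integration against one square integrable function, the
    transposed operator applied to phi. This makes it linear in u and compatible with weak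
    limits. *)
Lemma cint_pair_ex (h : R) q phi : test_function phi ->
  exists2 tau, sqint lam tau & forall u, sqint lam u -> weyl q h (distr_of u) phi = cint lam (fun x => u x * tau x).
Proof.
move=> [Cr Ci cK]; set K := closure _ in cK.
have clK : closed K by exact: closed_closure.
have phi0 x : ~ K x -> phi x = 0.
  by move=> Kx; apply/eqP; apply: contra_notT Kx => px; exact: subset_closure.
have s0 : csupp K phi by split => //; split; [exact: (Cr 0%N)|exact: (Ci 0%N)].
have s1 j : csupp K (partialC j phi).
  split; last exact: partialC_supp.
  by split; [have [_ /(_ j)[_]] := Cr 1%N|have [_ /(_ j)[_]] := Ci 1%N].
have s2 j l : csupp K (partialC l (partialC j phi)).
  split; last by apply: partialC_supp => //; have [] := s1 j.
  by split; [have [_ /(_ j)[_ [_ /(_ l)[_]]]] := Cr 2%N|have [_ /(_ j)[_ [_ /(_ l)[_]]]] := Ci 2%N].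
have d1 j x : cder j phi x (partialC j phi x).
  have [_ /(_ j)[r1 _]] := Cr 1%N; have [_ /(_ j)[i1 _]] := Ci 1%N.
  by split; apply: DeriveDef => //=.
have sx j l : csupp K (partialC l (fun x => (x ord0 j)%:C%C * phi x)).
  rewrite (_ : partialC _ _ = fun x => (l == j)%:R * phi x + (x ord0 j)%:C%C * partialC l phi x).
    by apply: csuppD; [exact: csuppZ|exact: csupp_coord].
  by apply/funext => x; apply: cder_partial; apply: cderM; [exact: cder_coord|exact: d1].
pose w := h%:C%C / 'i%C.
pose t (j l : 'I_n) (x : 'rV[R]_n) : R[i] := ulsubmx (polar_mx q) j l * ((x ord0 l)%:C%C * ((x ord0 j)%:C%C * phi x))
  + (drsubmx (polar_mx q) j l * (w * w)) * partialC l (partialC j phi) x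
  + (ursubmx (polar_mx q) j l *+ 2 / 2 * - w) * (partialC l (fun y => (y ord0 j)%:C%C * phi y) x +
     (x ord0 j)%:C%C * partialC l phi x).
have st j l : csupp K (t j l).
  apply: csuppD; first apply: csuppD.
  - by apply: csuppZ; do 2! apply: csupp_coord.
  - exact: csuppZ.
  - by apply: csuppZ; apply: csuppD => //; exact: csupp_coord.
have sqt j l := csupp_sqint cK (st j l).
exists (fun x => \sum_j \sum_l t j l x).
  have H (I : Type) (r : seq I) (f : I -> 'rV[R]_n -> R[i]) : (forall i, sqint lam (f i)) ->
      sqint lam (fun x => \sum_(i <- r) f i x).
    move=> sf; elim: r => [|i r IH]; first by under eq_fun do rewrite big_nil; exact: sqint0.
    by under eq_fun do rewrite big_cons; exact: sqintD.
  by apply: (@H _ _ (fun j x => \sum_l t j l x)) => j; exact: (@H _ _ (t j)).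
move=> u su.
have I psi : csupp K psi -> cintg lam (fun x => u x * psi x).
  by move=> sp; apply: sqint_prod => //; exact: csupp_sqint cK sp.
have D2 psi psi' : csupp K psi -> csupp K psi' -> cint lam (fun x => u x * (psi x + psi' x)) =
    cint lam (fun x => u x * psi x) + cint lam (fun x => u x * psi' x).
  by move=> sp sp'; rewrite -cintD; [|exact: I..]; under eq_fun do rewrite mulrDr.
have DZ c psi : csupp K psi -> cint lam (fun x => u x * (c * psi x)) = c * cint lam (fun x => u x * psi x).
  by move=> sp; rewrite -cintZ; [|exact: I]; under eq_fun do rewrite mulrCA.
have -> : (fun x => u x * (\sum_j \sum_l t j l x)) = fun x => \sum_j \sum_l u x * t j l x.
  by apply/funext => x; rewrite mulr_sumr; apply: eq_bigr => j _; rewrite mulr_sumr.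
rewrite cint_sum => [|j]; last by apply: cintg_sum => l; exact: I.
apply: eq_bigr => j _; rewrite cint_sum => [|l]; last exact: I.
apply: eq_bigr => l _; rewrite /t.
have c1 := csupp_coord l (csupp_coord j s0); have c2 := csupp_coord j (s1 l).
rewrite D2; [|by apply: csuppD; exact: csuppZ|by apply: csuppZ; apply: csuppD].
rewrite D2; [|exact: csuppZ..].
rewrite !DZ//; last exact: csuppD.
rewrite D2// /mulx /hD /distr_of -/w.
exact: weyl_weights_test.
Qed.

Lemma L2_sqint (u : 'rV[R]_n -> R[i]) : L2 u <-> sqint lam u.
Proof.
have meas (f : 'rV[R]_n -> R) : f \in Lfun lam 2%:E -> measurable_fun setT f.
  by rewrite inE => /andP[]; rewrite inE.
have mem (f : 'rV[R]_n -> R) : measurable_fun setT f -> intg lam (fun x => f x ^+ 2) -> f \in Lfun lam 2%:E.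
  move=> mf fi; rewrite inE; apply/andP; split; first by rewrite inE.
  rewrite inE /= /finite_norm unlock /Lnorm; apply: poweR_lty.
  rewrite (_ : (\int[lam]_x _)%E = (\int[lam]_x (f x ^+ 2)%:E)%E).
    by rewrite (integral_Rint fi) ltry.
  apply: eq_integral => x _ /=; rewrite powR_mulrn ?normr_ge0//.
  by rewrite real_normK ?num_real.
split=> [[Lr Li]|[[mr mi] iu]].
  have mr := meas _ Lr; have mi := meas _ Li; split; first by split.
  have := intgD (Lfun2_integrable_sqr Lr) (Lfun2_integrable_sqr Li).
  by congr intg; apply/funext => x.
have m2 (f : 'rV[R]_n -> R) : measurable_fun setT f -> measurable_fun setT (fun x => f x ^+ 2).
  by move=> mf; exact: measurable_funX.
split; apply: mem => //; apply: (intg_le _ iu); try exact: m2.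
  by move=> x; rewrite ger0_norm ?sqr_ge0// /sqc lerDl sqr_ge0.
by move=> x; rewrite ger0_norm ?sqr_ge0// /sqc lerDr sqr_ge0.
Qed.

Lemma L2normE (u : 'rV[R]_n -> R[i]) : sqint lam u -> L2norm u = (Num.sqrt (sqmass u))%:E.
Proof.
move=> [mu' iu]; rewrite /L2norm unlock /Lnorm.
rewrite (_ : (\int[lam]_x _)%E = (sqmass u)%:E).
  by rewrite poweR_EFin powR12_sqrt// Rint_ge0// => x; exact: sqc_ge0.
rewrite /sqmass -(integral_Rint iu); apply: eq_integral => x _ /=.
by rewrite powR_mulrn ?normr_ge0// ger0_norm ?normc_ge0// normc_sqr.
Qed.

End test_functions.

(** * Openness of the resolvent set *)

Section l2_norm.
Variables (R : realType) (n : nat).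
Local Notation lam := (lebesgue_Rn R n).
Implicit Types (u v : 'rV[R]_n -> R[i]).

Definition l2norm u : R := Num.sqrt (sqmass u).

Lemma l2norm_ge0 u : 0 <= l2norm u. Proof. exact: sqrtr_ge0. Qed.

Lemma sqmass_ge0 u : 0 <= sqmass u.
Proof. by apply: Rint_ge0 => x; exact: sqc_ge0. Qed.

Lemma l2norm_sqr u : l2norm u ^+ 2 = sqmass u.
Proof. by rewrite sqr_sqrtr// sqmass_ge0. Qed.

Lemma l2norm_nm u (su : sqint lam u) :
  l2norm u = nm (@ipL _ _ R lam) (L2T (introT (l2predP lam u) su)).
Proof. by rewrite /nm ipLvv. Qed.

Lemma l2normD u v : sqint lam u -> sqint lam v ->
  l2norm (fun x => u x + v x) <= l2norm u + l2norm v.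
Proof.
move=> su sv; rewrite (l2norm_nm su) (l2norm_nm sv).
apply: le_trans (nmD (@ipL_linear _ _ R lam) (@ipL_J _ _ R lam) (@ipL_ge0 _ _ R lam) _ _).
by rewrite /nm ipLvv.
Qed.

Lemma l2normZ c u : sqint lam u -> l2norm (fun x => c * u x) = Normc.normc c * l2norm u.
Proof.
move=> su; rewrite (l2norm_nm su).
rewrite -(nmZ (@ipL_linear _ _ R lam) (@ipL_J _ _ R lam) (@ipL_ge0 _ _ R lam)).
by rewrite /nm ipLvv.
Qed.

Lemma l2normJ u : l2norm (fun x => (u x)^*%C) = l2norm u.
Proof. by rewrite /l2norm /sqmass; under eq_Rintegral do rewrite sqcJ. Qed.

Lemma cint_le u v : sqint lam u -> sqint lam v ->
  Normc.normc (cint lam (fun x => u x * v x)) <= l2norm u * l2norm v.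
Proof.
move=> su sv; rewrite -[l2norm v]l2normJ (l2norm_nm su) (l2norm_nm (sqintJ sv)).
rewrite (_ : (fun x => u x * v x) = fun x => u x * (v x)^*%C^*%C); last first.
  by apply/funext => x; rewrite conjcK.
exact: (normc_ip_le (@ipL_linear _ _ R lam) (@ipL_J _ _ R lam) (@ipL_ge0 _ _ R lam)
  (L2T (introT (l2predP lam u) su)) (L2T (introT (l2predP lam _) (sqintJ sv)))).
Qed.

Lemma l2norm0_ae u : sqint lam u -> l2norm u = 0 -> {ae lam, forall x, u x = 0}.
Proof.
move=> [mu' iu] /eqP; rewrite sqrtr_eq0 => s0.
have {}s0 : sqmass u = 0 by apply/eqP; rewrite eq_le s0 sqmass_ge0.
have I1 : (\int[lam]_x `|(sqc (u x))%:E| = 0)%E.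
  transitivity (\int[lam]_x (sqc (u x))%:E)%E.
    by apply: eq_integral => x _; rewrite gee0_abs// lee_fin sqc_ge0.
  by rewrite (integral_Rint iu) -/(sqmass u) s0.
have me : measurable_fun setT (fun x => (sqc (u x))%:E).
  by apply/measurable_EFinP; exact: cmeas_sqc.
have := (ae_eq_integral_abs lam measurableT me).1 I1.
apply: filterS => x /(_ I) [] /eqP; rewrite -normc_sqr sqrf_eq0 => /eqP.
exact: Normc.eq0_normc.
Qed.

Lemma cint_ae u v : cmeas u -> cmeas v -> {ae lam, forall x, u x = v x} ->
  cint lam u = cint lam v.
Proof.
move=> [u1 u2] [v1 v2] H.
have mE (f : 'rV[R]_n -> R) : measurable_fun setT f -> measurable_fun setT (EFin \o f).
  by move=> mf; exact/measurable_EFinP.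
have H1 : (\int[lam]_x (complex.Re (u x))%:E = \int[lam]_x (complex.Re (v x))%:E)%E.
  apply: ae_eq_integral; [exact: measurableT|exact: (mE _ u1)|exact: (mE _ v1)|].
  by apply: filterS H => x ->.
have H2 : (\int[lam]_x (complex.Im (u x))%:E = \int[lam]_x (complex.Im (v x))%:E)%E.
  apply: ae_eq_integral; [exact: measurableT|exact: (mE _ u2)|exact: (mE _ v2)|].
  by apply: filterS H => x ->.
by rewrite /cint /Rintegral H1 H2.
Qed.

(** The inequality |a + b|^2 <= 2 |a|^2 + 2 |b|^2, applied by splitting off one term at a time,
    doubles the weight at each index. *)
Lemma sqc_sum_le (z : nat -> R[i]) k :
  sqc (\sum_(i < k) z i) <= 2 * \sum_(i < k) 2 ^+ i * sqc (z i).
Proof.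
elim: k z => [|k IH] z; first by rewrite !big_ord0 mulr0 /sqc /= expr0n addr0.
have E : \sum_(i < k.+1) 2 ^+ i * sqc (z i) = sqc (z 0%N) + 2 * \sum_(i < k) 2 ^+ i * sqc (z i.+1).
  rewrite big_ord_recl expr0 mul1r mulr_sumr; congr (_ + _).
  by apply: eq_bigr => i _; rewrite exprS mulrA.
rewrite E big_ord_recl; apply: (le_trans (sqcD_le _ _)).
rewrite [leRHS]mulrDr; apply: lerD => //; rewrite ler_pM2l//.
exact: IH (fun i => z i.+1).
Qed.

(** |t_i| <= 2^-i + 2^i t_i^2, whose partial sums are at most 2 + B. *)
Lemma series_cvg_weighted (t : nat -> R) (B : R) :
  (forall k, \sum_(i < k) 2 ^+ i * t i ^+ 2 <= B) -> cvgn (series t).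
Proof.
move=> H; apply: normed_cvg; apply: nondecreasing_is_cvgn.
  by apply: nondecreasing_series => i _ _; exact: normr_ge0.
exists (2 + B) => _ [k _ <-]; change (series (fun i => `|t i|) k <= 2 + B); rewrite seriesEord /=.
apply: (@le_trans _ _ (\sum_(i < k) (2^-1 ^+ i + 2 ^+ i * t i ^+ 2))).
  apply: ler_sum => i _; rewrite exprVn -[t i ^+ 2]real_normK ?num_real//.
  have p0 : 0 < 2 ^+ i :> R by rewrite exprn_gt0.
  move: p0; move: (2 ^+ i) (`|t i|) => p y p0.
  rewrite -(ler_pM2l p0) mulrDr divff ?gt_eqF// mulrA -expr2 -exprMn.
  by move: (p * y) => z; have := sqr_ge0 (z - 1); have := sqr_ge0 z; nra.
rewrite big_split /=; apply: lerD; last exact: H.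
rewrite -[leRHS]mulr1.
have E : \sum_(i < k) (2^-1 : R) ^+ i = 2 * (1 - 2^-1 ^+ k).
  elim: k => [|k IH]; first by rewrite big_ord0 expr0 subrr mulr0.
  by rewrite big_ord_recr /= IH exprS; field.
by rewrite E ler_pM2l// lerBlDr lerDl exprn_ge0.
Qed.

(* On the set where the weighted sum of the squares diverges all the terms
   are replaced by 0; this set is negligible. *)
Lemma series_l2 (v_ : nat -> 'rV[R]_n -> R[i]) (c : R) :
  (forall k, sqint lam (v_ k)) -> (forall k, sqmass (v_ k) <= c * 4^-1 ^+ k) ->
  exists2 u, sqint lam u & forall tau, sqint lam tau ->
    ccvg (fun k => cint lam (fun x => (\sum_(i < k) v_ i x) * tau x))
         (cint lam (fun x => u x * tau x)).
Proof.
(* The weight 2^i is affordable because the masses decay like 4^-i, and it forces convergence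
   wherever the sum G is finite. *)
move=> sv vc; pose g i x : \bar R := (2 ^+ i * sqc (v_ i x))%:E.
have g0 i x : (0 <= g i x)%E by rewrite lee_fin mulr_ge0 ?exprn_ge0 ?sqc_ge0.
have mg i : measurable_fun setT (g i).
  apply/measurable_EFinP; apply: measurable_funM; first exact: measurable_cst.
  by apply: cmeas_sqc; have [] := sv i.
pose G x := (\sum_(0 <= i <oo) g i x)%E.
have mG : measurable_fun setT G by apply: ge0_emeasurable_sum.
have G0 x : (0 <= G x)%E by apply: nneseries_ge0.
have c0 : 0 <= c.
  by have := le_trans (sqmass_ge0 (v_ 0%N)) (vc 0%N); rewrite expr0 mulr1.
have IG : (\int[lam]_x G x < +oo)%E.
  rewrite /G integral_nneseries//.
  apply: (@le_lt_trans _ _ (2 * c)%:E); last exact: ltry.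
  apply: lime_le; first by apply: is_cvg_nneseries => i _ _; exact: integral_ge0.
  apply: nearW => k; rewrite big_mkord.
  apply: (@le_trans _ _ (\sum_(i < k) (c * 2^-1 ^+ i)%:E)%E).
    apply: lee_sum => i _; have [_ ii] := sv i.
    rewrite (integral_Rint (intgZ (2 ^+ i) ii)) (RintZ _ ii) -/(sqmass _) lee_fin.
    apply: (@le_trans _ _ (2 ^+ i * (c * 4^-1 ^+ i))).
      by rewrite ler_pM2l ?exprn_gt0.
    rewrite mulrCA ler_wpM2l// -exprMn (_ : 2 * 4^-1 = 2^-1)//.
    by field.
  rewrite sumEFin lee_fin -mulr_sumr [leRHS]mulrC ler_wpM2l//.
  have E : \sum_(i < k) (2^-1 : R) ^+ i = 2 * (1 - 2^-1 ^+ k).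
    elim: k => [|k IH]; first by rewrite big_ord0 expr0 subrr mulr0.
    by rewrite big_ord_recr /= IH exprS; field.
  by rewrite E -[leRHS]mulr1 ler_pM2l// lerBlDr lerDl exprn_ge0.
have iG : lam.-integrable setT G.
  by apply/integrableP; split => //; under eq_integral do rewrite gee0_abs//.
have aeG := integrable_ae measurableT iG.
pose N := G @^-1` [set +oo%E].
have mN : measurable N by rewrite -[N]setTI; apply: mG => //; exact: measurable_set1.
pose a x : R := \1_(~` N) x.
have ma : measurable_fun setT a by apply: measurable_indic; exact: measurableC.
have a1 x : ~ N x -> a x = 1 by move=> Nx; rewrite /a indicE mem_set.
have a0 x : N x -> a x = 0 by move=> Nx; rewrite /a indicE memNset//=; exact.
pose gf x := fine (G x).
have igf : intg lam (fun x => a x * gf x).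
  have mgf : measurable_fun setT (fun x => (gf x)%:E).
    rewrite (_ : (fun x => _) = fun x => (G x * (a x)%:E)%E).
      by apply: emeasurable_funM => //; exact/measurable_EFinP.
    apply/funext => x; have [Nx|Nx] := pselect (N x).
      by rewrite (a0 _ Nx) mule0 /gf (_ : G x = +oo%E).
    by rewrite (a1 _ Nx) mule1 /gf fineK// ge0_fin_numE// ltey; apply/eqP.
  have ig : intg lam gf.
    apply/integrableP; split; first exact: mgf.
    apply: le_lt_trans IG; apply: ge0_le_integral => //.
      exact: measurableT_comp mgf.
    move=> x _ /=; have := G0 x; rewrite /gf; case: (G x) => [r|_|]//=.
      by move=> r0; rewrite lee_fin ger0_norm.
    by rewrite normr0 leey.
  apply: (intg_le _ (intgZ 1 ig)).
    by apply: measurable_funM => //; exact: intg_meas ig.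
  move=> x; have gx : 0 <= gf x by apply: fine_ge0.
  rewrite mul1r normrM (ger0_norm gx) ler_piMl// /a indicE.
  by case: (_ \in _); rewrite ?normr1 ?normr0.
have part x k : ~ N x -> \sum_(i < k) 2 ^+ i * sqc (v_ i x) <= gf x.
  move=> Nx; rewrite -lee_fin /gf fineK; last by rewrite ge0_fin_numE// ltey; apply/eqP.
  rewrite -sumEFin -(big_mkord xpredT (fun i => g i x)).
  exact: nneseries_lim_ge.
pose w i x := (a x)%:C%C * v_ i x.
have sw i : cmeas (w i) by apply: cmeasM; [exact: cmeasR|have [] := sv i].
pose S k x := \sum_(i < k) w i x.
have mS k : cmeas (S k) by apply: cmeas_sum.
have SE k x : S k x = (a x)%:C%C * \sum_(i < k) v_ i x by rewrite /S mulr_sumr.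
have Sb k x : sqc (S k x) <= 2 * (a x * gf x).
  rewrite SE sqcR; have [Nx|Nx] := pselect (N x).
    by rewrite (a0 _ Nx) expr0n /= !mul0r mulr0.
  rewrite (a1 _ Nx) expr1n !mul1r; apply: (le_trans (sqc_sum_le (fun i => v_ i x) k)).
  by rewrite ler_pM2l//; exact: part.
have cS x : exists l, ccvg (S ^~ x) l.
  have [Nx|Nx] := pselect (N x).
    exists 0; rewrite (_ : S ^~ x = fun=> 0); first exact: ccvg_cst.
    by apply/funext => k; rewrite SE (a0 _ Nx) mul0r.
  have c1 : cvgn (series (fun i => complex.Re (v_ i x))).
    apply: (@series_cvg_weighted _ (gf x)) => k; apply: le_trans (part x k Nx).
    by apply: ler_sum => i _; rewrite ler_pM2l ?exprn_gt0// /sqc lerDl sqr_ge0.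
  have c2 : cvgn (series (fun i => complex.Im (v_ i x))).
    apply: (@series_cvg_weighted _ (gf x)) => k; apply: le_trans (part x k Nx).
    by apply: ler_sum => i _; rewrite ler_pM2l ?exprn_gt0// /sqc lerDr sqr_ge0.
  exists (limn (series (fun i => complex.Re (v_ i x))) +i*
          limn (series (fun i => complex.Im (v_ i x))))%C.
  have ImS (I : finType) (f : I -> R[i]) : complex.Im (\sum_i f i) = \sum_i complex.Im (f i).
    exact: (big_morph (@complex.Im R) (@ImD R) erefl).
  split => /=.
    rewrite (_ : (fun k => _) = series (fun i => complex.Re (v_ i x))) //.
    by apply/funext => k; rewrite SE (a1 _ Nx) mul1r Re_sum seriesEord.
  rewrite (_ : (fun k => _) = series (fun i => complex.Im (v_ i x))) //.
  by apply/funext => k; rewrite SE (a1 _ Nx) mul1r ImS seriesEord.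
have [u uS] := choice cS.
have [su _] := sqmass_cvg mS uS (intgZ 2 igf) Sb.
exists u => // tau st; have [mt it] := st.
have aeS k : cint lam (fun x => (\sum_(i < k) v_ i x) * tau x) = cint lam (fun x => S k x * tau x).
  apply: cint_ae.
  - by apply: cmeasM => //; apply: cmeas_sum => i; have [] := sv i.
  - exact: cmeasM.
  - apply: filterS aeG => x /(_ I) fx; rewrite SE a1 ?mul1r// => Nx.
    by move: fx; rewrite Nx.
under eq_fun do rewrite aeS.
have [||||_ L1 L2] := @cint_dct _ _ R lam (fun k x => S k x * tau x)
  (fun x => u x * tau x) (fun x => 2 * (a x * gf x) + sqc (tau x)) _ _ _ (intgD (intgZ 2 igf) it) _ => //.
- by move=> k; exact: cmeasM.
- by move=> x; have [] := ccvgM (uS x) (ccvg_cst (tau x)).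
- by move=> x; have [] := ccvgM (uS x) (ccvg_cst (tau x)).
- move=> k x; apply: (@le_trans _ _ (sqc (S k x) + sqc (tau x))); last by rewrite lerD2r.
  rewrite Normc.normcM -!normc_sqr.
  have := normc_ge0 (S k x); have := normc_ge0 (tau x).
  by move: (Normc.normc _) (Normc.normc _) => y1 y2 ? ?; nra.
Qed.

End l2_norm.

Section resolvent_open.
Variables (R : realType) (n : nat) (q : 'rV[R]_(n + n) -> R[i]) (h : R).
Local Notation lam := (lebesgue_Rn R n).
Local Notation P := (weyl_op q h).
Implicit Types (u v f : 'rV[R]_n -> R[i]) (z : R[i]).

Lemma test_sqint phi : test_function phi -> sqint lam phi.
Proof.
move=> [Cr Ci cK]; apply: (csupp_sqint cK); split.
  by split; [exact: (Cr 0%N)|exact: (Ci 0%N)].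
by move=> x Kx; apply/eqP; apply: contra_notT Kx => px; exact: subset_closure.
Qed.

(** The graph of the resolvent with the function P u eliminated: it must be f + z u. *)
Definition solves z f u := [/\ sqint lam u, sqint lam f & forall phi, test_function phi ->
  weyl q h (distr_of u) phi = cint lam (fun x => (f x + z * u x) * phi x)].

Lemma solvesP z f u : resolvent P z f u <-> solves z f u.
Proof.
split=> [[g [/L2_sqint su /L2_sqint sg H] fE]|[su sf H]].
  split=> // [|phi tp].
    rewrite fE; apply: sqintB => //; exact: sqintZ.
  rewrite H// /distr_of; congr cint; apply/funext => x.
  by rewrite fE subrK.
exists (fun x => f x + z * u x).
  split; [exact/L2_sqint|apply/L2_sqint; apply: sqintD => //; exact: sqintZ|exact: H].
by apply/funext => x; rewrite addrK.
Qed.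

Lemma solves_linear z c f1 u1 f2 u2 : solves z f1 u1 -> solves z f2 u2 ->
  solves z (fun x => c * f1 x + f2 x) (fun x => c * u1 x + u2 x).
Proof.
move=> [su1 sf1 H1] [su2 sf2 H2].
have su : sqint lam (fun x => c * u1 x + u2 x) by apply: sqintD => //; exact: sqintZ.
have sf : sqint lam (fun x => c * f1 x + f2 x) by apply: sqintD => //; exact: sqintZ.
split=> // phi tp; have [tau st E] := cint_pair_ex h q tp; have sp := test_sqint tp.
have I u v : sqint lam u -> sqint lam v -> cintg lam (fun x => u x * v x) by exact: sqint_prod.
have sg1 : sqint lam (fun x => f1 x + z * u1 x) by apply: sqintD => //; exact: sqintZ.
have sg2 : sqint lam (fun x => f2 x + z * u2 x) by apply: sqintD => //; exact: sqintZ.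
transitivity (c * weyl q h (distr_of u1) phi + weyl q h (distr_of u2) phi).
  rewrite !E// -cintZ; last exact: I.
  rewrite -cintD; [|by apply: cintgZ; exact: I|exact: I].
  by congr cint; apply/funext => x; rewrite mulrDl mulrA.
rewrite H1// H2// -cintZ; last exact: I.
rewrite -cintD; [|by apply: cintgZ; exact: I|exact: I].
congr cint; apply/funext => x; rewrite mulrA -mulrDl; congr (_ * _).
by rewrite !mulrDr [z * (c * _)]mulrCA addrACA.
Qed.

Lemma solves_shift z z' f u : solves z f u -> solves z' (fun x => f x + (z - z') * u x) u.
Proof.
move=> [su sf H]; split=> // [|phi tp]; first by apply: sqintD => //; exact: sqintZ.
by rewrite H//; congr cint; apply/funext => x; rewrite -addrA -mulrDl subrK.
Qed.

(** The Neumann series with terms u_0 = S f and u_(k+1) = S ((z' - z) u_k), where S is a mere choice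
    of solutions at z. The norms are at most 2^-k |u_0|, the sum exists weakly, and the equation
    passes to the limit since every pairing is with a fixed square integrable function. *)
Lemma neumann z z' (K0 : R) : 0 <= K0 -> (forall f, sqint lam f -> exists u, solves z f u) ->
  (forall f u, solves z f u -> l2norm u <= K0 * l2norm f) ->
  K0 * Normc.normc (z' - z) <= 2^-1 ->
  forall f, sqint lam f -> exists u, solves z' f u.
Proof.
move=> K00 ex bd small f sf.
have /choice[S SP] : forall g, exists u, sqint lam g -> solves z g u.
  move=> g; have [sg|sg] := pselect (sqint lam g); last by exists g.
  by have [u] := ex g sg; exists u.
pose u_ := fix u_ (k : nat) : 'rV[R]_n -> R[i] :=
  if k is k'.+1 then S (fun x => (z' - z) * u_ k' x) else S f.
have su k : sqint lam (u_ k).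
  elim: k => [|k IH] /=; first by have [] := SP f sf.
  by have [] := SP _ (sqintZ (z' - z) IH).
have nu k : l2norm (u_ k) <= 2^-1 ^+ k * l2norm (u_ 0%N).
  elim: k => [|k IH]; first by rewrite expr0 mul1r.
  apply: (le_trans (bd _ _ (SP _ (sqintZ (z' - z) (su k))))).
  rewrite l2normZ// mulrA exprS -[leRHS]mulrA; apply: ler_pM => //.
    by rewrite mulr_ge0// normc_ge0.
  exact: l2norm_ge0.
have [|u sol cv] := @series_l2 R n u_ (sqmass (u_ 0%N)) su.
  move=> k; rewrite -!l2norm_sqr.
  have -> : l2norm (u_ 0%N) ^+ 2 * 4^-1 ^+ k = (2^-1 ^+ k * l2norm (u_ 0%N)) ^+ 2.
    rewrite exprMn mulrC -exprM mulnC exprM; congr (_ ^+ _ * _).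
    by rewrite exprVn; congr (_^-1); rewrite -natrX.
  by rewrite ler_pXn2r ?nnegrE ?l2norm_ge0// mulr_ge0 ?l2norm_ge0// exprn_ge0.
exists u; split=> // phi tp; have [tau st E] := cint_pair_ex h q tp; have sp := test_sqint tp.
rewrite E//.
have I u1 v1 : sqint lam u1 -> sqint lam v1 -> cintg lam (fun x => u1 x * v1 x) by exact: sqint_prod.
have sumE (w : 'rV[R]_n -> R[i]) k : sqint lam w -> cint lam (fun x => (\sum_(i < k) u_ i x) * w x) =
    \sum_(i < k) cint lam (fun x => u_ i x * w x).
  move=> sw; rewrite -cint_sum => [|i]; last exact: I.
  by congr cint; apply/funext => x; rewrite mulr_suml.
pose A k := cint lam (fun x => (\sum_(i < k) u_ i x) * tau x).
pose B k := cint lam (fun x => (\sum_(i < k) u_ i x) * phi x).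
pose F := cint lam (fun x => f x * phi x).
have D g v : solves z g v -> cint lam (fun x => v x * tau x) =
    cint lam (fun x => g x * phi x) + z * cint lam (fun x => v x * phi x).
  move=> [sv sg H]; rewrite -E// H// -cintZ; last exact: I.
  rewrite -cintD; [|exact: I|by apply: cintgZ; exact: I].
  by congr cint; apply/funext => x; rewrite mulrDl mulrA.
(* The equations of the terms are added up; in the limit z and z' - z combine to z'. *)
have AB k : A k.+1 = F + z * B k.+1 + (z' - z) * B k.
  rewrite /A /B !sumE// big_ord_recl (D _ _ (SP f sf)) [in RHS]big_ord_recl mulrDr !addrA.
  rewrite -!addrA; congr (_ + (_ + _)); rewrite !mulr_sumr -big_split; apply: eq_bigr => i _.
  rewrite /= (D _ _ (SP _ (sqintZ (z' - z) (su i)))) addrC; congr (_ + _).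
  rewrite -cintZ; last exact: I.
  by congr cint; apply/funext => x; rewrite mulrA.
have sh (w : nat -> R[i]) l : ccvg w l -> ccvg (fun k => w k.+1) l.
  by move=> [w1 w2]; split; [rewrite (cvg_shiftS (fun k => complex.Re (w k)))|rewrite (cvg_shiftS (fun k => complex.Im (w k)))].
have cA := sh _ _ (cv tau st); have cB := cv phi sp.
have cA' : ccvg (fun k => A k.+1) (F + z * cint lam (fun x => u x * phi x) + (z' - z) * cint lam (fun x => u x * phi x)).
  under eq_fun do rewrite AB.
  apply: ccvgD; last by apply: ccvgZ.
  by apply: ccvgD; [exact: ccvg_cst|apply: ccvgZ; exact: sh cB].
rewrite (ccvg_unique cA cA') -addrA -mulrDl [z + _]addrC subrK.
rewrite -cintZ; last exact: I.
rewrite -cintD; [|exact: I|by apply: cintgZ; exact: I].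
by congr cint; apply/funext => x; rewrite mulrDl mulrA.
Qed.

Lemma opnorm_bound z : (opnorm (resolvent P z) < +oo)%E ->
  exists2 K0, 0 <= K0 & forall f u, solves z f u -> l2norm u <= K0 * l2norm f.
Proof.
move=> fin; pose K0 := fine (opnorm (resolvent P z)).
have ub f u : solves z f u -> l2norm f <= 1 -> ((l2norm u)%:E <= opnorm (resolvent P z))%E.
  move=> s f1; apply: ereal_sup_ubound; exists f, u; have [su sf _] := s.
  by split; [exact/solvesP|rewrite L2normE// lee_fin|rewrite L2normE].
have s0 : solves z (fun=> 0) (fun=> 0).
  have s00 := @sqint0 _ _ R lam; split => // phi tp.
  have [tau st E] := cint_pair_ex h q tp; rewrite E//.
  by congr cint; apply/funext => x; rewrite mulr0 add0r !mul0r.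
have z0 : l2norm (fun _ : 'rV[R]_n => 0 : R[i]) = 0.
  rewrite /l2norm (_ : sqmass _ = 0) ?sqrtr0//.
  rewrite -[RHS](Rint0 lam) /sqmass; congr Rintegral.
  by apply/funext => x; rewrite /sqc /= expr0n addr0.
have op0 : (0 <= opnorm (resolvent P z))%E.
  by have := ub _ _ s0; rewrite z0; apply.
have opE : opnorm (resolvent P z) = K0%:E by rewrite /K0 fineK// ge0_fin_numE.
exists K0; first by rewrite -lee_fin -opE.
move=> f u s; have [su sf _] := s.
have K00 : 0 <= K0 by rewrite -lee_fin -opE.
apply/ler_addgt0Pr => e e0.
(* The shift keeps the divisor positive when f has norm 0 and costs at most e in the end. *)
pose c := (l2norm f + e / (K0 + 1))^-1.
have e1 : 0 < e / (K0 + 1) by rewrite divr_gt0// ltr_wpDl.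
have c0 : 0 < l2norm f + e / (K0 + 1) by rewrite ltr_wpDl// l2norm_ge0.
have nc : Normc.normc (c%:C%C) = c.
  by rewrite /= expr0n /= addr0 sqrtr_sqr ger0_norm// invr_ge0 ltW.
have := ub _ _ (solves_linear c%:C%C s s0).
rewrite (_ : (fun x => c%:C%C * f x + 0) = fun x => c%:C%C * f x); last by apply/funext => x; rewrite addr0.
rewrite (_ : (fun x => c%:C%C * u x + 0) = fun x => c%:C%C * u x); last by apply/funext => x; rewrite addr0.
rewrite !l2normZ// nc opE lee_fin mulrC ler_pdivrMr// mul1r lerDl => /(_ (ltW e1)).
rewrite mulrC ler_pdivrMr// => H; apply: (le_trans H).
rewrite mulrDr lerD2l mulrCA ler_piMr ?(ltW e0)// ler_pdivrMr ?mul1r ?lerDl//.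
by rewrite ltr_wpDl.
Qed.

(** For K0 |z - z'| <= 1/2 the term (z' - z) u is absorbed, so solutions at z' satisfy a bound with
    2 K0; this gives injectivity and boundedness, and the Neumann series gives existence. *)
Lemma resolvent_set_open z : resolvent_set P z ->
  exists2 r, 0 < r & forall z', Normc.normc (z - z') < r -> resolvent_set P z'.
Proof.
move=> [[ex inj] fin]; have [K0 K00 bd] := opnorm_bound fin.
have ex' f : sqint lam f -> exists u, solves z f u.
  by move=> sf; have [u /solvesP H] := ex f ((L2_sqint f).2 sf); exists u.
have K1 : 0 < 2 * (K0 + 1) by rewrite mulr_gt0// ltr_wpDl.
exists ((2 * (K0 + 1))^-1) => [|z' zz]; first by rewrite invr_gt0.
have small : K0 * Normc.normc (z - z') <= 2^-1.
  apply: (@le_trans _ _ ((K0 + 1) * (2 * (K0 + 1))^-1)).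
    apply: ler_pM; rewrite ?normc_ge0// ?lerDl//; exact: ltW.
  by rewrite invfM mulrCA divff ?mulr1// gt_eqF// ltr_wpDl.
have small' : K0 * Normc.normc (z' - z) <= 2^-1 by rewrite -opprB normcN.
have bd' f u : solves z' f u -> l2norm u <= 2 * K0 * l2norm f.
  move=> s; have [su sf _] := s; have := bd _ _ (solves_shift z s).
  move=> H; have := le_trans H (ler_wpM2l K00 (l2normD sf (sqintZ (z' - z) su))).
  rewrite l2normZ// mulrDr mulrA => H2.
  have H3 : l2norm u <= K0 * l2norm f + 2^-1 * l2norm u.
    by apply: (le_trans H2); rewrite lerD2l; exact: (ler_wpM2r (l2norm_ge0 u) small').
  rewrite -[2 * K0 * _]mulrA; move: H3.
  by move: (l2norm u) (K0 * l2norm f) => a b; lra.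
split; [split|].
- move=> f /L2_sqint sf; have [u su] := neumann K00 ex' bd small' sf.
  by exists u; exact/solvesP.
- move=> f1 f2 u1 u2 /solvesP s1 /solvesP s2 f12.
  have s := solves_linear (-1) s1 s2; have [su sf _] := s.
  have f0 : l2norm (fun x => -1 * f1 x + f2 x) = 0.
    have [mf _] := sf; rewrite /l2norm.
    rewrite (_ : sqmass _ = 0) ?sqrtr0//.
    have E0 : cint lam (fun x => (-1 * f1 x + f2 x) * (-1 * f1 x + f2 x)^*%C) = 0.
      transitivity (cint lam (fun=> 0 : R[i])); last exact: cint0.
      apply: cint_ae.
      - by apply: cmeasM => //; exact: cmeasJ.
      - exact: cmeas_cst.
      - by apply: filterS f12 => x ->; rewrite mulN1r addNr mul0r.
    have := congr1 (@complex.Re R) E0; rewrite /cint /= => <-.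
    by congr Rintegral; apply/funext => x; case: (-1 * f1 x + f2 x) => a b; rewrite /sqc /=; ring.
  have := bd' _ _ s; rewrite f0 mulr0 => u0.
  have : l2norm (fun x => -1 * u1 x + u2 x) = 0 by apply/eqP; rewrite eq_le u0 l2norm_ge0.
  move/(l2norm0_ae su); apply: filterS => x /eqP.
  by rewrite mulN1r addrC subr_eq0 eq_sym => /eqP.
- apply: (@le_lt_trans _ _ (2 * K0)%:E); last exact: ltry.
  apply: ge_ereal_sup => _ [f [u [/solvesP s f1 ->]]]; have [su sf _] := s.
  move: f1; rewrite !L2normE// !lee_fin => f1.
  apply: (le_trans (bd' _ _ s)); rewrite -[leRHS]mulr1 ler_wpM2l//.
  by rewrite mulr_ge0.
Qed.

(** The point s0 is essential: the infimum over an empty spectrum would be the default value 0. *)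
Lemma distC_gt0 z s0 : ~ spectrum P z -> spectrum P s0 -> 0 < distC z (spectrum P).
Proof.
move=> /contrapT /resolvent_set_open[r r0 H] Hs; apply: (lt_le_trans r0).
apply: lb_le_inf; first by exists (Normc.normc (z - s0)), s0.
move=> _ [s Ps <-]; rewrite leNgt; apply/negP => zs; exact: Ps (H _ zs).
Qed.

Lemma distC_le z s : spectrum P s -> distC z (spectrum P) <= Normc.normc (z - s).
Proof.
move=> Ps; apply: ge_inf; last by exists s.
by exists 0 => _ [w _ <-]; exact: normc_ge0.
Qed.

End resolvent_open.

(** * The theorem *)

Lemma symmetrize_term (K : comNzRingType) (t c d x y : K) :
  t * (c * x * y + d * y * x) = t * (c + d) * (y * x).
Proof. ring. Qed.

Lemma polarization_cancel (K : comNzRingType) (a b c d : K) :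
  a + b + (c + d) - a - d = b + c.
Proof. ring. Qed.

(** * The polarization of q and its Hamilton map *)

Section quadratic_form_facts.
Variables (R : realType) (n : nat) (q : 'rV[R]_(n + n) -> R[i]).
Hypothesis hq : quadratic_form q.

(** A matrix representing q need not be symmetric; the polarization is its symmetric part. *)
Lemma polar_mxE : exists c : 'M[R[i]]_(n + n),
  (forall X : 'rV[R]_(n + n), q X = \sum_a \sum_b c a b * (X ord0 a)%:C%C * (X ord0 b)%:C%C) /\
  polar_mx q = 2^-1 *: (c + c^T).
Proof.
have [c cE] := hq; exists c; split=> //.
pose B (X Y : 'rV[R]_(n + n)) : R[i] := \sum_a \sum_b c a b * (X ord0 a)%:C%C * (Y ord0 b)%:C%C.
have BDl X Y Z : B (X + Y) Z = B X Z + B Y Z.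
  rewrite /B -big_split; apply: eq_bigr => a _; rewrite -big_split; apply: eq_bigr => b _ /=.
  by rewrite mxE rmorphD mulrDr mulrDl.
have BDr X Y Z : B Z (X + Y) = B Z X + B Z Y.
  rewrite /B -big_split; apply: eq_bigr => a _; rewrite -big_split; apply: eq_bigr => b _ /=.
  by rewrite mxE rmorphD mulrDr.
have Bd i j : B (delta_mx ord0 i) (delta_mx ord0 j) = c i j.
  rewrite /B (bigD1 i)//= [X in _ + X]big1 ?addr0 => [|a ai]; last first.
    by rewrite big1// => b _; rewrite mxE eqxx (negbTE ai) mulr0 mul0r.
  rewrite (bigD1 j)//= big1 ?addr0 => [|b bj]; last by rewrite [_ ord0 b]mxE eqxx (negbTE bj) mulr0.
  by rewrite !mxE !eqxx !mulr1.
have qB X : q X = B X X by rewrite cE.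
apply/matrixP => i j; rewrite !mxE !qB BDl !BDr !Bd.
rewrite [LHS]mulrC; congr (_ * _).
exact: polarization_cancel.
Qed.

Lemma polar_mx_sym : (polar_mx q)^T = polar_mx q.
Proof.
have [c [_ ->]] := polar_mxE.
by apply/matrixP => i j; rewrite !mxE addrC.
Qed.

Lemma qf_Re_polar X : qf (map_mx (@complex.Re R) (polar_mx q)) X = complex.Re (q X).
Proof.
have [c [cE ->]] := polar_mxE.
have E2 : q X = \sum_a \sum_b c b a * (X ord0 b)%:C%C * (X ord0 a)%:C%C.
  by rewrite cE exchange_big.
have -> : q X = \sum_a \sum_b (2^-1 * (c a b + c b a)) * (X ord0 b * X ord0 a)%:C%C.
  transitivity (2^-1 * (\sum_a \sum_b c a b * (X ord0 a)%:C%C * (X ord0 b)%:C%C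
    + \sum_a \sum_b c b a * (X ord0 b)%:C%C * (X ord0 a)%:C%C)).
    rewrite -cE -E2.
    by rewrite -mulr2n mulrnAr -mulrnAl -[2^-1 *+ 2]mulr_natr mulVf ?mul1r// pnatr_eq0.
  rewrite -big_split mulr_sumr; apply: eq_bigr => a _ /=; rewrite -big_split mulr_sumr.
  apply: eq_bigr => b _ /=; rewrite [(X ord0 b * X ord0 a)%:C%C]rmorphM.
  exact: symmetrize_term.
rewrite qfE Re_sum; apply: eq_bigr => a _; rewrite Re_sum; apply: eq_bigr => b _.
by rewrite [RHS]ReM /= mulr0 subr0 -mulrA !mxE.
Qed.

Lemma polar_hamilton F : hamilton_map q F -> polar_mx q = F *m Jmx R n.
Proof.
move=> hF; rewrite -[F]hsubmxK mul_row_Jmx.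
apply/matrixP => a b; rewrite -{1}polar_mx_sym mxE.
have := hF (delta_mx ord0 b) (delta_mx ord0 a).
rewrite /polar -rowE trmx_delta -colE [col _ _ _ _]mxE [row _ _ _ _]mxE => ->.
rewrite /symplectic_form -rowE.
case: (split_ordP b) => j ->; rewrite ?row_mxEl ?row_mxEr.
  rewrite (bigD1 j)//= big1 ?addr0 => [|k kj].
    by rewrite !mxE !eqxx /= eq_rlshift mul0r sub0r mul1r.
  by rewrite !mxE !eqxx /= eq_rlshift (inj_eq (@lshift_inj _ _)) (negbTE kj) !mul0r subrr.
rewrite (bigD1 j)//= big1 ?addr0 => [|k kj].
  by rewrite !mxE !eqxx /= eq_lrshift mul0r subr0 mul1r.
by rewrite !mxE !eqxx /= eq_lrshift (inj_eq (@rshift_inj _ _)) (negbTE kj) !mul0r subrr.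
Qed.

End quadratic_form_facts.

(** * Transfer of the estimates from Pol to the operator on L^2 *)

Section weyl_resolvent.
Variables (R : realType) (n : nat) (q : 'rV[R]_(n + n) -> R[i]) (M : 'M[R[i]]_n) (h : R).
Local Notation lam := (lebesgue_Rn R n).
Local Notation Q := (polar_mx q).
Local Notation T := (Tq (Lp M h) Q).
Hypothesis MT : M^T = M.
Hypothesis Mpos : forall x : 'rV[R]_n, x != 0 -> 0 < qf (map_mx (@complex.Re R) M) x.
Hypothesis h0 : 0 < h.
Hypothesis Qs : Q^T = Q.

Lemma nm_l2norm p : nm (ipp M h) p = l2norm (ev M h p).
Proof. by rewrite /nm ippvv. Qed.

Lemma solves_pair z f u p : solves q h z f u ->
  pair M h f p = pair M h u (T p - z *: p).
Proof.
move=> [su sf H].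
have sg : sqint lam (fun x => f x + z * u x) by apply: sqintD => //; exact: sqintZ.
have E := weyl_pairing MT Mpos h0 p Qs su sg H.
have I v : sqint lam v -> cintg lam (fun x => v x * ev M h p x).
  by move=> sv; exact: (sqint_prod sv (sqint_ev MT Mpos h0 p)).
have E2 : pair M h (fun x => f x + z * u x) p = pair M h f p + z * pair M h u p.
  rewrite /pair -cintZ; last exact: I.
  rewrite -cintD; [|exact: I|by apply: cintgZ; exact: I].
  by congr cint; apply/funext => x; rewrite mulrDl mulrA.
have := pair_linear MT Mpos h0 (- z) p (T p) su.
rewrite scaleNr [- _ + _]addrC => ->; rewrite -E E2 mulNr addrC addrK.
by [].
Qed.

(** Lets e tend to 0: if c < a, the chosen e makes the error (c + a) e equal to half of a (a - c), a
    contradiction. *)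
Lemma quadratic_le (a c : R) : 0 <= a -> 0 <= c ->
  (forall e, 0 < e -> a ^+ 2 <= c * (a + e) + a * e) -> a <= c.
Proof.
move=> a0 c0 H; rewrite leNgt; apply/negP => ca.
have ap : 0 < a by exact: le_lt_trans ca.
have s0 : 0 < c + a by rewrite ltr_wpDl.
have e0 : 0 < a * (a - c) / (2 * (c + a)) by rewrite divr_gt0 ?mulr_gt0 ?subr_gt0.
have := H _ e0; set e := _ / _.
have E : (c + a) * e = a * (a - c) / 2 by rewrite /e; field; rewrite gt_eqF.
have -> : c * (a + e) + a * e = c * a + (c + a) * e by ring.
rewrite E => {}H; have : 0 < a * (a - c) by rewrite mulr_gt0// subr_gt0.
by move: H; rewrite expr2 mulrBr [c * a]mulrC; move: (a * a) (a * c) => x y; lra.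
Qed.

(** |u|^2 is the bilinear pairing of u with conj u. The latter is approximated by r = (T - z) p in
    Pol, and the pairing of u with r equals that of f with p, at most |f| K |r|. *)
Lemma solves_bound z K f u : 0 <= K -> (forall r, exists p, T p - z *: p = r) ->
  (forall p, nm (ipp M h) p <= K * nm (ipp M h) (T p - z *: p)) ->
  solves q h z f u -> l2norm u <= K * l2norm f.
Proof.
move=> K0 sur est s; have [su sf _] := s.
apply: quadratic_le; rewrite ?mulr_ge0 ?l2norm_ge0// => e e0.
have sJ := sqintJ su.
have [_ /(_ _ (exprn_gt0 2 e0))[r re]] := approx_all MT Mpos h0 sJ.
have sr := sqint_ev MT Mpos h0 r.
have re' : l2norm (fun x => (u x)^*%C - ev M h r x) <= e.
  by rewrite -(@ler_pXn2r _ 2) ?nnegrE ?l2norm_ge0 ?(ltW e0)// l2norm_sqr.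
have sd := sqintB sJ sr.
have nr : l2norm (ev M h r) <= l2norm u + e.
  have -> : ev M h r = fun x => (u x)^*%C + -1 * ((u x)^*%C - ev M h r x).
    by apply/funext => x; rewrite mulN1r opprB addrC subrK.
  apply: (le_trans (l2normD sJ (sqintZ (-1) sd))); rewrite l2normJ lerD2l l2normZ//.
  by rewrite /= oppr0 expr0n /= addr0 sqrrN expr1n sqrtr1 mul1r.
have E : cint lam (fun x => u x * (u x)^*%C) =
    pair M h u r + cint lam (fun x => u x * ((u x)^*%C - ev M h r x)).
  rewrite /pair -cintD; [|exact: (sqint_prod su sr)|exact: (sqint_prod su sd)].
  by congr cint; apply/funext => x; rewrite -mulrDr addrC subrK.
have E2 : l2norm u ^+ 2 = complex.Re (cint lam (fun x => u x * (u x)^*%C)).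
  rewrite l2norm_sqr /sqmass /cint /=; congr Rintegral; apply/funext => x.
  by case: (u x) => a b; rewrite /sqc /=; ring.
rewrite E2; apply: (le_trans (Re_le_normc _)); rewrite E.
apply: (le_trans (le_normcD _ _)); apply: lerD; last first.
  apply: (le_trans (cint_le su sd)); apply: ler_wpM2l => //; exact: l2norm_ge0.
have [p pr] := sur r; rewrite -pr -(solves_pair p s).
apply: (le_trans (cint_le sf (sqint_ev MT Mpos h0 p))).
rewrite [K * _]mulrC -mulrA; apply: ler_wpM2l; first exact: l2norm_ge0.
have := est p; rewrite pr !nm_l2norm => /le_trans; apply.
exact: ler_wpM2l.
Qed.

(** If P - s were onto, it would reach conj w by some u; pairing with w gives |w|^2 as the pairing
    of u with (T - s) w = 0. *)
Lemma eigenvalue_spectrum s w : 0 < nm (ipp M h) w -> T w = s *: w ->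
  spectrum (weyl_op q h) s.
Proof.
move=> w0 Tw [[ex _] _].
have sw := sqint_ev MT Mpos h0 w.
have [u /solvesP sol] := ex _ ((L2_sqint _).2 (sqintJ sw)).
have := solves_pair w sol; rewrite Tw subrr.
have -> : pair M h u 0 = 0.
  have [su _ _] := sol; have := pair_linear MT Mpos h0 1 0 0 su.
  rewrite scale1r mul1r addr0 => /eqP.
  by rewrite -subr_eq0 opprD addrA subrr sub0r oppr_eq0 => /eqP.
move/(congr1 (@complex.Re R)) => H.
have : nm (ipp M h) w ^+ 2 = 0.
  rewrite nm_l2norm l2norm_sqr -[RHS]H /pair /cint /sqmass /=; congr Rintegral.
  by apply/funext => x; case: (ev M h w x) => a b; rewrite /sqc /=; ring.
by move/eqP; rewrite sqrf_eq0 gt_eqF.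
Qed.

End weyl_resolvent.

Lemma compact_normc_bounded (R : realType) (Omega : set R[i]^o) : compact (closure Omega) ->
  exists B : R, forall z, Omega z -> Normc.normc z <= B.
Proof.
rewrite compact_cover => /(_ nat setT (fun k => ball (0 : R[i]^o) k%:R)).
have nC (z : R[i]) : `|z| = (Normc.normc z)%:C%C by [].
case=> [k _|z _|D _ DO].
- exact: ball_open.
- exists (Num.truncn (Normc.normc z)).+1 => //.
  rewrite -ball_normE /= sub0r normrN nC -(rmorph_nat (real_complex R)) ltcR.
  exact: truncnS_gt.
(* The sum of the finitely many radii dominates each of them. *)
exists (\sum_(k <- finmap.enum_fset D) k)%:R => z Oz.
have [k kD] := DO _ (subset_closure Oz).
rewrite -ball_normE /= sub0r normrN nC -(rmorph_nat (real_complex R)) ltcR => /ltW zk.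
apply: (le_trans zk); rewrite ler_nat.
have kE : k \in finmap.enum_fset D by exact: kD.
by rewrite (big_rem k kE) leq_addr.
Qed.

Theorem mainTheorem2 (R : realType) (n : nat)
    (q : 'rV[R]_(n + n) -> R[i]) (F : 'M[R[i]]_(n + n)) (Omega : set R[i]^o)
    (hq : quadratic_form q) (hRe : Re_positive_definite q)
    (hF : hamilton_map q F) (hdiag : diagonalizable F)
    (hOmega : compact (closure Omega)) :
  exists h0 A : R, [/\ 0 < h0, 0 < A &
    forall h : R, 0 < h <= h0 ->
    forall z : R[i], Omega z -> ~ spectrum (weyl_op q h) z ->
      (opnorm (resolvent (weyl_op q h) z) <=
       (A * expR (A / h) / distC z (spectrum (weyl_op q h)))%:E)%E].
Proof.
have Qs := polar_mx_sym hq.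
have Qpos (X : 'rV[R]_(n + n)) : X != 0 -> 0 < qf (map_mx (@complex.Re R) (polar_mx q)) X.
  by move=> X0; rewrite qf_Re_polar//; exact: hRe.
have [M [I [g [d [kap [[MT Mpos] gk gdk [dann annQ] gspan]]]]]] :=
  symplectic_structure Qs Qpos (polar_hamilton hq hF) hdiag.
have geig i := (gk i).2; have gg i k := (gdk i k).1; have dg i k := (gdk i k).2.
have [c1 c1p c1Q] := posdef_lowerC Qs Qpos.
have [Gu GT GJ [c2 c2p c2G]] := posdef_inv_lowerC MT Mpos.
have [c5 c5p c5H] := mx_upper (Hmx M).
have Gam_ge0 j : 0 <= complex.Re ((M + map_mx (@conjc R) M) j j).
  have := Mpos (delta_mx ord0 j).
  rewrite /qf -rowE trmx_delta -colE !mxE ReD ReJ => H.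
  rewrite addr_ge0//; apply: ltW; apply: H; apply/eqP => /rowP/(_ j)/eqP;
  by rewrite !mxE !eqxx oner_eq0.
have [B zB] := compact_normc_bounded hOmega.
pose c := cstA (polar_mx q) M g d c1 c2 c5 B.
(* All data entering c are fixed before h, which affects only the representation; |c| + 1 is a
   positive majorant of c. *)
exists 1, (`|c| + 1); split; [exact: ltr01|by rewrite ltr_wpDl|move=> h /andP[h0 h1] z Oz zS].
have Ll a (e : R[i]) u v : Lp M h a (e *: u + v) = e *: Lp M h a u + Lp M h a v by exact: Lp_linear.
have ccr a b v : Lp M h a (Lp M h b v) = Lp M h b (Lp M h a v) + (- 'i%C * h%:C%C * Jmx R n a b) *: v.
  exact: Lp_ccr.
have ipL (a : R[i]) u v w : ipp M h (a *: u + v) w = a * ipp M h u w + ipp M h v w by exact: ipp_linear.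
have ipJ u v : ipp M h v u = (ipp M h u v)^*%C by exact: ippJ.
have ip_ge0 v : 0 <= complex.Re (ipp M h v v) by exact: ipp_ge0.
have Lsym a u v : ipp M h (Lp M h a u) v = ipp M h u (Lp M h a v) by exact: Lp_sym.
have ip_pos := ipp_pos MT Mpos h0.
have vac j : op (Lp M h) (row j (annmx M)) (mpolyC n 1) = 0 by exact: ann_vac.
have vac_uniq w : (forall j, op (Lp M h) (row j (annmx M)) w = 0) -> exists e, w = e *: mpolyC n 1.
  exact: ann_vac_uniq.
have gen p : exists N, wspan (fun j => op (Lp M h) (row j (cremx M))) (mpolyC n 1) (leq^~ N) p.
  exact: pol_gen.
have nv0 : 0 < nm (ipp M h) (mpolyC n 1).
  by apply: nm_gt0 => // x; rewrite pevC oner_eq0.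
have [z0 T0] := T_vac Qs annQ Ll ccr vac vac_uniq.
have spec nu : spectrum (weyl_op q h) (zev kap h z0 nu).
  have [w [w0 Tw]] := fock_eigenvector Qs MT geig gg dg dann Gu GT GJ c2p c2G Gam_ge0
    h0 Ll ccr ipL ipJ ip_ge0 Lsym ip_pos vac nv0 nu T0.
  exact: (eigenvalue_spectrum MT Mpos h0 Qs w0 Tw).
have del0 := distC_gt0 zS (spec (fun=> 0%N)).
set del := distC _ _ in del0 *.
have dist nu : del <= Normc.normc (zev kap h z0 nu - z).
  by rewrite -opprB normcN; exact: distC_le.
have est p := fock_estimate Qs MT geig gg dg dann gspan c1p c1Q Gu GT GJ c2p c2G Gam_ge0
  h0 Ll ccr ipL ipJ ip_ge0 Lsym ip_pos vac gen nv0 c5p c5H p h1 T0 (zB z Oz) del0 dist.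
have sur := fock_surjective Qs geig gspan Ll ccr vac gen T0 (z := z).
have {}sur r : exists w, Tq (Lp M h) (polar_mx q) w - z *: w = r.
  apply: sur => nu; apply/eqP => E.
  by have := dist nu; rewrite E subrr Normc.normc0 leNgt del0.
have hV : 0 <= h^-1 by rewrite invr_ge0 ltW.
have cA : c <= `|c| + 1 by rewrite (le_trans (ler_norm _))// lerDl.
have A0 : 0 <= `|c| + 1 by rewrite addr_ge0.
have bound : c * expR (c / h) / del <= (`|c| + 1) * expR ((`|c| + 1) / h) / del.
  rewrite ler_pM2r ?invr_gt0//.
  apply: (@le_trans _ _ ((`|c| + 1) * expR (c / h))); first by rewrite ler_pM2r ?expR_gt0.
  by apply: ler_wpM2l => //; rewrite ler_expR ler_wpM2r.
set K := (`|c| + 1) * _ / _ in bound *.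
have K0 : 0 <= K by rewrite /K divr_ge0 ?mulr_ge0 ?expR_ge0 ?(ltW del0).
apply: ge_ereal_sup => _ [f [u [/solvesP s f1 ->]]]; have [su sf _] := s.
move: f1; rewrite !L2normE// !lee_fin => f1.
apply: (@le_trans _ _ (K * l2norm f)); last by rewrite -[leRHS]mulr1 ler_wpM2l.
apply: (solves_bound MT Mpos h0 Qs K0 sur _ s) => p.
apply: (le_trans (est p)).
exact: (ler_wpM2r (nm_ge0 (ipp M h) _) bound).
Qed.
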